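(* Let $v$ be a finite place of $K$. The false Eisenstein series $E = \sum_{a \in A_+} a\, u_a$ is a $v$-adic modular form in $\mathcal{M}_2^1(A_v)$, i.e. it lies in $A_v[[u]]$ and is a $v$-adic modular form of weight $2$ and type $1$.
   Context: $A=\mathbb{F}_q[\theta]$ ($q$ a power of the prime $p$), $K=\mathbb{F}_q(\theta)$, $A_+$ the monic elements of $A$. The Carlitz module is given by $C_\theta(x)=\theta x+x^q$, $e_C$ is the Carlitz exponential with kernel $A\tilde\pi$, $u(z)=1/e_C(\tilde\pi z)$, and for $a\in A_+$, $u_a := u^{q^{\deg a}}/R_a(u)\in A[[u]]$ with $R_a(u)=u^{q^{\deg a}}C_a(1/u)$ (so $u_a(z)=u(az)$). $E$ is the $u$-expansion of Gekeler's false Eisenstein series $\tilde\pi^{-1}\sum_{a\in A_+}\sum_{b\in A}a/(az+b)$. For the finite place $v$ (monic irreducible generator $\wp$, degree $d$, completions $A_v,K_v$): $K\otimes_AA_v[[u]]$ denotes power series over $K_v$ with bounded denominators, $\|f\|_v=q^{-\min_n\mathrm{ord}_v(c_n)}$ for $f=\sum c_nu^n$; $\mathbb{S}=\mathbb{Z}/(q^d-1)\mathbb{Z}\times\mathbb{Z}_p$ with $\mathbb{Z}\hookrightarrow\mathbb{S}$, $n\mapsto(n\bmod q^d-1,n)$. Drinfeld modular forms of weight $k$ and type $m\in\mathbb{Z}/(q-1)\mathbb{Z}$ are rigid analytic $f$ on $\Omega=\mathbb{C}_\infty\setminus\mathbb{F}_q((1/\theta))$ with $f(\gamma z)=(\det\gamma)^{-m}(cz+d)^kf(z)$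 for $\gamma\in\mathrm{GL}_2(A)$ and a $u$-expansion; $M_k^m(K)$ those with coefficients in $K$. A $v$-adic modular form of weight $s\in\mathbb{S}$ and type $m$ is $f\in K\otimes_AA_v[[u]]$ with $f_i\in M_{k_i}^m(K)$, $\|f_i-f\|_v\to0$, $k_i\to s$ in $\mathbb{S}$; $\mathcal{M}_s^m$ is their space and $\mathcal{M}_s^m(A_v)=\mathcal{M}_s^m\cap A_v[[u]]$. *)

(* Defs.v *)
From HB Require Import structures.
From mathcomp Require Import all_boot all_order all_algebra.
From mathcomp Require Import all_classical all_reals all_analysis.

Set Implicit Arguments.
Unset Strict Implicit.
Unset Printing Implicit Defensive.

Import Order.TTheory GRing.Theory Num.Theory.
Import numFieldNormedType.Exports.

Local Open Scope classical_set_scope.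
Local Open Scope ring_scope.

Record absval (R : realType) (L : fieldType) := AbsVal {
  absval_fun :> L -> R;
  absval_ge0 : forall x, 0 <= absval_fun x;
  absval_eq0 : forall x, absval_fun x = 0 <-> x = 0;
  absvalM : forall x y, absval_fun (x * y) = absval_fun x * absval_fun y;
  absval1 : absval_fun 1 = 1;
  absvalD : forall x y,
    absval_fun (x + y) <= Num.max (absval_fun x) (absval_fun y) }.

Section Convergence.
Variables (R : realType) (L : fieldType) (w : absval R L).

Definition av_cvg (s : nat -> L) (l : L) : Prop :=
  (fun n => w (s n - l)) @ \oo --> (0 : R).

Definition av_cauchy (s : nat -> L) : Prop :=
  forall e : R, 0 < e -> exists N : nat,
    forall m n : nat, (N <= m)%N -> (N <= n)%N -> w (s m - s n) < e.

Definition av_complete : Prop :=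
  forall s : nat -> L, av_cauchy s -> exists l : L, av_cvg s l.

Definition av_dense (X : set L) : Prop :=
  forall (y : L) (e : R), 0 < e -> exists2 x : L, X x & w (y - x) < e.

(* The limit of [s] when it exists, and 0 otherwise. *)
Definition av_lim (s : nat -> L) : L := xget 0 [set l | av_cvg s l].

End Convergence.

Definition ratK (F : finFieldType) : fieldType := {fraction {poly F}}.

Definition injA (F : finFieldType) (a : {poly F}) : ratK F := FracField.tofrac a.

Definition deg (F : finFieldType) (a : {poly F}) : nat := (size a).-1.

(* [K_v] with the absolute value |x|_v = q^(- ord_v x); it is determined up to
   a unique isometric K-isomorphism by being complete with [K] dense in it.
   Note the base q (not q^d) of the normalization. *)
Record completion_at (R : realType) (F : finFieldType) (wp : {poly F}) := {
  Kv_field :> fieldType;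
  Kv_inj : {rmorphism ratK F -> Kv_field};
  Kv_abs : absval R Kv_field;
  Kv_absE : forall (n : nat) (b : {poly F}), ~~ (wp %| b) ->
    Kv_abs (Kv_inj (injA (wp ^+ n * b))) = #|F|%:R ^- n;
  Kv_complete : av_complete Kv_abs;
  Kv_dense : av_dense Kv_abs (range Kv_inj) }.

Section FinitePlace.
Variables (R : realType) (F : finFieldType) (wp : {poly F}).
Variable Kv : completion_at R wp.

Definition Av : set Kv := [set x | Kv_abs Kv x <= 1].

(* For [f = \sum_n c_n u^n] this is sup_n |c_n|_v = q^(- min_n ord_v c_n), with
   value [+oo] exactly when the coefficients have unbounded denominators. *)
Definition vnorm (f : nat -> Kv) : \bar R :=
  ereal_sup (range (fun n => (Kv_abs Kv (f n))%:E)).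

(* The space K \otimes_A A_v[[u]]. *)
Definition bounded_den (f : nat -> Kv) : Prop := (vnorm f < +oo)%E.

End FinitePlace.

Section LaurentSeries.
Variables (R : realType) (F : finFieldType) (C : fieldType).
Variables (iota : {rmorphism ratK F -> C}) (w : absval R C).

Definition theta : C := iota (injA 'X).

(* [F_q((1/theta))]: sums of series \sum_i c_i theta^(N - i), [c_i] in F_q. *)
Definition laurent_infty : set C := [set x | exists (N : nat) (c : nat -> F),
  av_cvg w (fun n => \sum_(i < n) iota (injA (c i)%:P) * theta ^ (N%:Z - i%:Z))
    x].

Definition algebraic_over_laurent : set C := [set x | exists p : {poly C},
  [/\ p != 0, forall i, laurent_infty p`_i & root p x]].

End LaurentSeries.

(* Complete, algebraically closed, with the elements algebraic over
   [F_q((1/theta))] dense: this determines [C_oo] up to isometric isomorphism. *)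
Record complex_infty (R : realType) (F : finFieldType) := {
  Coo_field :> closedFieldType;
  Coo_inj : {rmorphism ratK F -> Coo_field};
  Coo_abs : absval R Coo_field;
  Coo_absE : forall a : {poly F}, a != 0 ->
    Coo_abs (Coo_inj (injA a)) = #|F|%:R ^+ deg a;
  Coo_complete : av_complete Coo_abs;
  Coo_dense : av_dense Coo_abs (algebraic_over_laurent Coo_inj Coo_abs) }.

Section DrinfeldModularForms.
Variables (R : realType) (F : finFieldType) (C : complex_infty R F).

Local Notation q := #|F|.
Local Notation "`| x |" := (Coo_abs C x).
Local Notation iA a := (Coo_inj C (injA a)).
Local Notation th := (theta (Coo_inj C)).

Definition Koo : set C := laurent_infty (Coo_inj C) (Coo_abs C).

Definition Omega : set C := ~` Koo.

(* The affinoids |z| <= q^n, |z - x| >= q^(-n) for all x in F_q((1/theta)),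
   which form the standard admissible covering of [Omega]. *)
Definition Omega_aff (n : nat) : set C := [set z |
  `|z| <= q%:R ^+ n /\ forall x, Koo x -> q%:R ^- n <= `|z - x|].

(* Uniform limit, on each of the affinoids, of rational functions without poles
   there. *)
Definition rigid_analytic (f : C -> C) : Prop :=
  forall (n : nat) (e : R), 0 < e -> exists P Q : {poly C},
    forall z, Omega_aff n z -> Q.[z] != 0 /\ `|f z - P.[z] / Q.[z]| < e.

(* The Carlitz exponential \sum_i z^(q^i) / D_i, with
   D_i = \prod_(j < i) (theta^(q^i) - theta^(q^j)). *)
Definition carlitz_D (i : nat) : C :=
  \prod_(j < i) (th ^+ (q ^ i) - th ^+ (q ^ j)).

Definition carlitz_exp (z : C) : C :=
  av_lim (Coo_abs C) (fun n => \sum_(i < n) z ^+ (q ^ i) / carlitz_D i).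

Definition carlitz_period (tpi : C) : Prop :=
  forall z : C, carlitz_exp z = 0 <-> exists a : {poly F}, z = iA a * tpi.

Definition u_param (tpi z : C) : C := (carlitz_exp (tpi * z))^-1.

(* [f z = \sum_n c_n u(z)^n] for all [z] at distance at least some [r > 0] from
   [F_q((1/theta))], i.e. for all z with |u(z)| small. *)
Definition has_u_expansion (tpi : C) (f : C -> C) (c : nat -> C) : Prop :=
  exists2 r : R, 0 < r & forall z, (forall x, Koo x -> r <= `|z - x|) ->
    av_cvg (Coo_abs C) (fun n => \sum_(i < n) c i * u_param tpi z ^+ i) (f z).

(* The type in Z/(q-1)Z is given by an integer representative [m]: since
   \det g lies in F_q^*, only the class of [m] modulo q - 1 matters. *)
Definition modular_transf (k m : int) (f : C -> C) : Prop :=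
  forall g : 'M[{poly F}]_2, g \in unitmx -> forall z, Omega z ->
    let az_b := iA (g 0 0) * z + iA (g 0 1) in
    let cz_d := iA (g 1 0) * z + iA (g 1 1) in
    f (az_b / cz_d) = iA (\det g) ^ (- m) * cz_d ^ k * f z.

(* [M_k^m(K)], a form being identified with its u-expansion [c]. *)
Definition drinfeld_modular (tpi : C) (k m : int) : set (nat -> ratK F) :=
  [set c | exists f : C -> C, [/\ rigid_analytic f, modular_transf k m f
    & has_u_expansion tpi f (fun n => Coo_inj C (c n))]].

End DrinfeldModularForms.

(* Residues modulo [N > 0], as ['I_N]; ['Z_N] would be wrong for [N = 1], which
   happens for q = 2 and d = 1. *)
Definition residue (N : nat) : Type := 'I_N.-1.+1.

Definition res_of_int (N : nat) (k : int) : residue N := inord `|(k %% N)%Z|%N.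

(* Z_p as the inverse limit of the Z/p^n. *)
Record padic_int (p : nat) := PadicInt {
  padic_res :> forall n : nat, residue (p ^ n);
  padic_coh : forall n : nat, padic_res n.+1 = padic_res n %[mod p ^ n] }.

Lemma padic_of_int_coh (p : nat) (hp : prime p) (k : int) (n : nat) :
  res_of_int (p ^ n.+1) k = res_of_int (p ^ n) k %[mod p ^ n].
Proof.
have resE m : (res_of_int (p ^ m) k : nat) = `|(k %% (p ^ m)%N)%Z|%N.
  have pm : (0 < p ^ m)%N by rewrite expn_gt0 prime_gt0.
  by rewrite /res_of_int inordK // prednK // -ltz_nat gez0_abs ?modz_ge0 //
    ?ltz_pmod // eqz_nat -lt0n.
have pn m : ((p ^ m)%N : int) != 0 by rewrite eqz_nat -lt0n expn_gt0 prime_gt0.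
rewrite !resE; apply/eqP; rewrite -eqz_nat -!modz_nat !gez0_abs ?modz_ge0 //.
apply/eqP; have eP : Posz (p ^ n.+1) = Posz p * Posz (p ^ n) by rewrite expnS.
set x := (_ %% _)%Z; rewrite modz_mod.
by rewrite [in RHS](divz_eq k (p ^ n.+1)%N) {2}eP mulrA modzMDl.
Qed.

Definition padic_of_int (p : nat) (hp : prime p) (k : int) : padic_int p :=
  PadicInt (padic_of_int_coh hp k).

Definition weight (q d p : nat) : Type :=
  (residue (q ^ d - 1) * padic_int p)%type.

Definition weight_of_int (q d p : nat) (hp : prime p) (k : int) :
  weight q d p := (res_of_int (q ^ d - 1) k, padic_of_int hp k).

(* Convergence for the product of the discrete and the p-adic topology. *)
Definition weight_cvg (q d p : nat) (s : nat -> weight q d p)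
    (t : weight q d p) : Prop :=
  (\forall i \near \oo, (s i).1 = t.1) /\
  (forall n : nat, \forall i \near \oo, (s i).2 n = t.2 n).

Section VadicModularForms.
Variables (R : realType) (F : finFieldType) (wp : {poly F}).
Variables (Kv : completion_at R wp) (C : complex_infty R F) (tpi : C).
Variables (p : nat) (hp : prime p).

Definition vadic_modular (s : weight #|F| (deg wp) p) (m : int) :
    set (nat -> Kv) :=
  [set f | bounded_den f /\
    exists (k : nat -> int) (g : nat -> nat -> ratK F),
    [/\ forall i, drinfeld_modular tpi (k i) m (g i),
        (fun i => vnorm (fun n => Kv_inj Kv (g i n) - f n)) @ \oo -->
          (0 : \bar R)
      & weight_cvg (fun i => weight_of_int #|F| (deg wp) hp (k i)) s]].

Definition vadic_modular_int (s : weight #|F| (deg wp) p) (m : int) :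
    set (nat -> Kv) :=
  vadic_modular s m `&` [set f | forall n, Av (f n)].

End VadicModularForms.

Section FalseEisenstein.
Variable F : finFieldType.
Local Notation q := #|F|.

(* [C_theta (x) = theta x + x^q]; the outer variable of {poly {poly F}} is x, and
   C_a = \sum_i a_i C_(theta^i) for a = \sum_i a_i theta^i. *)
Definition carlitz_theta (x : {poly {poly F}}) : {poly {poly F}} :=
  ('X : {poly F})%:P * x + x ^+ q.

Definition carlitz (a : {poly F}) : {poly {poly F}} :=
  \sum_(i < size a) (a`_i)%:P%:P * iter i carlitz_theta 'X.

(* R_a(u) = u^(q^deg a) C_a(1/u). *)
Definition carlitz_rev (a : {poly F}) : {poly {poly F}} :=
  \poly_(j < (q ^ deg a).+1) (carlitz a)`_(q ^ deg a - j).

(* Coefficients of the power series 1/P = \sum_k (1 - P)^k, for P(0) = 1. *)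
Definition ps_inv (B : nzRingType) (P : {poly B}) (n : nat) : B :=
  (\sum_(k < n.+1) (1 - P) ^+ k)`_n.

(* u_a = u^(q^deg a) / R_a(u), for [a] monic (so that R_a(0) = 1). *)
Definition u_series (a : {poly F}) (n : nat) : {poly F} :=
  if (n < q ^ deg a)%N then 0 else ps_inv (carlitz_rev a) (n - q ^ deg a).

(* E = \sum_a a u_a over monic [a]. The monic polynomials of degree j are the
   'X^j + rVpoly c, and those of degree j > n contribute nothing to the
   coefficient of u^n since q^j > n. *)
Definition false_eisenstein (n : nat) : {poly F} :=
  \sum_(j < n.+1) \sum_(c : 'rV[F]_j)
    ('X^j + rVpoly c) * u_series ('X^j + rVpoly c) n.

End FalseEisenstein.

(* Main.v *)
(** Put A = F_q[theta], Q = q^n and L_n = \prod_(1 <= j <= n) (theta^(q^j) - theta).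
    The Eisenstein series of weight Q - 1, divided by its constant term, is
      g = 1 + \sum_(a monic) \sum_(i < n) (-1)^(n - i) (L_n / L_i) u_a^(Q - q^i),
    and, with h = \sum_(a monic) a u_a^Q,
      X = E g - (-1)^n L_n h
    is a modular form of weight Q + 1 and type 1: up to a constant factor it is
    the derivative of g corrected by E. When the degree d of wp divides n, every
    factor L_n / L_i above is divisible by wp, so g = 1 mod wp and
    g^(p^i) = 1 mod wp^(p^i); moreover L_n is divisible by wp^(n / d). Hence, for
    n = d (i + 1), the form X g^(p^i - 1) is congruent to E mod wp^i, and its
    weight 2 + p^i (Q - 1) tends to 2.

    Under z -> 1/z, X is the limit of sums over the boxes deg a, deg b < N, for
    which the transformation law is an identity of finite sums: the failure of
    E itself to be modular comes from the missing pair (0, 0), and cancels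
    against the one of h. The sums of (w + b)^(-k) over deg b < N are evaluated
    by adding one line F_q theta^N at a time, which yields recursively the
    finite exponentials (tending to the Carlitz exponential) and the
    coefficients of their logarithms. *)

Require Import Defs.
From HB Require Import structures.
From mathcomp Require Import all_boot all_order all_algebra all_field.
From mathcomp Require Import all_classical all_reals all_analysis.
From mathcomp Require Import zify ring.

Set Implicit Arguments.
Unset Strict Implicit.
Unset Printing Implicit Defensive.

Import Order.TTheory GRing.Theory Num.Theory.
Import numFieldNormedType.Exports.

Local Open Scope classical_set_scope.
Local Open Scope ring_scope.

(** * Nonarchimedean convergence *)

(** The terms a / (a z + b) of the double series for E do not tend to 0 (take b = 0), so the order
    of summation matters. Square boxes are invariant under the exchange of a and b induced by z ->
    1/z, but their convergence to the iterated sum needs bounds on the inner sums that are uniform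
    in the box; for E such a bound only appears after a first sum over the constants b.

    The period is known only through the kernel of the Carlitz exponential, whereas the u-expansions
    must have coefficients in A. The bridge is the exponential of the lattice A: its functional
    equation under multiplication by theta is that of the Carlitz module up to a scaling, and this
    yields tpi^(q - 1). The same multiplication gives a recursion for the coefficients of its
    logarithm, hence their closed form (-1)^n tpi^(q^n - 1) / L_n. The powers of tpi then cancel in
    the normalized forms and leave the quotients L_n / L_i, the source of the congruences.

    The exponent of g is p^i - 1 because X already carries one factor g. *)

Section Absval.
Variables (R : realType) (L : fieldType) (w : absval R L).

Lemma absval0 : w 0 = 0.
Proof. exact/absval_eq0. Qed.

Lemma absval_neq0 x : (w x == 0) = (x == 0).
Proof. by apply/eqP/eqP; have [] := absval_eq0 w x. Qed.

Lemma absval_gt0 x : (0 < w x) = (x != 0).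
Proof. by rewrite lt_neqAle absval_ge0 andbT eq_sym absval_neq0. Qed.

Lemma absvalX x n : w (x ^+ n) = w x ^+ n.
Proof. by elim: n => [|n IH]; rewrite ?absval1 // !exprS absvalM IH. Qed.

Lemma absvalN x : w (- x) = w x.
Proof.
suff w1 : w (- 1) = 1 by rewrite -mulN1r absvalM w1 mul1r.
apply/eqP; rewrite -(@pexpr_eq1 _ _ 2) ?absval_ge0 //.
by rewrite -absvalX sqrrN expr1n absval1.
Qed.

Lemma absvalV x : w x^-1 = (w x)^-1.
Proof.
have [->|x0] := eqVneq x 0; first by rewrite invr0 absval0 invr0.
have wx0 : w x != 0 by rewrite absval_neq0.
by apply: (mulfI wx0); rewrite mulfV // -absvalM mulfV // absval1.
Qed.

Lemma absval_prod I (r : seq I) (P : pred I) (f : I -> L) :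
  w (\prod_(i <- r | P i) f i) = \prod_(i <- r | P i) w (f i).
Proof. by apply: (big_morph w); [exact: absvalM | exact: absval1]. Qed.

Lemma absvalD_le x y B : w x <= B -> w y <= B -> w (x + y) <= B.
Proof.
by move=> hx hy; apply: le_trans (absvalD w x y) _; rewrite ge_max hx.
Qed.

Lemma absvalB_le x y B : w x <= B -> w y <= B -> w (x - y) <= B.
Proof. by move=> hx hy; apply: absvalD_le; rewrite ?absvalN. Qed.

Lemma absvalD_lt x y B : w x < B -> w y < B -> w (x + y) < B.
Proof.
by move=> hx hy; apply: le_lt_trans (absvalD w x y) _; rewrite gt_max hx.
Qed.

Lemma absvalB_lt x y B : w x < B -> w y < B -> w (x - y) < B.
Proof. by move=> hx hy; apply: absvalD_lt; rewrite ?absvalN. Qed.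

Lemma absvalBC x y : w (x - y) = w (y - x).
Proof. by rewrite -absvalN opprB. Qed.

Lemma absvalD_isosceles x y : w y < w x -> w (x + y) = w x.
Proof.
move=> yx; apply/eqP; rewrite eq_le; apply/andP; split.
  by apply: absvalD_le => //; exact: ltW.
rewrite leNgt; apply/negP => h.
have : w (x + y - y) < w x by apply: absvalB_lt.
by rewrite addrK ltxx.
Qed.

Lemma absval_sum_le I (r : seq I) (P : pred I) (f : I -> L) B : 0 <= B ->
  (forall i, P i -> w (f i) <= B) -> w (\sum_(i <- r | P i) f i) <= B.
Proof.
move=> B0 h; elim/big_ind: _ => //; first by rewrite absval0.
by move=> x y; exact: absvalD_le.
Qed.

Lemma av_cvgP s l : av_cvg w s l <->
  forall e : R, 0 < e -> exists N, forall n, (N <= n)%N -> w (s n - l) <= e.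
Proof.
rewrite /av_cvg; split=> [/cvgrPdist_le h e e0|h].
  have [N _ hN] := h e e0; exists N => n Nn; have := hN n Nn.
  by rewrite sub0r normrN ger0_norm ?absval_ge0.
apply/cvgrPdist_le => e e0; have [N hN] := h e e0.
exists N => // n /= Nn; rewrite sub0r normrN ger0_norm ?absval_ge0 //.
exact: hN.
Qed.

Lemma av_cvg_unique s l m : av_cvg w s l -> av_cvg w s m -> l = m.
Proof.
move=> /av_cvgP hl /av_cvgP hm; apply/eqP; rewrite -subr_eq0 -absval_neq0.
rewrite eq_le absval_ge0 andbT; apply/ler_addgt0Pl => e e0; rewrite addr0.
have [N hN] := hl e e0; have [M hM] := hm e e0.
have -> : l - m = (s (maxn N M) - m) - (s (maxn N M) - l) by ring.
by apply: absvalB_le; [apply: hM; rewrite leq_maxr|apply: hN; rewrite leq_maxl].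
Qed.

Lemma av_limE s l : av_cvg w s l -> av_lim w s = l.
Proof.
move=> sl; rewrite /av_lim; case: xgetP => [x _ sx|/(_ l) //].
exact: av_cvg_unique sx sl.
Qed.

Lemma av_cvg_eventually s t l (N : nat) :
  (forall n, (N <= n)%N -> s n = t n) -> av_cvg w s l -> av_cvg w t l.
Proof.
move=> st /av_cvgP h; apply/av_cvgP => e /h[M hM].
exists (maxn N M) => n; rewrite geq_max => /andP[Nn Mn].
by rewrite -st //; exact: hM.
Qed.

Lemma av_cvg_ext s t l : (forall n, s n = t n) -> av_cvg w s l -> av_cvg w t l.
Proof. by move=> st; apply: (@av_cvg_eventually _ _ _ 0) => n _. Qed.

Lemma av_cvg_cst l : av_cvg w (fun=> l) l.
Proof.
by apply/av_cvgP => e e0; exists 0%N => n _; rewrite subrr absval0 ltW.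
Qed.

Lemma av_cvgD s t l m :
  av_cvg w s l -> av_cvg w t m -> av_cvg w (fun n => s n + t n) (l + m).
Proof.
move=> /av_cvgP hl /av_cvgP hm; apply/av_cvgP => e e0.
have [N hN] := hl e e0; have [M hM] := hm e e0.
exists (maxn N M) => n; rewrite geq_max => /andP[Nn Mn].
have -> : s n + t n - (l + m) = (s n - l) + (t n - m) by ring.
by apply: absvalD_le; [exact: hN|exact: hM].
Qed.

Lemma av_cvg_bounded s l : av_cvg w s l ->
  exists2 B : R, 0 < B & forall n, w (s n) <= B.
Proof.
move=> /av_cvgP /(_ 1 ltr01)[N hN].
exists (1 + w l + \sum_(i < N) w (s i)) => [|n].
  rewrite ltr_wpDr ?sumr_ge0 // => [i _|]; first exact: absval_ge0.
  by rewrite ltr_wpDr ?absval_ge0.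
have [nN|Nn] := ltnP n N.
  rewrite (bigD1 (Ordinal nN)) //= addrCA lerDl addr_ge0 ?sumr_ge0 //.
    by rewrite addr_ge0 ?absval_ge0.
  by move=> i _; exact: absval_ge0.
apply: (@le_trans _ _ (1 + w l)); last first.
  by rewrite lerDl sumr_ge0 // => i _; exact: absval_ge0.
have -> : s n = (s n - l) + l by ring.
apply: le_trans (absvalD w _ _) _; rewrite ge_max; apply/andP; split.
  by apply: le_trans (hN n Nn) _; rewrite lerDl absval_ge0.
by rewrite lerDr.
Qed.

Lemma av_cvgM s t l m :
  av_cvg w s l -> av_cvg w t m -> av_cvg w (fun n => s n * t n) (l * m).
Proof.
move=> hl hm; have [B B0 hB] := av_cvg_bounded hm.
move: hl hm => /av_cvgP hl /av_cvgP hm; apply/av_cvgP => e e0.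
have l0 : 0 < w l + 1 by rewrite ltr_wpDl ?absval_ge0.
have [N hN] := hl (e / B) (divr_gt0 e0 B0).
have [M hM] := hm (e / (w l + 1)) (divr_gt0 e0 l0).
exists (maxn N M) => n; rewrite geq_max => /andP[Nn Mn].
have -> : s n * t n - l * m = (s n - l) * t n + l * (t n - m) by ring.
apply: absvalD_le; rewrite absvalM.
  rewrite -[leRHS](divfK (lt0r_neq0 B0)).
  by apply: ler_pM; rewrite ?absval_ge0 ?hN.
rewrite -[leRHS](divfK (lt0r_neq0 l0)) mulrC.
by apply: ler_pM; rewrite ?absval_ge0 ?hM // lerDl.
Qed.

Lemma av_cvgZ s l c : av_cvg w s l -> av_cvg w (fun n => c * s n) (c * l).
Proof. exact: av_cvgM (av_cvg_cst c). Qed.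

Lemma av_cvgN s l : av_cvg w s l -> av_cvg w (fun n => - s n) (- l).
Proof.
move=> /(@av_cvgZ _ _ (-1)); rewrite mulN1r; apply: av_cvg_ext => n.
by rewrite mulN1r.
Qed.

Lemma av_cvgX s l k : av_cvg w s l -> av_cvg w (fun n => s n ^+ k) (l ^+ k).
Proof.
move=> sl; elim: k => [|k IH]; first exact: av_cvg_cst.
rewrite exprS; apply: av_cvg_ext (av_cvgM sl IH) => n.
by rewrite exprS.
Qed.

Lemma av_cvg_sum I (r : seq I) (s : I -> nat -> L) (l : I -> L) :
  (forall i, av_cvg w (s i) (l i)) ->
  av_cvg w (fun n => \sum_(i <- r) s i n) (\sum_(i <- r) l i).
Proof.
move=> h; elim: r => [|i r IH].
  by rewrite big_nil; apply: av_cvg_ext (av_cvg_cst 0) => n; rewrite big_nil.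
rewrite big_cons; apply: av_cvg_ext (av_cvgD (h i) IH) => n.
by rewrite big_cons.
Qed.

Lemma av_cvgS s l : av_cvg w s l -> av_cvg w (fun n => s n.+1) l.
Proof.
move=> /av_cvgP h; apply/av_cvgP => e /h[N hN]; exists N => n Nn.
by apply: hN; rewrite (leq_trans Nn).
Qed.

Lemma av_cvg_ball s l y B (N : nat) : av_cvg w s l ->
  (forall n, (N <= n)%N -> w (s n - y) <= B) -> w (l - y) <= B.
Proof.
move=> /av_cvgP h hB; apply/ler_addgt0Pl => e e0.
have [M hM] := h e e0; set n := maxn N M.
have -> : l - y = (s n - y) - (s n - l) by ring.
have h1 : w (s n - y) <= B by apply: hB; rewrite leq_maxl.
have h2 : w (s n - l) <= e by apply: hM; rewrite leq_maxr.
have B0 : 0 <= B := le_trans (absval_ge0 w _) h1.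
apply: absvalB_le; first by rewrite (le_trans h1) // lerDr ltW.
by rewrite (le_trans h2) // lerDl.
Qed.

Lemma av_cvg_le s l B (N : nat) : av_cvg w s l ->
  (forall n, (N <= n)%N -> w (s n) <= B) -> w l <= B.
Proof.
move=> sl h; rewrite -[l]subr0; apply: (@av_cvg_ball s l 0 B N) => // n Nn.
by rewrite subr0 h.
Qed.

(* In a nonarchimedean field a sequence with small consecutive differences is
   Cauchy. *)
Lemma av_step_le s e (N : nat) : 0 <= e ->
  (forall n, (N <= n)%N -> w (s n.+1 - s n) <= e) ->
  forall n, (N <= n)%N -> w (s n - s N) <= e.
Proof.
move=> e0 h n /subnK <-; elim: (n - N)%N => [|k IH].
  by rewrite subrr absval0.
have -> : s (k.+1 + N)%N - s N = (s (k.+1 + N)%N - s (k + N)%N) + (s (k + N)%N - s N).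
  by ring.
by apply: absvalD_le => //; rewrite addSn h // leq_addl.
Qed.

Hypothesis w_complete : av_complete w.

Lemma av_cvg_step s :
  (forall e : R, 0 < e -> exists N : nat,
    forall n, (N <= n)%N -> w (s n.+1 - s n) <= e) ->
  exists l, av_cvg w s l.
Proof.
move=> h; apply: w_complete => e e0.
have e20 : 0 < e / 2 by rewrite divr_gt0.
have [N hN] := h (e / 2) e20.
exists N => m n Nm Nn.
have -> : s m - s n = (s m - s N) - (s n - s N) by ring.
apply: (@le_lt_trans _ _ (e / 2)).
  by apply: absvalB_le; apply: av_step_le => //; exact: ltW.
by rewrite ltr_pdivrMr // ltr_pMr // ltr1n.
Qed.

Lemma av_cvg_series x : av_cvg w x 0 ->
  exists l, av_cvg w (fun n => \sum_(i < n) x i) l.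
Proof.
move=> /av_cvgP h; apply: av_cvg_step => e /h[N hN]; exists N => n Nn.
by rewrite big_ord_recr /= [X in X - _]addrC addrK -[x n]subr0; exact: hN.
Qed.

End Absval.

(** * The embedding of A in C_oo, and sums over polynomials of bounded degree *)

Section Embedding.
Variables (R : realType) (F : finFieldType) (C : complex_infty R F).
Local Notation q := #|F|.
Local Notation "`| x |" := (Coo_abs C x) : ring_scope.

Definition emb (a : {poly F}) : C := Coo_inj C (injA a).

HB.instance Definition _ :=
  GRing.RMorphism.copy emb (Coo_inj C \o @FracField.tofrac {poly F}).

Lemma emb0 : emb 0 = 0. Proof. exact: rmorph0. Qed.
Lemma emb1 : emb 1 = 1. Proof. exact: rmorph1. Qed.
Lemma embD a b : emb (a + b) = emb a + emb b. Proof. exact: rmorphD. Qed.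
Lemma embN a : emb (- a) = - emb a. Proof. exact: rmorphN. Qed.
Lemma embM a b : emb (a * b) = emb a * emb b. Proof. exact: rmorphM. Qed.
Lemma embX a n : emb (a ^+ n) = emb a ^+ n. Proof. exact: rmorphXn. Qed.
Lemma embCN (c : F) : emb (- c)%:P = - emb c%:P.
Proof. by rewrite polyCN embN. Qed.
Lemma embCB (c c' : F) : emb (c - c')%:P = emb c%:P - emb c'%:P.
Proof. by rewrite polyCB embD embN. Qed.
Lemma embZ (c : F) (a : {poly F}) : emb (c *: a) = emb c%:P * emb a.
Proof. by rewrite -mul_polyC embM. Qed.
Lemma emb_sum I (r : seq I) (P : pred I) (f : I -> {poly F}) :
  emb (\sum_(i <- r | P i) f i) = \sum_(i <- r | P i) emb (f i).
Proof. exact: rmorph_sum. Qed.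

Definition th : C := emb 'X.

Lemma cardF_gt1 : (1 < q)%N. Proof. exact: finRing_gt1. Qed.
Lemma cardF_gt0 : (0 < q)%N. Proof. exact: ltnW cardF_gt1. Qed.
Lemma cardFX_gt0 n : (0 < q ^ n)%N. Proof. by rewrite expn_gt0 cardF_gt0. Qed.

Lemma cardR_gt1 : 1 < q%:R :> R. Proof. by rewrite ltr1n cardF_gt1. Qed.
Lemma cardR_gt0 : 0 < q%:R :> R. Proof. by rewrite ltr0n cardF_gt0. Qed.
Lemma cardR_ge1 : 1 <= q%:R :> R. Proof. by rewrite ler1n cardF_gt0. Qed.

Lemma emb_abs a : a != 0 -> `|emb a| = q%:R ^+ deg a.
Proof. exact: Coo_absE. Qed.

Lemma emb_eq0 a : (emb a == 0) = (a == 0).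
Proof. by rewrite fmorph_eq0 tofrac_eq0. Qed.

Lemma emb_abs_le (a : {poly F}) n : (size a <= n.+1)%N -> `|emb a| <= q%:R ^+ n.
Proof.
have [->|a0] := eqVneq a 0.
  by rewrite emb0 absval0 exprn_ge0 // ltW // cardR_gt0.
move=> sa; rewrite emb_abs // ler_weXn2l ?cardR_ge1 // /deg.
by rewrite -ltnS prednK // size_poly_gt0.
Qed.

Lemma emb_abs_lt (a : {poly F}) n : (size a <= n)%N -> `|emb a| < q%:R ^+ n.
Proof.
case: n => [|n] sa.
  by move: sa; rewrite size_poly_leq0 => /eqP ->; rewrite emb0 absval0.
apply: le_lt_trans (emb_abs_le sa) _.
by rewrite ltr_eXn2l // cardR_gt1.
Qed.

Lemma emb_absC c : c != 0 -> `|emb c%:P| = 1.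
Proof. by move=> c0; rewrite emb_abs ?polyC_eq0 // /deg size_polyC c0. Qed.

Lemma th_abs : `|th| = q%:R.
Proof. by rewrite emb_abs ?polyX_eq0 // /deg size_polyX. Qed.

Lemma th_neq0 : th != 0.
Proof. by rewrite emb_eq0 polyX_eq0. Qed.

Lemma embC_expq c : emb c%:P ^+ q = emb c%:P.
Proof. by rewrite -embX -polyC_exp expf_card. Qed.

Lemma embC_expqX c m : emb c%:P ^+ (q ^ m) = emb c%:P.
Proof. by elim: m => [|m IH]; rewrite ?expr1 // expnS exprM embC_expq. Qed.

Lemma pcharF_card : [pchar F].-nat q.
Proof.
have [p pp pF] := finPcharP F.
have := card_pprimeChar pF; set n := (X in (_ ^ X)%N) => ->.
by rewrite pnatX (eq_pnat _ (pcharf_eq pF)) pnat_id.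
Qed.

Lemma pcharC_card : [pchar C].-nat q.
Proof.
have [p pp pF] := finPcharP F.
have pC : p \in [pchar C].
  by rewrite inE pp /= -(rmorph_nat emb) -(rmorph_nat polyC) (pcharf0 pF) !rmorph0.
by rewrite (eq_pnat _ (pcharf_eq pC)) -(eq_pnat _ (pcharf_eq pF)) pcharF_card.
Qed.

Lemma exprDq (x y : C) m : (x + y) ^+ (q ^ m) = x ^+ (q ^ m) + y ^+ (q ^ m).
Proof. by rewrite exprDn_pchar // pnatX pcharC_card. Qed.

Lemma exprDq1 (x y : C) : (x + y) ^+ q = x ^+ q + y ^+ q.
Proof. by have := exprDq x y 1; rewrite expn1. Qed.

Lemma exprNq (x : C) m : (- x) ^+ (q ^ m) = - x ^+ (q ^ m).
Proof.
apply/eqP; rewrite -addr_eq0 -exprDq addNr expr0n.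
by rewrite gtn_eqF ?cardFX_gt0.
Qed.

Lemma exprBq (x y : C) m : (x - y) ^+ (q ^ m) = x ^+ (q ^ m) - y ^+ (q ^ m).
Proof. by rewrite exprDq exprNq. Qed.

Lemma exprBq1 (x y : C) : (x - y) ^+ q = x ^+ q - y ^+ q.
Proof. by have := exprBq x y 1; rewrite expn1. Qed.

Lemma expr_sumq I (r : seq I) (P : pred I) (f : I -> C) m :
  (\sum_(i <- r | P i) f i) ^+ (q ^ m) = \sum_(i <- r | P i) f i ^+ (q ^ m).
Proof.
apply: (big_morph (fun x : C => x ^+ (q ^ m))); first by move=> x y; rewrite exprDq.
by rewrite expr0n gtn_eqF ?cardFX_gt0.
Qed.

(** Constants sum to 0 over F, so a summand with the same value at all c != 0 sums to minus that
    value there. *)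
Lemma cardF_natr0 : q%:R = 0 :> C.
Proof.
have [p pp pF] := finPcharP F.
have qF : p.-nat q by rewrite -(eq_pnat _ (pcharf_eq pF)) pcharF_card.
have /dvdnP[k ->] : (p %| q)%N.
  have [[|n] qE] := p_natP qF; last by rewrite qE dvdn_exp.
  by have := cardF_gt1; rewrite qE.
by rewrite natrM -(rmorph_nat emb p) -(rmorph_nat polyC p) (pcharf0 pF) !rmorph0 mulr0.
Qed.

(* [sumA N f] is the sum of [f b] over the [b] of degree less than [N]. *)
Definition sumA (N : nat) (V : nmodType) (f : {poly F} -> V) : V :=
  \sum_(c : 'rV[F]_N) f (rVpoly c).

Lemma sumA0 (V : nmodType) (f : {poly F} -> V) : sumA 0 f = f 0.
Proof.
rewrite /sumA (big_pred1 0) => [|c]; last by rewrite /= (thinmx0 c) eqxx.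
by rewrite linear0.
Qed.

Lemma eq_sumA N (V : nmodType) (f g : {poly F} -> V) :
  (forall b : {poly F}, (size b <= N)%N -> f b = g b) -> sumA N f = sumA N g.
Proof. by move=> h; apply: eq_bigr => c _; rewrite h // size_poly. Qed.

Lemma sumAS N (V : nmodType) (f : {poly F} -> V) :
  sumA N.+1 f = \sum_(c : F) sumA N (fun b => f (b + c *: 'X^N)).
Proof.
pose h (x : F * 'rV[F]_N) : 'rV[F]_N.+1 :=
  poly_rV (rVpoly x.2 + x.1 *: 'X^N).
pose k (v : 'rV[F]_N.+1) : F * 'rV[F]_N :=
  ((rVpoly v)`_N, poly_rV (rVpoly v)).
have sz x : (size (rVpoly (x : F * 'rV[F]_N).2 + x.1 *: 'X^N)%R <= N.+1)%N.
  rewrite (leq_trans (size_polyD _ _)) // geq_max ltnW ?ltnS ?size_poly //=.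
  by rewrite (leq_trans (size_scale_leq _ _)) ?size_polyXn.
have kK : cancel h k.
  move=> [c v]; rewrite /k /h poly_rV_K ?sz //=; congr (_, _).
    by rewrite coefD coefZ coefXn eqxx mulr1 nth_default ?add0r ?size_poly.
  apply/rowP => i; rewrite mxE coefD coefZ coefXn (ltn_eqF (ltn_ord i)).
  by rewrite mulr0 addr0 coef_rVpoly_ord.
have hK : cancel k h.
  move=> v; rewrite /k /h /=; apply: (can_inj (@rVpolyK _ _)).
  rewrite poly_rV_K ?(sz (_, poly_rV _)) //.
  apply/polyP => i; rewrite coefD coefZ coefXn coef_rVpoly.
  case: insubP => [j /= _ ji|iN].
    rewrite mxE ji (_ : i == N = false) ?mulr0 ?addr0 //.
    by rewrite -ji ltn_eqF.
  have [->|iNe] := eqVneq i N; first by rewrite mulr1 add0r.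
  rewrite mulr0 addr0 nth_default // (leq_trans (size_poly _ _)) //.
  by rewrite ltn_neqAle eq_sym iNe leqNgt.
rewrite /sumA pair_bigA /= (reindex h) /=; last by exists k => x _.
by apply: eq_bigr => x _; rewrite /h poly_rV_K ?sz.
Qed.

Lemma sumA_le (f : {poly F} -> C) N B : 0 <= B ->
  (forall b : {poly F}, (size b <= N)%N -> `|f b| <= B) -> `|sumA N f| <= B.
Proof.
by move=> B0 h; apply: absval_sum_le => // c _; rewrite h // size_poly.
Qed.

Lemma sumA_scale N (V : nmodType) (f : {poly F} -> V) (c : F) : c != 0 ->
  sumA N (fun b => f (c *: b)) = sumA N f.
Proof.
move=> c0; rewrite /sumA [RHS](reindex (fun v : 'rV[F]_N => c *: v)) /=.
  by apply: eq_bigr => v _; rewrite linearZ.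
by exists (fun v => c^-1 *: v) => v _; rewrite scalerA ?mulVf ?mulfV ?scale1r.
Qed.

Lemma sumA_shift N (V : nmodType) (f : {poly F} -> V) (a : {poly F}) :
  (size a <= N)%N -> sumA N (fun b => f (b + a)) = sumA N f.
Proof.
move=> sa; rewrite /sumA [RHS](reindex (fun v : 'rV[F]_N => v + poly_rV a)) /=.
  by apply: eq_bigr => v _; rewrite linearD /= poly_rV_K.
by exists (fun v => v - poly_rV a) => v _; rewrite ?addrK ?subrK.
Qed.

(* [monsum j f] is the sum of [f a] over the monic [a] of degree [j]. *)
Definition monsum (j : nat) (V : nmodType) (f : {poly F} -> V) : V :=
  \sum_(c : 'rV[F]_j) f ('X^j + rVpoly c).

Lemma size_monic_shift j (b : {poly F}) :
  (size b <= j)%N -> size ('X^j + b)%R = j.+1.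
Proof. by move=> sb; rewrite size_polyDl size_polyXn. Qed.

Lemma monic_shift j (b : {poly F}) : (size b <= j)%N -> 'X^j + b \is monic.
Proof.
move=> sb; rewrite monicE lead_coefDl ?size_polyXn //.
by rewrite lead_coefXn.
Qed.

Lemma monsum_le (f : {poly F} -> C) j B : 0 <= B ->
  (forall a : {poly F}, a \is monic -> size a = j.+1 -> `|f a| <= B) ->
  `|monsum j f| <= B.
Proof.
move=> B0 h; apply: absval_sum_le => // c _.
by rewrite h ?monic_shift ?size_monic_shift ?size_poly.
Qed.

(* Each monic [a] has [q - 1 = -1] nonzero multiples [c a]. *)
Lemma sumA_monsum (f : {poly F} -> C) N :
  (forall (c : F) a, c != 0 -> f (c *: a) = f a) ->
  sumA N f = f 0 - \sum_(j < N) monsum j f.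
Proof.
move=> fZ; elim: N => [|N IH]; first by rewrite sumA0 big_ord0 subr0.
rewrite sumAS (bigD1 0) //= big_ord_recr opprD /= addrA -IH; congr (_ + _).
  by apply: eq_sumA => b _; rewrite scale0r addr0.
rewrite (eq_bigr (fun=> monsum N f)) => [|c c0].
  have E : \sum_(c : F) monsum N f = 0.
    by rewrite sumr_const -mulr_natr cardF_natr0 mulr0.
  by move: E; rewrite (bigD1 0) //= => /addr0_eq ->.
have ci0 : c^-1 != 0 by rewrite invr_eq0.
rewrite (_ : monsum N f = sumA N (fun b => f ('X^N + b))) //.
rewrite -[RHS](sumA_scale N _ ci0); apply: eq_sumA => b _.
by rewrite -(fZ _ (b + _) ci0) scalerDr scalerA mulVf // scale1r addrC.
Qed.

End Embedding.

(** * Exponentials and power sums of finite lattices *)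

Section FiniteExponential.
Variables (R : realType) (F : finFieldType) (C : complex_infty R F).
Local Notation q := #|F|.
Local Notation "`| x |" := (Coo_abs C x) : ring_scope.
Local Notation emb := (@emb R F C).
Local Notation th := (th C).

(** The logarithmic derivative. As X^q - X has the constant derivative -1, it turns a sum of
    inverses over a line into a single inverse ([sum_inv_line]). *)
Lemma deriv_prodXsubC_horner (r : seq C) (t : C) : (forall x, x \in r -> t != x) ->
  (\prod_(x <- r) ('X - x%:P))^`().[t] =
  (\prod_(x <- r) ('X - x%:P)).[t] * \sum_(x <- r) (t - x)^-1.
Proof.
elim: r => [|x r IH] h; first by rewrite !big_nil derivC hornerC mulr0.
rewrite !big_cons derivM derivXsubC mul1r hornerD !hornerM hornerXsubC.
rewrite IH => [|y yr]; last by rewrite h // inE yr orbT.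
have tx : t - x != 0 by rewrite subr_eq0 h // inE eqxx.
by field.
Qed.

Lemma emb_genPoly : 'X^q - 'X = \prod_(c : F) ('X - (emb c%:P)%:P) :> {poly C}.
Proof.
have := congr1 (map_poly (emb \o polyC)) (finField_genPoly F).
rewrite rmorphB /= map_polyXn map_polyX => ->.
rewrite rmorph_prod; apply: eq_bigr => c _.
by rewrite rmorphB /= map_polyX map_polyC.
Qed.

(* [t |-> t - t^q / s^(q-1)] is the normalized additive polynomial with
   kernel the line [F s]. *)
Definition line (s t : C) : C := t - t ^+ q / s ^+ q.-1.

Lemma line_add s t t' : line s (t + t') = line s t + line s t'.
Proof. by rewrite /line exprDq1; ring. Qed.

Lemma line_scale s t (c : F) : line s (emb c%:P * t) = emb c%:P * line s t.
Proof. by rewrite /line exprMn embC_expq; ring. Qed.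

Lemma expq_predn (s : C) : s ^+ q = s * s ^+ q.-1.
Proof. by rewrite -exprS prednK // cardF_gt0. Qed.

Lemma line_self s : s != 0 -> line s s = 0.
Proof.
by move=> s0; rewrite /line expq_predn mulfK ?subrr // expf_neq0.
Qed.

Lemma line_shift s t (c : F) : s != 0 -> line s (t + emb c%:P * s) = line s t.
Proof. by move=> s0; rewrite line_add line_scale line_self // mulr0 addr0. Qed.

Lemma prod_line s t :
  \prod_(c : F) (t - emb c%:P * s) = t ^+ q - t * s ^+ q.-1.
Proof.
have [->|s0] := eqVneq s 0.
  have q1 : (0 < q.-1)%N by have := cardF_gt1 F; lia.
  rewrite expr0n eqn0Ngt q1 mulr0 subr0 (eq_bigr (fun=> t)) => [|c _].
    by rewrite prodr_const.
  by rewrite mulr0 subr0.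
rewrite (eq_bigr (fun c => s * (t / s - emb c%:P))) => [|c _]; last first.
  by rewrite mulrBr [in RHS]mulrC divfK // [X in _ = _ - X]mulrC.
rewrite big_split /= prodr_const /=.
have := congr1 (fun p : {poly C} => p.[t / s]) emb_genPoly.
rewrite hornerD hornerN hornerXn hornerX horner_prod.
under eq_bigr do rewrite hornerXsubC.
move=> <-; rewrite expr_div_n mulrBr [s ^+ _ * (_ / _)]mulrC divfK ?expf_neq0 //.
by rewrite (expq_predn s); congr (_ - _); field.
Qed.

Lemma prod_lineE s t : s != 0 ->
  \prod_(c : F) (t - emb c%:P * s) = - (s ^+ q.-1 * line s t).
Proof.
move=> s0; rewrite prod_line /line mulrBr [X in - (_ - X)]mulrC divfK ?expf_neq0 //.
by ring.
Qed.

Lemma sum_inv_line s t : s != 0 -> (forall c : F, t + emb c%:P * s != 0) ->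
  \sum_(c : F) (t + emb c%:P * s)^-1 = (line s t)^-1.
Proof.
move=> s0 ts.
have ts' (c : F) : t / s != emb c%:P.
  apply/eqP => tc; have := ts (- c); rewrite embCN -tc mulNr divfK //.
  by rewrite subrr eqxx.
have hx x : x \in [seq emb c%:P | c <- index_enum F] -> t / s != x.
  by case/mapP => c _ ->.
have := deriv_prodXsubC_horner hx; rewrite !big_map -emb_genPoly => h.
have : (('X^q - 'X)^`()).[t / s] = -1 :> C.
  rewrite derivB derivXn derivX hornerD hornerN hornerMn hornerXn hornerC.
  by rewrite -mulr_natr cardF_natr0 mulr0 add0r.
rewrite h hornerD hornerN hornerXn hornerX => e.
have l0 : line s t != 0.
  apply/eqP => l0; have : \prod_(c : F) (t - emb c%:P * s) == 0.
    by rewrite prod_lineE // l0 mulr0 oppr0.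
  rewrite prodf_seq_eq0 => /hasP[c _ /=]; apply/negP.
  by have := ts (- c); rewrite embCN mulNr.
rewrite (reindex_inj oppr_inj) /=; apply: (mulfI l0); rewrite mulfV //.
have E : line s t = s * (t / s - (t / s) ^+ q).
  rewrite /line mulrBr [s * (t / s)]mulrC divfK // expr_div_n expq_predn.
  by congr (_ - _); rewrite expq_predn; field; rewrite expf_neq0 ?s0.
rewrite E -mulrA mulrCA -opprB mulNr.
rewrite (_ : s * _ = \sum_(c : F) (t / s - emb c%:P)^-1) ?e ?opprK //.
rewrite mulr_sumr; apply: eq_bigr => c _.
rewrite embCN mulNr -{1}(divfK s0 t) -mulrBl invfM.
by rewrite mulrCA mulfV // mulr1.
Qed.

(** Up to the factor |s|^(q - 1), the size of [line s t] is the product of the distances from t to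
    the multiples of s. Once c s is the nearest multiple, the ultrametric inequality makes every
    other distance at least |s|, so these factors cancel the denominator. *)
Lemma line_lower s t : exists c : F, `|t - emb c%:P * s| <= `|line s t|.
Proof.
have [->|s0] := eqVneq s 0.
  exists 0; rewrite mulr0 subr0 /line expr0n.
  have -> : (q.-1 == 0)%N = false by have := cardF_gt1 F; lia.
  by rewrite invr0 mulr0 subr0.
have [c _ cmin] := @arg_minP _ R F 0 predT (fun c => `|t - emb c%:P * s|) isT.
exists c; set t0 := t - _.
have sgt0 : 0 < `|s| ^+ q.-1 by rewrite exprn_gt0 // absval_gt0.
have -> : `|line s t| = (\prod_(i : F) `|t - emb i%:P * s|) / `|s| ^+ q.-1.
  rewrite -absval_prod prod_lineE // absvalN absvalM absvalX [X in X / _]mulrC.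
  by rewrite mulfK ?lt0r_neq0.
rewrite ler_pdivlMr // (bigD1 c) //= ler_wpM2l ?absval_ge0 //.
have -> : `|s| ^+ q.-1 = \prod_(i | i != c) `|s|.
  by rewrite prodr_const; congr (_ ^+ _); rewrite cardC1.
apply: ler_prod => i ic; rewrite absval_ge0 /=.
have dE : t - emb i%:P * s = t0 + emb (c - i)%:P * s.
  by rewrite /t0 embCB; ring.
have ds : `|emb (c - i)%:P * s| = `|s|.
  by rewrite absvalM emb_absC ?mul1r // subr_eq0 eq_sym.
rewrite dE; have [lt|le] := ltP `|t0| `|s|.
  by rewrite addrC absvalD_isosceles ?ds.
by rewrite (le_trans le) // -dE; exact: cmin.
Qed.

(* The normalized additive polynomial with kernel the polynomials of degree
   less than [N]. *)
Fixpoint eN (N : nat) (w : C) : C :=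
  if N is M.+1 then line (eN M (th ^+ M)) (eN M w) else w.

Definition lam (N : nat) : C := eN N (th ^+ N).

Lemma eNS N w : eN N.+1 w = line (lam N) (eN N w). Proof. by []. Qed.

Lemma eN_add N w w' : eN N (w + w') = eN N w + eN N w'.
Proof. by elim: N => // N IH; rewrite !eNS IH line_add. Qed.

Lemma eN_scale N w (c : F) : eN N (emb c%:P * w) = emb c%:P * eN N w.
Proof. by elim: N => // N IH; rewrite !eNS IH line_scale. Qed.

Lemma eN0 N : eN N 0 = 0.
Proof. by have := eN_scale N 0 0; rewrite emb0 !mul0r. Qed.

Lemma eN_opp N w : eN N (- w) = - eN N w.
Proof. by apply/eqP; rewrite -addr_eq0 -eN_add addNr eN0. Qed.

Lemma emb_shift (b : {poly F}) (c : F) N :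
  emb (b + c *: 'X^N) = emb b + emb c%:P * th ^+ N.
Proof. by rewrite embD embZ embX. Qed.

Lemma size_shift (b : {poly F}) (c : F) N :
  (size b <= N)%N -> (size (b + c *: 'X^N)%R <= N.+1)%N.
Proof.
move=> sb; rewrite (leq_trans (size_polyD _ _)) // geq_max (leq_trans sb) //=.
by rewrite (leq_trans (size_scale_leq _ _)) ?size_polyXn.
Qed.

(** Each of the k lines above level M is removed by [line_lower], which chooses one coefficient of
    b. The case M = 0 compares [eN] with the distance to the lattice; the case M = 1 keeps the
    additive polynomial of the constants, which gains a power in [decay_id1]. *)
Lemma eN_lower M k w : exists2 b : {poly F}, (size b <= k + M)%N &
  `|eN M (w - emb b)| <= `|eN (k + M) w|.
Proof.
elim: k w => [|k IH] w; first by exists 0; rewrite ?size_poly0 // emb0 subr0.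
have [c hc] := line_lower (lam (k + M)) (eN (k + M) w).
have [b sb hb] := IH (w - emb c%:P * th ^+ (k + M)).
exists (b + c *: 'X^(k + M)); first by rewrite addSn size_shift.
rewrite emb_shift opprD [X in w + X]addrC addrA.
apply: le_trans hb _; apply: le_trans hc.
by rewrite eN_add eN_opp eN_scale.
Qed.

Lemma eN_ge N w d : (forall b : {poly F}, (size b <= N)%N -> d <= `|w + emb b|) ->
  d <= `|eN N w|.
Proof.
move=> h; have [b sb hb] := eN_lower 0 N w; rewrite addn0 in sb hb.
by apply: le_trans hb; rewrite -embN h // size_polyN.
Qed.

Definition pole_free (N : nat) (w : C) : Prop :=
  forall b : {poly F}, (size b <= N)%N -> w + emb b != 0.

Lemma eN_neq0 N w : pole_free N w -> eN N w != 0.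
Proof.
move=> h; have [b sb hb] := eN_lower 0 N w; rewrite addn0 in sb hb.
rewrite -(@absval_gt0 _ _ (Coo_abs C)); apply: lt_le_trans hb.
by rewrite absval_gt0 -embN h // size_polyN.
Qed.

Lemma th_shift_abs N (b : {poly F}) :
  (size b <= N)%N -> `|th ^+ N + emb b| = q%:R ^+ N.
Proof.
move=> sb; rewrite -[th ^+ N]embX -embD.
rewrite emb_abs ?/deg ?size_monic_shift //.
by rewrite -size_poly_gt0 size_monic_shift.
Qed.

Lemma lam_ge N : q%:R ^+ N <= `|lam N|.
Proof. by apply: eN_ge => b sb; rewrite th_shift_abs. Qed.

Lemma lam_neq0 N : lam N != 0.
Proof.
rewrite -(@absval_gt0 _ _ (Coo_abs C)); apply: lt_le_trans (lam_ge N).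
by rewrite exprn_gt0 ?cardR_gt0.
Qed.

Lemma eN_poly N (b : {poly F}) : (size b <= N)%N -> eN N (emb b) = 0.
Proof.
elim: N b => [|N IH] b sb.
  by move: sb; rewrite size_poly_leq0 => /eqP ->; rewrite emb0 eN0.
set a := b - b`_N *: 'X^N.
have sa : (size a <= N)%N.
  apply/leq_sizeP => i Ni; rewrite coefB coefZ coefXn.
  have [->|iN] := eqVneq i N; first by rewrite mulr1 subrr.
  by rewrite mulr0 subr0 nth_default // (leq_trans sb) // ltn_neqAle eq_sym iN.
have -> : b = a + b`_N *: 'X^N by rewrite subrK.
rewrite emb_shift eNS eN_add eN_scale line_shift ?lam_neq0 // IH //.
by rewrite /line expr0n gtn_eqF ?cardF_gt0 // mul0r subrr.
Qed.

End FiniteExponential.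

(** * Sums of negative powers over a finite lattice *)

Section PowerSums.
Variables (R : realType) (F : finFieldType) (C : complex_infty R F).
Local Notation q := #|F|.
Local Notation "`| x |" := (Coo_abs C x) : ring_scope.
Local Notation emb := (@emb R F C).
Local Notation th := (th C).
Local Notation lam := (lam C).

Lemma exprV_sub (x : C) m n : (m <= n)%N -> x != 0 ->
  x^-1 ^+ (n - m) = x ^+ m * x^-1 ^+ n.
Proof.
move=> mn x0; rewrite -{2}(subnK mn) exprD mulrCA -exprMn mulfV // expr1n.
by rewrite mulr1.
Qed.

(** The formal inverse of the additive polynomial [line s] is the series of general term s^(1 - q^j)
    x^(q^j); its truncation telescopes. *)
Lemma sum_line_iter (s t : C) m : s != 0 ->
  \sum_(j < m) s / s ^+ (q ^ j) * line s t ^+ (q ^ j) =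
  t - s / s ^+ (q ^ m) * t ^+ (q ^ m).
Proof.
move=> s0; elim: m => [|m IH].
  by rewrite big_ord0 expn0 !expr1 mulfV // mul1r subrr.
rewrite big_ord_recr /= IH /line exprBq expr_div_n -!exprM.
have -> : s ^+ (q ^ m.+1) = s ^+ (q ^ m) * s ^+ (q.-1 * q ^ m).
  by rewrite -exprD -mulSn prednK ?cardF_gt0 // expnS.
rewrite -expnS; field.
by rewrite !expf_neq0.
Qed.

(** For y = t + c s, the value [line s y] does not depend on c. Dividing the identity of
    [sum_line_iter] at y by y^(q^m) expresses y^(1 - q^m) through y^(-q^m) and a constant. In the
    sum over c the constant disappears, and the powers add up to the q^m-th power of
    [sum_inv_line]. *)
Lemma sum_inv_line_pow (s t : C) m : s != 0 ->
  (forall c : F, t + emb c%:P * s != 0) ->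
  \sum_(c : F) (t + emb c%:P * s)^-1 ^+ (q ^ m - 1) =
  \sum_(j < m) s / s ^+ (q ^ j) * (line s t)^-1 ^+ (q ^ m - q ^ j).
Proof.
move=> s0 ts; have lE := sum_inv_line s0 ts.
have l0 : line s t != 0.
  have [c hc] := line_lower s t.
  rewrite -(@absval_gt0 _ _ (Coo_abs C)); apply: lt_le_trans hc.
  by rewrite absval_gt0 -mulNr -embCN.
have E (c : F) : (t + emb c%:P * s)^-1 ^+ (q ^ m - 1) =
    (\sum_(j < m) s / s ^+ (q ^ j) * line s t ^+ (q ^ j)) *
      (t + emb c%:P * s)^-1 ^+ (q ^ m) + s / s ^+ (q ^ m).
  rewrite -(line_shift t c s0) sum_line_iter // exprV_sub ?cardFX_gt0 // expr1.
  rewrite mulrBl -[X in _ - X]mulrA -exprMn mulfV // expr1n mulr1.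
  by rewrite subrK.
rewrite (eq_bigr _ (fun c _ => E c)) big_split /= -mulr_sumr -expr_sumq lE.
rewrite sumr_const -[X in _ + X]mulr_natr cardF_natr0 mulr0 addr0 mulr_suml.
apply: eq_bigr => j _; rewrite exprV_sub ?mulrA //.
by rewrite leq_exp2l ?cardF_gt1 // ltnW.
Qed.

Definition TN (k N : nat) (w : C) : C := sumA N (fun b => (w + emb b)^-1 ^+ k).

Lemma TNS k N w :
  TN k N.+1 w = \sum_(c : F) TN k N (w + emb c%:P * th ^+ N).
Proof.
rewrite /TN sumAS; apply: eq_bigr => c _; apply: eq_sumA => b _.
by rewrite emb_shift [emb b + _]addrC addrA.
Qed.

Lemma pole_free_shift N w (c : F) :
  pole_free N.+1 w -> pole_free N (w + emb c%:P * th ^+ N).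
Proof.
move=> h b sb; rewrite -addrA [X in w + X]addrC -emb_shift.
by apply: h; exact: size_shift.
Qed.

Lemma eN_shift_neq0 N w (c : F) :
  pole_free N.+1 w -> eN N w + emb c%:P * lam N != 0.
Proof. by move=> h; rewrite -eN_scale -eN_add eN_neq0 //; exact: pole_free_shift. Qed.

Lemma TN1 N w : pole_free N w -> TN 1 N w = (eN N w)^-1.
Proof.
elim: N w => [|N IH] w h; first by rewrite /TN sumA0 emb0 addr0 expr1.
rewrite TNS eNS -sum_inv_line ?lam_neq0 // => [|c]; last exact: eN_shift_neq0.
apply: eq_bigr => c _; rewrite IH; last exact: pole_free_shift.
by rewrite eN_add eN_scale.
Qed.

Lemma TN_expq k m N w : TN (k * q ^ m) N w = TN k N w ^+ (q ^ m).
Proof. by rewrite /TN /sumA expr_sumq; apply: eq_bigr => c _; rewrite exprM. Qed.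

(* Coefficients of the logarithm attached to [eN N], up to degree [q^N]. *)
Fixpoint be (N : nat) (k : nat) : C :=
  if N is M.+1 then
    \sum_(i < k.+1) be M i * (lam M ^+ (q ^ i) / lam M ^+ (q ^ k))
  else (k == 0)%:R.

Lemma beS N k :
  be N.+1 k = \sum_(i < k.+1) be N i * (lam N ^+ (q ^ i) / lam N ^+ (q ^ k)).
Proof. by []. Qed.

Lemma be_diag N k :
  be N.+1 k = be N k + \sum_(i < k) be N i * (lam N ^+ (q ^ i) / lam N ^+ (q ^ k)).
Proof.
by rewrite beS big_ord_recr /= mulfV ?expf_neq0 ?lam_neq0 // mulr1 addrC.
Qed.

Lemma be_0 N : be N 0 = 1.
Proof. by elim: N => // N IH; rewrite be_diag big_ord0 addr0. Qed.

Lemma triangle_sum (n : nat) (f : nat -> nat -> C) :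
  \sum_(i < n) \sum_(j < n - i) f i (i + j)%N = \sum_(k < n) \sum_(i < k.+1) f i k.
Proof.
elim: n => [|n IH]; first by rewrite !big_ord0.
rewrite [RHS]big_ord_recr /= -IH big_ord_recr /= subSnn big_ord1 addn0.
rewrite [X in _ = _ + X]big_ord_recr /= addrA; congr (_ + _).
rewrite -big_split; apply: eq_bigr => i _ /=.
by rewrite subSn ?(ltnW (ltn_ord i)) // big_ord_recr /= subnKC // ltnW.
Qed.

(** These are Goss polynomials for the exponents q^n - 1. Adding a line, the i-th term is the q^i-th
    power of a sum handled by [sum_inv_line_pow]; regrouping the double sum by k = i + j gives the
    recursion that defines [be]. *)
Lemma TN_be n N w : (0 < n)%N -> pole_free N w ->
  TN (q ^ n - 1) N w = \sum_(i < n) be N i * (eN N w)^-1 ^+ (q ^ n - q ^ i).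
Proof.
move=> n0; elim: N w => [|N IH] w h.
  case: n n0 => // n _; rewrite big_ord_recl /= mul1r expn0 big1 ?addr0 => [|i _].
    by rewrite /TN sumA0 emb0 addr0.
  by rewrite mul0r.
rewrite TNS eNS; set l := lam N; set t := eN N w.
transitivity (\sum_(c : F) \sum_(i < n) be N i *
    ((t + emb c%:P * l)^-1 ^+ (q ^ (n - i) - 1)) ^+ (q ^ i)).
  apply: eq_bigr => c _; rewrite IH; last exact: pole_free_shift.
  apply: eq_bigr => i _; rewrite eN_add eN_scale -exprM mulnBl mul1n -expnD.
  by rewrite subnK // ltnW.
rewrite exchange_big /=.
transitivity (\sum_(i < n) \sum_(j < n - i) be N i *
    (l ^+ (q ^ i) / l ^+ (q ^ (i + j)) * (line l t)^-1 ^+ (q ^ n - q ^ (i + j)))).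
  apply: eq_bigr => i _; rewrite -mulr_sumr -expr_sumq.
  rewrite sum_inv_line_pow ?lam_neq0 // => [|c]; last exact: eN_shift_neq0.
  rewrite expr_sumq -mulr_sumr; congr (_ * _); apply: eq_bigr => j _.
  rewrite exprMn expr_div_n -!exprM -!expnD mulnBl -!expnD subnK ?(ltnW (ltn_ord i)) //.
  by rewrite [(j + i)%N]addnC.
rewrite (triangle_sum n (fun i k => be N i *
  (l ^+ (q ^ i) / l ^+ (q ^ k) * (line l t)^-1 ^+ (q ^ n - q ^ k)))).
apply: eq_bigr => k _; rewrite mulr_suml; apply: eq_bigr => i _.
by rewrite mulrA.
Qed.

Lemma lam_pole_free N (c : F) : c != 0 -> pole_free N (emb c%:P * th ^+ N).
Proof.
move=> c0 b sb; rewrite addrC -emb_shift emb_eq0; apply/eqP => e.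
have := coefD b (c *: 'X^N) N; rewrite e coef0 coefZ coefXn eqxx mulr1.
by rewrite nth_default // add0r => /esym/eqP; apply/negP.
Qed.

(* The term [b = 0] of the sum vanishes, as [0^-1 = 0]. *)
Lemma TN_0 n N : (0 < n)%N -> TN (q ^ n - 1) N 0 = - be N n.
Proof.
move=> n0; have qn : (0 < q ^ n - 1)%N.
  by rewrite subn_gt0 -{1}(exp1n n) ltn_exp2r ?cardF_gt1.
elim: N => [|N IH].
  by rewrite /TN sumA0 emb0 addr0 invr0 expr0n gtn_eqF //= gtn_eqF ?oppr0.
rewrite be_diag opprD TNS (bigD1 0) //= emb0 mul0r addr0 IH; congr (_ + _).
set X := (X in - X).
(* Since c^(q^i) = c^(q^n), the factors c cancel and each c != 0 contributes the same X; the total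
   over c != 0 is therefore - X. *)
transitivity (\sum_(c : F | c != 0) X).
  apply: eq_bigr => c c0; rewrite add0r TN_be //; last exact: lam_pole_free.
  apply: eq_bigr => i _; congr (_ * _); rewrite eN_scale -/(lam N) invfM exprMn.
  have qi : (q ^ i <= q ^ n)%N by rewrite leq_exp2l ?cardF_gt1 // ltnW.
  have c0' : emb c%:P != 0 by rewrite emb_eq0 polyC_eq0.
  rewrite !exprV_sub ?lam_neq0 // exprVn !embC_expqX mulfV ?mul1r //.
  by rewrite exprVn.
have : \sum_(c : F) X = 0 by rewrite sumr_const -mulr_natr cardF_natr0 mulr0.
by rewrite (bigD1 0) //= => /addr0_eq ->.
Qed.

End PowerSums.

(** * The Carlitz exponential and its period *)

Section InfiniteExponential.
Variables (R : realType) (F : finFieldType) (C : complex_infty R F).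
Local Notation q := #|F|.
Local Notation "`| x |" := (Coo_abs C x) : ring_scope.
Local Notation emb := (@emb R F C).
Local Notation th := (th C).
Local Notation lam := (lam C).

Lemma cardRX_gt0 n : 0 < q%:R ^+ n :> R.
Proof. by rewrite exprn_gt0 ?cardR_gt0. Qed.

Lemma cardRX_unbounded (x : R) : exists N : nat, x < q%:R ^+ N.
Proof.
exists (Num.bound x); apply: lt_le_trans (upper_nthrootP (leqnn _)) _.
by rewrite lerXn2r ?nnegrE ?ler0n // ler_nat cardF_gt1.
Qed.

Lemma cardRXV_small (e : R) : 0 < e -> exists N : nat, q%:R ^- N <= e.
Proof.
move=> e0; have [N hN] := cardRX_unbounded e^-1.
by exists N; rewrite -[e]invrK lef_pV2 ?posrE ?cardRX_gt0 ?invr_gt0 // ltW.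
Qed.

Lemma cardRXV_le m n : (m <= n)%N -> q%:R ^- n <= q%:R ^- m :> R.
Proof.
by move=> mn; rewrite lef_pV2 ?posrE ?cardRX_gt0 // ler_weXn2l ?cardR_ge1.
Qed.

Lemma cardRXV_ge0 n : 0 <= q%:R ^- n :> R.
Proof. by rewrite invr_ge0 ltW // cardRX_gt0. Qed.

Lemma cardRXV_le1 n : q%:R ^- n <= 1 :> R.
Proof. by have := cardRXV_le (leq0n n); rewrite expr0 invr1. Qed.

Lemma shift_abs N w (b : {poly F}) (c : F) : c != 0 -> (size b <= N)%N ->
  `|w| < q%:R ^+ N -> `|w + emb c%:P * th ^+ N + emb b| = q%:R ^+ N.
Proof.
move=> c0 sb wN; have E : `|emb c%:P * th ^+ N + emb b| = q%:R ^+ N.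
  have -> : emb c%:P * th ^+ N + emb b = emb c%:P * (th ^+ N + emb (c^-1 *: b)).
    by rewrite embZ mulrDr mulrA -embM -polyCM mulfV // emb1 mul1r.
  rewrite absvalM emb_absC // mul1r th_shift_abs //.
  by rewrite (leq_trans (size_scale_leq _ _)).
by rewrite -addrA addrC absvalD_isosceles E.
Qed.

Lemma TN_tail k N M w : (0 < k)%N -> `|w| < q%:R ^+ N -> (N <= M)%N ->
  `|TN k M w - TN k N w| <= q%:R ^- N.
Proof.
move=> k0 wN; apply: (@av_step_le _ _ _ (fun n => TN k n w)) => [|n Nn].
  exact: cardRXV_ge0.
have wn : `|w| < q%:R ^+ n.
  by apply: lt_le_trans wN _; rewrite ler_weXn2l ?cardR_ge1.
rewrite TNS (bigD1 0) //= emb0 mul0r addr0 [X in X - _]addrC addrK.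
apply: absval_sum_le => [|c c0]; first exact: cardRXV_ge0.
apply: sumA_le => [|b sb]; first exact: cardRXV_ge0.
rewrite absvalX absvalV shift_abs // exprVn -exprM.
by apply: cardRXV_le; rewrite (leq_trans Nn) // leq_pmulr.
Qed.

Definition TI (k : nat) (w : C) : C := av_lim (Coo_abs C) (fun N => TN k N w).

Lemma TN_cvg k w : (0 < k)%N -> av_cvg (Coo_abs C) (fun N => TN k N w) (TI k w).
Proof.
move=> k0; suff [l hl] : exists l, av_cvg (Coo_abs C) (fun N => TN k N w) l.
  by rewrite /TI (av_limE hl).
apply: (av_cvg_step (@Coo_complete _ _ C)) => e e0.
have [N0 hN0] := cardRX_unbounded `|w|; have [N1 hN1] := cardRXV_small e0.
exists (maxn N0 N1) => n; rewrite geq_max => /andP[n0 n1].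
apply: le_trans (@TN_tail k n n.+1 w k0 _ (leqnSn n)) _.
  by apply: lt_le_trans hN0 _; rewrite ler_weXn2l ?cardR_ge1.
by apply: le_trans hN1; exact: cardRXV_le.
Qed.

Lemma TN_TI k N w : (0 < k)%N -> `|w| < q%:R ^+ N ->
  `|TN k N w - TI k w| <= q%:R ^- N.
Proof.
move=> k0 wN; rewrite absvalBC.
apply: (@av_cvg_ball _ _ _ (fun M => TN k M w) _ _ _ N (TN_cvg w k0)) => M NM.
exact: TN_tail.
Qed.

Lemma line_abs_lt (s t : C) : `|t| < `|s| -> `|line s t| = `|t|.
Proof.
have [->|t0] := eqVneq t 0.
  by rewrite /line expr0n gtn_eqF ?cardF_gt0 // mul0r subrr.
move=> ts; have tp : 0 < `|t| by rewrite absval_gt0.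
have sp : 0 < `|s| := lt_trans tp ts.
rewrite /line absvalD_isosceles // absvalN absvalM absvalV !absvalX.
rewrite -[q in _ ^+ q](prednK (cardF_gt0 F)) exprS -mulrA gtr_pMr //.
rewrite ltr_pdivrMr ?exprn_gt0 // mul1r ltrXn2r ?absval_ge0 //.
by have := cardF_gt1 F; lia.
Qed.

(** The induction hypothesis is used for w and also for th^M, so that both [eN M w] and [lam M] are
    smaller than T = [eN M (th ^+ N)]. Then T^q / l^(q - 1) is the dominant term of [line l T] and
    exceeds both terms of [line l t]. *)
Lemma eN_mono N M w : (M <= N)%N -> `|w| < q%:R ^+ N ->
  `|eN M w| < `|eN M (th ^+ N)|.
Proof.
move=> MN wN; elim: M MN w wN => [|M IH] MN w wN.
  by rewrite /= absvalX th_abs.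
have tT := IH (ltnW MN) w wN.
have lT : `|lam M| < `|eN M (th ^+ N)|.
  by apply: IH; rewrite 1?ltnW // absvalX th_abs ltr_eXn2l ?cardR_gt1.
rewrite !eNS; move: tT lT; set t := eN M w; set T := eN M _; set l := lam M.
move=> tT lT; have l0 : 0 < `|l| by rewrite absval_gt0 lam_neq0.
have q1 : (q.-1 != 0)%N by have := cardF_gt1 F; lia.
have T0 : 0 < `|T| := lt_trans l0 lT.
have TE : `|T ^+ q / l ^+ q.-1| = `|line l T|.
  rewrite /line addrC absvalD_isosceles absvalN // absvalM absvalV !absvalX.
  rewrite -[X in _ ^+ X](prednK (cardF_gt0 F)) exprS -mulrA ltr_pMr //.
  by rewrite ltr_pdivlMr ?exprn_gt0 // mul1r ltrXn2r ?absval_ge0.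
apply: absvalB_lt; rewrite -TE.
  apply: lt_trans tT _; rewrite absvalM absvalV !absvalX.
  rewrite -[X in _ ^+ X](prednK (cardF_gt0 F)) exprS -mulrA ltr_pMr //.
  by rewrite ltr_pdivlMr ?exprn_gt0 // mul1r ltrXn2r ?absval_ge0.
rewrite !absvalM absvalV !absvalX ltr_pM2r ?invr_gt0 ?exprn_gt0 //.
by rewrite ltrXn2r ?absval_ge0 // -lt0n cardF_gt0.
Qed.

Lemma eN_lam_lt N M w : (N <= M)%N -> `|w| < q%:R ^+ N -> `|eN M w| < `|lam M|.
Proof.
move=> NM wN; apply: eN_mono => //.
by apply: lt_le_trans wN _; rewrite ler_weXn2l ?cardR_ge1.
Qed.

Lemma eN_abs_stable N M w : (N <= M)%N -> `|w| < q%:R ^+ N ->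
  `|eN M w| = `|eN N w|.
Proof.
move=> /subnK <- wN; elim: (M - N)%N => // k IH.
by rewrite addSn eNS line_abs_lt ?IH //; rewrite -IH (eN_lam_lt _ wN) // leq_addl.
Qed.

(** The difference has size |t|^q / |l|^(q - 1), and q >= 2 allows a bound quadratic in t. Through
    [eI_small] this quadratic error is what beats the linear growth under multiplication by th in
    [eI_carlitz]. *)
Lemma eN_step_le N M w : (N <= M)%N -> `|w| < q%:R ^+ N ->
  `|eN M.+1 w - eN M w| <= `|eN N w| ^+ 2 * q%:R ^- M.
Proof.
move=> NM wN; have lt := eN_lam_lt NM wN.
rewrite eNS /line [X in X - _]addrC addrK absvalN -(eN_abs_stable NM wN).
move: lt; set t := eN M w; set l := lam M => tl.
have l0 : 0 < `|l| by rewrite absval_gt0 lam_neq0.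
have -> : `|t ^+ q / l ^+ q.-1| = `|t| ^+ 2 / `|l| * (`|t| / `|l|) ^+ q.-2.
  have q2 : q = q.-2.+2 by have := cardF_gt1 F; lia.
  rewrite absvalM absvalV !absvalX expr_div_n {1 2}q2 /= !exprS.
  by field; rewrite expf_neq0 ?lt0r_neq0.
rewrite -[leRHS]mulr1; apply: ler_pM.
- by rewrite divr_ge0 ?exprn_ge0 ?absval_ge0.
- by rewrite exprn_ge0 // divr_ge0 ?absval_ge0.
- rewrite ler_wpM2l ?exprn_ge0 ?absval_ge0 // lef_pV2 ?posrE ?cardRX_gt0 //.
  exact: lam_ge.
- by rewrite exprn_ile1 ?divr_ge0 ?absval_ge0 // ler_pdivrMr // mul1r ltW.
Qed.

(** The exponential of the lattice A, that is, the product of w and of all 1 - w / a for a != 0. *)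
Definition eI (w : C) : C := av_lim (Coo_abs C) (fun N => eN N w).

Lemma eN_cvg w : av_cvg (Coo_abs C) (fun N => eN N w) (eI w).
Proof.
suff [l hl] : exists l, av_cvg (Coo_abs C) (fun N => eN N w) l.
  by rewrite /eI (av_limE hl).
apply: (av_cvg_step (@Coo_complete _ _ C)) => e e0.
have [N0 hN0] := cardRX_unbounded `|w|; set m := `|eN N0 w| ^+ 2.
have m0 : 0 < m + 1 by rewrite ltr_wpDl // exprn_ge0 // absval_ge0.
have [N1 hN1] := cardRXV_small (divr_gt0 e0 m0).
exists (maxn N0 N1) => n; rewrite geq_max => /andP[n0 n1].
apply: le_trans (eN_step_le n0 hN0) _.
rewrite -[leRHS](divfK (lt0r_neq0 m0)) mulrC; apply: ler_pM.
- exact: cardRXV_ge0.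
- by rewrite exprn_ge0 ?absval_ge0.
- by apply: le_trans hN1; exact: cardRXV_le.
- by rewrite lerDl.
Qed.

(** The size of [eN M w] no longer changes once q^M exceeds |w|; a zero of the limit is thus already
    a zero at a finite level, where [eN_lower] produces a lattice point at distance 0. *)
Lemma eI_eq0 w : eI w = 0 <-> exists a : {poly F}, w = emb a.
Proof.
split=> [e0|[a ->]]; last first.
  apply: av_cvg_unique (eN_cvg _) _.
  apply: (@av_cvg_eventually _ _ _ (fun=> 0) _ _ (size a)); last exact: av_cvg_cst.
  by move=> n an; rewrite eN_poly.
have [N wN] := cardRX_unbounded `|w|.
have E0 : `|eN N w| <= 0.
  apply/ler_addgt0Pl => e ep; rewrite addr0.
  have /av_cvgP /(_ e ep)[M hM] := eN_cvg w.
  have := hM (maxn N M) (leq_maxr _ _); rewrite e0 subr0.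
  by rewrite (eN_abs_stable _ wN) ?leq_maxl.
have [b _] := eN_lower 0 N w; rewrite addn0 => hb; exists b; apply/eqP.
rewrite -subr_eq0 -(@absval_neq0 _ _ (Coo_abs C)) eq_le absval_ge0 andbT.
exact: le_trans hb E0.
Qed.

Lemma TI1 w : (forall N, pole_free N w) -> TI 1 w = (eI w)^-1.
Proof.
move=> h; have E : TI 1 w * eI w = 1.
  apply: av_cvg_unique (av_cvgM (TN_cvg w (ltn0Sn 0)) (eN_cvg w)) _.
  apply: av_cvg_ext (av_cvg_cst _ _) => n.
  by rewrite TN1 // mulVf // eN_neq0.
have e0 : eI w != 0.
  by apply/eqP => e0; move/eqP: E; rewrite e0 mulr0 eq_sym oner_eq0.
by apply: (mulIf e0); rewrite E mulVf.
Qed.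

Lemma TI_expq k m w : (0 < k)%N -> TI (k * q ^ m) w = TI k w ^+ (q ^ m).
Proof.
move=> k0; have k1 : (0 < k * q ^ m)%N by rewrite muln_gt0 k0 cardFX_gt0.
apply: av_cvg_unique (TN_cvg w k1) _; apply: av_cvg_ext (av_cvgX _ (TN_cvg w k0)).
by move=> n; rewrite TN_expq.
Qed.

Lemma eI_small w : `|w| < 1 -> `|eI w - w| <= `|w| ^+ 2.
Proof.
move=> w1; have w1' : `|w| < q%:R ^+ 0 by rewrite expr0.
apply: (@av_cvg_ball _ _ _ (fun N => eN N w) _ _ _ 0 (eN_cvg w)) => n _.
apply: (@av_step_le _ _ _ (fun N => eN N w) _ 0) => [|m _|//].
  by rewrite exprn_ge0 ?absval_ge0.
apply: le_trans (eN_step_le (leq0n m) w1') _.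
by rewrite ler_piMr ?exprn_ge0 ?absval_ge0 // cardRXV_le1.
Qed.

(* Both sides are the normalized additive polynomial in [x] with kernel
   [F s + F t]. *)
Lemma line_comm (s t x : C) : s != 0 -> t != 0 -> line s t != 0 ->
  line (line s t) (line s x) = line (line t s) (line t x).
Proof.
move=> s0 t0 st0; set a := t ^+ q.-1; set b := s ^+ q.-1.
have a0 : a != 0 by rewrite expf_neq0.
have b0 : b != 0 by rewrite expf_neq0.
pose u := b - a.
have stE : line s t = t * u / b.
  by rewrite /line expq_predn -/a -/b /u; field.
have tsE : line t s = - (s * u / a).
  by rewrite /line expq_predn -/a -/b /u; field.
have u0 : u != 0 by apply: contra_neq st0 => u0; rewrite stE u0 mulr0 mul0r.
set A := a ^+ q.-1; set B := b ^+ q.-1; set D := u ^+ q.-1.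
have A0 : A != 0 by rewrite expf_neq0.
have B0 : B != 0 by rewrite expf_neq0.
have D0 : D != 0 by rewrite expf_neq0.
have uD : u * D = b * B - a * A.
  by rewrite /D /A /B -!expq_predn /u exprBq1.
have NX (y : C) : (- y) ^+ q.-1 = y ^+ q.-1.
  have [->|y0] := eqVneq y 0; first by rewrite oppr0.
  have Ny0 : - y != 0 by rewrite oppr_eq0.
  apply: (mulfI Ny0); rewrite -expq_predn.
  by have := exprNq y 1; rewrite !expn1 => ->; rewrite expq_predn mulNr.
have E1 : line s t ^+ q.-1 = a * D / B by rewrite stE expr_div_n exprMn.
have E2 : line t s ^+ q.-1 = b * D / A by rewrite tsE NX expr_div_n exprMn.
rewrite /line -/(line s t) -/(line t s) E1 E2 -/a -/b !exprBq1 !expr_div_n.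
rewrite (expq_predn a) (expq_predn b) -/A -/B.
(* The relation [uD] is the additivity of Frobenius; eliminating A by it leaves an identity of
   rational functions. *)
have -> : A = (b * B - u * D) / a by rewrite uD; field.
have bBuD : b * B - u * D != 0 by rewrite uD opprB addrC subrK mulf_neq0.
by rewrite /u in uD bBuD *; field; rewrite a0 b0 B0 D0 bBuD.
Qed.

Definition muN (N : nat) : C := eN N th^-1.

Lemma line_scale_th (c s t : C) : c != 0 -> line (c * s) (c * t) = c * line s t.
Proof.
move=> c0; rewrite /line !exprMn (expq_predn c).
have [->|s0] := eqVneq s 0; last by field; rewrite !expf_neq0.
have q1 : (q.-1 == 0)%N = false by have := cardF_gt1 F; lia.
by rewrite !expr0n q1 !mulr0 invr0 !mulr0 !subr0.
Qed.

Lemma thV_notin (a : {poly F}) : th^-1 != emb a.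
Proof.
apply/eqP => e; have a0 : a != 0 by rewrite -(@emb_eq0 R F C) -e invr_eq0 th_neq0.
have : `|th^-1| < 1.
  by rewrite absvalV th_abs invf_lt1 ?cardR_gt0 ?cardR_gt1.
by rewrite e emb_abs // ltNge exprn_ege1 ?cardR_ge1.
Qed.

Lemma muN_neq0 N : muN N != 0.
Proof.
by apply: eN_neq0 => b _; rewrite -[emb b]opprK -embN subr_eq0 thV_notin.
Qed.

(** The polynomials of degree at most N, divided by th, form the lattice of level N enlarged by the
    line through th^-1. The induction on N adds the lines of th^-1 and th^N in either order, by
    [line_comm]. *)
Lemma eN_th N x : eN N.+1 (th * x) = th * line (muN N) (eN N x).
Proof.
elim: N x => [|N IH] x.
  rewrite eNS /lam /muN /= expr0 -{1}(mulfV (th_neq0 C)) line_scale_th //.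
  exact: th_neq0.
have lE : lam N.+1 = th * line (muN N) (lam N) by rewrite /lam exprS IH.
rewrite eNS lE IH line_scale_th ?th_neq0 // line_comm ?muN_neq0 ?lam_neq0 //.
by apply: contra_neq (@lam_neq0 R F C N.+1) => l0; rewrite lE l0 mulr0.
Qed.

Definition mu : C := eI th^-1.

Lemma mu_neq0 : mu != 0.
Proof. by apply/eqP => /eI_eq0[a /eqP]; apply/negP/thV_notin. Qed.

(** The functional equation of a rank one Drinfeld module with th x - (th / mu^(q - 1)) x^q in place
    of th x + x^q. A scaling by T with T^(q - 1) = - th / mu^(q - 1) identifies the two. *)
Lemma eI_th x : eI (th * x) = th * line mu (eI x).
Proof.
have mu0 : mu ^+ q.-1 != 0 by rewrite expf_neq0 ?mu_neq0.
suff E : (eI (th * x) - th * eI x) * mu ^+ q.-1 = - (th * eI x ^+ q).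
  apply: (mulIf mu0); apply: (addIr (- (th * eI x * mu ^+ q.-1))).
  by rewrite -mulrBl E /line; field.
apply: av_cvg_unique (av_cvgM (av_cvgD (av_cvgS (eN_cvg (th * x)))
  (av_cvgN (av_cvgZ th (eN_cvg x)))) (av_cvgX q.-1 (eN_cvg th^-1))) _.
apply: av_cvg_ext (av_cvgN (av_cvgZ th (av_cvgX q (eN_cvg x)))) => n.
rewrite eN_th -/(muN n) /line; field.
by rewrite expf_neq0 ?muN_neq0.
Qed.

End InfiniteExponential.

(** * Comparison with the Carlitz exponential, and its logarithm coefficients *)

Section CarlitzExponential.
Variables (R : realType) (F : finFieldType) (C : complex_infty R F).
Local Notation q := #|F|.
Local Notation "`| x |" := (Coo_abs C x) : ring_scope.
Local Notation emb := (@emb R F C).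
Local Notation th := (th C).
Local Notation mu := (mu C).
Local Notation D := (carlitz_D C).

Lemma carlitz_D_abs i : `|D i| = q%:R ^+ (i * q ^ i).
Proof.
rewrite /carlitz_D absval_prod (eq_bigr (fun=> q%:R ^+ (q ^ i))) => [|j _].
  by rewrite prodr_const card_ord -exprM mulnC.
rewrite -/th absvalD_isosceles ?absvalN !absvalX th_abs //.
by rewrite ltr_eXn2l ?cardR_gt1 // ltn_exp2l ?cardF_gt1.
Qed.

Lemma carlitz_D_neq0 i : D i != 0.
Proof. by rewrite -(@absval_gt0 _ _ (Coo_abs C)) carlitz_D_abs cardRX_gt0. Qed.

Lemma carlitz_DS i : D i.+1 = (th ^+ (q ^ i.+1) - th) * D i ^+ q.
Proof.
rewrite /carlitz_D big_ord_recl expn0 expr1 -prodrXl; congr (_ * _).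
by apply: eq_bigr => j _; rewrite exprBq1 -!exprM -!expnSr.
Qed.

Definition ec_term (z : C) (i : nat) : C := z ^+ (q ^ i) / D i.

Lemma ec_term_abs z i : `|ec_term z i| = (`|z| / q%:R ^+ i) ^+ (q ^ i).
Proof.
by rewrite absvalM absvalV absvalX carlitz_D_abs expr_div_n -exprM.
Qed.

Lemma ec_term_cvg z : av_cvg (Coo_abs C) (ec_term z) 0.
Proof.
apply/av_cvgP => e e0; have [N0 hN0] := cardRX_unbounded F `|z|.
have [N1 hN1] := @cardRXV_small R F e e0.
exists (maxn N0.+1 N1) => n; rewrite geq_max => /andP[n0 n1].
rewrite subr0 ec_term_abs.
have h : `|z| / q%:R ^+ n <= q%:R^-1.
  rewrite ler_pdivrMr ?cardRX_gt0 // -(prednK (leq_trans (ltn0Sn _) n0)) exprS.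
  rewrite mulKf ?lt0r_neq0 ?cardR_gt0 // (le_trans (ltW hN0)) //.
  by rewrite ler_weXn2l ?cardR_ge1 //; move: n0; case: n {n1}.
apply: (@le_trans _ _ (q%:R^-1 ^+ (q ^ n))).
  by rewrite lerXn2r ?nnegrE ?invr_ge0 ?divr_ge0 ?absval_ge0 // ?ltW ?cardRX_gt0 ?cardR_gt0.
rewrite exprVn; apply: le_trans hN1; apply: cardRXV_le.
by rewrite (leq_trans n1) // ltnW // ltn_expl // cardF_gt1.
Qed.

Lemma ec_cvg (z : C) :
  av_cvg (Coo_abs C) (fun n => \sum_(i < n) ec_term z i) (carlitz_exp z).
Proof.
have [l hl] := av_cvg_series (@Coo_complete _ _ C) (ec_term_cvg z).
by rewrite /carlitz_exp (av_limE hl).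
Qed.

Lemma ec_add (z z' : C) : carlitz_exp (z + z') = carlitz_exp z + carlitz_exp z'.
Proof.
apply: av_cvg_unique (ec_cvg _) _.
apply: av_cvg_ext (av_cvgD (ec_cvg z) (ec_cvg z')) => n.
by rewrite -big_split; apply: eq_bigr => i _; rewrite /ec_term exprDq mulrDl.
Qed.

Lemma ec_scale (z : C) (c : F) :
  carlitz_exp (emb c%:P * z) = emb c%:P * carlitz_exp z.
Proof.
apply: av_cvg_unique (ec_cvg _) _.
apply: av_cvg_ext (av_cvgZ (emb c%:P) (ec_cvg z)) => n.
rewrite mulr_sumr; apply: eq_bigr => i _.
by rewrite /ec_term exprMn embC_expqX mulrA.
Qed.

Lemma ec_th (z : C) : carlitz_exp (th * z) = th * carlitz_exp z + carlitz_exp z ^+ q.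
Proof.
apply: av_cvg_unique (av_cvgS (ec_cvg _)) _.
apply: av_cvg_ext (av_cvgD (av_cvgZ th (av_cvgS (ec_cvg z)))
  (av_cvgX q (ec_cvg z))) => n.
have := expr_sumq (index_enum 'I_n) xpredT (fun i : 'I_n => ec_term z i) 1.
rewrite expn1 => ->; rewrite !big_ord_recl mulrDr -addrA; congr (_ + _).
  by rewrite /ec_term /carlitz_D big_ord0 expn0 !expr1 invr1 !mulr1.
rewrite mulr_sumr -big_split; apply: eq_bigr => i _.
rewrite /ec_term lift0 carlitz_DS expr_div_n -exprM -expnSr exprMn.
have h : D i ^+ q != 0 by rewrite expf_neq0 ?carlitz_D_neq0.
have h' : th ^+ (q ^ i.+1) - th != 0.
  by apply: contra_neq (carlitz_D_neq0 i.+1) => e; rewrite carlitz_DS e mul0r.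
by rewrite /=; field; rewrite h h'.
Qed.

Lemma ec_small (z : C) : `|z| <= 1 -> `|carlitz_exp z - z| <= `|z| ^+ 2.
Proof.
move=> z1; apply: (@av_cvg_ball _ _ _ _ _ _ _ 1 (ec_cvg z)) => -[//|n] _.
rewrite big_ord_recl /ec_term /carlitz_D big_ord0 expn0 expr1 invr1 mulr1.
rewrite addrC addKr; apply: absval_sum_le => [|i _].
  by rewrite exprn_ge0 ?absval_ge0.
have /= -> := ec_term_abs z i.+1.
apply: (@le_trans _ _ (`|z| ^+ (q ^ i.+1))).
  have d0 : 0 <= `|z| / q%:R ^+ i.+1 by rewrite divr_ge0 ?absval_ge0 ?ltW ?cardRX_gt0.
  rewrite lerXn2r ?nnegrE ?absval_ge0 //.
  by rewrite ler_piMr ?absval_ge0 // cardRXV_le1.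
rewrite ler_wiXn2l ?absval_ge0 //.
by rewrite (leq_trans (cardF_gt1 F)) // -{1}(expn1 q) leq_exp2l ?cardF_gt1.
Qed.

Lemma ec0 : carlitz_exp (0 : C) = 0.
Proof. by have := ec_scale 0 0; rewrite emb0 !mul0r. Qed.

(* Both sides are additive, of the form [x + O(x^2)] near [0], and satisfy the
   same functional equation under multiplication by [th]; going from [x / th^k]
   up to [x] multiplies their difference, of size [O(q^(-2k))], by at most
   [q^k]. *)
Lemma eI_carlitz (T x : C) : T != 0 -> T ^+ q.-1 = - th / mu ^+ q.-1 ->
  eI x = T^-1 * carlitz_exp (T * x).
Proof.
move=> T0 TE; pose d y := eI y - T^-1 * carlitz_exp (T * y).
have mu0 : mu ^+ q.-1 != 0 by rewrite expf_neq0 ?mu_neq0.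
have dth y : d (th * y) = th * line mu (d y).
  rewrite /d eI_th mulrCA ec_th /line exprBq1 exprMn exprVn (expq_predn T).
  by rewrite TE; field; rewrite mu0 T0 andbT oppr_eq0; exact: th_neq0.
pose c := 1 + `|T|; have c0 : 0 < c by rewrite ltr_wpDr ?absval_ge0.
have small y : `|y| < 1 -> `|T * y| <= 1 -> `|d y| <= c * `|y| ^+ 2.
  move=> y1 Ty1.
  have -> : d y = (eI y - y) - T^-1 * (carlitz_exp (T * y) - T * y).
    by rewrite /d mulrBr mulKf //; ring.
  apply: absvalB_le.
    apply: le_trans (eI_small y1) _.
    by rewrite ler_peMl ?exprn_ge0 ?absval_ge0 // lerDl absval_ge0.
  rewrite absvalM; apply: (@le_trans _ _ (`|T^-1| * `|T * y| ^+ 2)).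
    by rewrite ler_wpM2l ?absval_ge0 // ec_small.
  have -> : `|T^-1| * `|T * y| ^+ 2 = `|T| * `|y| ^+ 2.
    by rewrite absvalM absvalV; field; rewrite absval_neq0.
  by rewrite ler_wpM2r ?exprn_ge0 ?absval_ge0 // lerDr.
have step y : `|d y| <= `|mu| -> `|d (th * y)| <= q%:R * `|d y|.
  move=> dm; rewrite dth absvalM th_abs ler_wpM2l ?ler0n //.
  apply: absvalB_le => //; rewrite absvalM absvalV !absvalX.
  rewrite -[X in _ ^+ X](prednK (cardF_gt0 F)) exprS -mulrA ler_piMr ?absval_ge0 //.
  rewrite ler_pdivrMr ?exprn_gt0 ?absval_gt0 ?mu_neq0 // mul1r.
  by rewrite lerXn2r ?nnegrE ?absval_ge0.
suff /eqP : d x = 0 by rewrite subr_eq0 => /eqP.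
apply/eqP; rewrite -(@absval_neq0 _ _ (Coo_abs C)) eq_le absval_ge0 andbT.
pose B := c * `|x| ^+ 2; have B0 : 0 <= B.
  by rewrite mulr_ge0 ?exprn_ge0 ?absval_ge0 // ltW.
apply/ler_addgt0Pl => e e0; rewrite addr0.
(* A bound by m serves twice: below |mu| the inequality [step] applies, and below e the conclusion
   follows. *)
pose m := Num.min e `|mu|; have m0 : 0 < m.
  by rewrite lt_min e0 absval_gt0 mu_neq0.
have B1 : 0 < B + 1 by rewrite ltr_wpDl.
have [k1 hk1] := cardRX_unbounded F `|x|.
have [k2 hk2] := cardRX_unbounded F `|T * x|.
have [k3 hk3] := @cardRXV_small R F _ (divr_gt0 m0 B1).
pose k := maxn k1 (maxn k2 k3).
have xk j : `|x / th ^+ j| = `|x| * q%:R ^- j.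
  by rewrite absvalM absvalV absvalX th_abs.
have kB : B * q%:R ^- k <= m.
  have h : q%:R ^- k <= m / (B + 1).
    by apply: le_trans hk3; apply: cardRXV_le; rewrite !leq_max leqnn !orbT.
  apply: (@le_trans _ _ ((B + 1) * (m / (B + 1)))).
    by rewrite ler_pM ?cardRXV_ge0 // lerDl.
  by rewrite mulrC divfK ?lt0r_neq0.
have main j : (j <= k)%N -> `|d (x / th ^+ (k - j))| <= B * q%:R ^- k * q%:R ^- (k - j).
  elim: j => [|j IH] jk.
    rewrite subn0; apply: le_trans (small _ _ _) _.
    - rewrite xk ltr_pdivrMr ?cardRX_gt0 // mul1r (lt_le_trans hk1) //.
      by rewrite ler_weXn2l ?cardR_ge1 // leq_max leqnn.
    - rewrite mulrA absvalM absvalV absvalX th_abs ler_pdivrMr ?cardRX_gt0 // mul1r.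
      by rewrite (le_trans (ltW hk2)) // ler_weXn2l ?cardR_ge1 // !leq_max leqnn orbT.
    by rewrite xk (_ : c * _ = B / q%:R ^+ k / q%:R ^+ k) // /B; ring.
  have kj : (k - j = (k - j.+1).+1)%N by rewrite subnSK.
  have {IH}IH := IH (ltnW jk); rewrite kj in IH.
  have -> : x / th ^+ (k - j.+1) = th * (x / th ^+ (k - j.+1).+1).
    by rewrite exprS invfM mulrCA mulVKf ?th_neq0.
  apply: le_trans (step _ _) _.
    apply: le_trans IH _; apply: (@le_trans _ _ (B * q%:R ^- k)).
      by rewrite ler_piMr ?cardRXV_le1 // mulr_ge0 ?cardRXV_ge0.
    by apply: le_trans kB _; rewrite ge_min lexx orbT.
  rewrite -[leRHS](mulVKf (lt0r_neq0 (cardR_gt0 R F))) ler_wpM2l ?ler0n //.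
  by apply: le_trans IH _; rewrite exprS invfM [leLHS]mulrCA.
have := main k (leqnn k); rewrite subnn expr0 divr1 invr1 mulr1 => h.
by apply: le_trans h _; apply: le_trans kB _; rewrite ge_min lexx.
Qed.

Section Period.
Variable tpi : C.
Hypothesis htpi : carlitz_period tpi.

(** A root T of the equation exists as C is algebraically closed, and by [eI_carlitz] the kernel of
    the Carlitz exponential is A T. It is also A tpi, so T and tpi differ by a unit of A, a nonzero
    constant c, and c^(q - 1) = 1. *)
Lemma period_spec : tpi != 0 /\ tpi ^+ q.-1 = - th / mu ^+ q.-1.
Proof.
have q1 : (0 < q.-1)%N by have := cardF_gt1 F; lia.
pose P : {poly C} := 'X^(q.-1) - (- th / mu ^+ q.-1)%:P.
have sP : size P != 1%N.
  rewrite /P size_polyDl ?size_polyXn ?size_polyN; first by rewrite eqSS -lt0n.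
  by rewrite (leq_ltn_trans (size_polyC_leq1 _)).
have /closed_rootP[T] := sP.
rewrite /root /P hornerD hornerN hornerXn hornerC subr_eq0 => /eqP TE.
have mu0 : mu ^+ q.-1 != 0 by rewrite expf_neq0 ?mu_neq0.
have T0 : T != 0.
  apply/eqP => T0; move/eqP: TE; rewrite T0 expr0n gtn_eqF // eq_sym.
  by rewrite mulf_eq0 invr_eq0 oppr_eq0 (negbTE (th_neq0 C)) (negbTE mu0).
have ecT x : carlitz_exp (T * x) = T * eI x by rewrite (eI_carlitz x T0 TE) mulVKf.
have /htpi[a Ta] : carlitz_exp T = 0.
  rewrite -[T]mulr1 ecT (_ : eI 1 = 0) ?mulr0 //.
  by apply/eI_eq0; exists 1; rewrite emb1.
have ec_tpi : carlitz_exp tpi = 0 by apply/htpi; exists 1; rewrite -/(emb 1) emb1 mul1r.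
have [b tb] : exists b : {poly F}, tpi / T = emb b.
  apply/eI_eq0; apply: (mulfI T0).
  by rewrite -ecT mulrC divfK // ec_tpi mulr0.
rewrite -/(emb a) in Ta.
have tpi0 : tpi != 0 by apply: contra_neq T0 => t0; rewrite Ta t0 mulr0.
have ab : a * b = 1.
  apply/eqP; rewrite -subr_eq0 -(@emb_eq0 R F C) embD embN embM emb1 -tb mulrA -Ta.
  by rewrite mulfV // subrr.
have ua : a \is a GRing.unit by apply/unitrPr; exists b.
have [c c0 ac] : exists2 c : F, c != 0 & a = c%:P.
  move: ua; rewrite poly_unitE => /andP[/eqP/eqP/size_poly1P[c c0 ->] _].
  by exists c.
split=> //; rewrite -TE Ta ac exprMn.
have ec0 : emb c%:P != 0 by rewrite emb_eq0 polyC_eq0.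
suff -> : emb c%:P ^+ q.-1 = 1 by rewrite mul1r.
by apply: (mulfI ec0); rewrite -expq_predn embC_expq mulr1.
Qed.

Lemma tpi_neq0 : tpi != 0. Proof. by have [] := period_spec. Qed.

Lemma carlitz_exp_tpi w : carlitz_exp (tpi * w) = tpi * eI w.
Proof. by have [t0 tE] := period_spec; rewrite (eI_carlitz w t0 tE) mulVKf. Qed.

Lemma u_paramE w : (forall N, pole_free N w) -> u_param tpi w = TI 1 w / tpi.
Proof. by move=> h; rewrite /u_param carlitz_exp_tpi TI1 // invfM mulrC. Qed.

Definition carlitz_L (n : nat) : {poly F} := \prod_(j < n) ('X ^+ (q ^ j.+1) - 'X).

Lemma carlitz_LS n : carlitz_L n.+1 = carlitz_L n * ('X ^+ (q ^ n.+1) - 'X).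
Proof. by rewrite /carlitz_L big_ord_recr. Qed.

Lemma carlitz_L_neq0 n : carlitz_L n != 0.
Proof.
apply/prodf_neq0 => j _; rewrite subr_eq0; apply/eqP => e.
have := congr1 (fun p : {poly F} => size p) e; rewrite size_polyXn size_polyX.
move=> [e1]; have : (1 < q ^ j.+1)%N by rewrite -(exp1n j.+1) ltn_exp2r ?cardF_gt1.
by rewrite e1.
Qed.

(* The coefficients of the logarithm of the lattice [A]. *)
Definition beI (k : nat) : C := if k == 0%N then 1 else - TI (q ^ k - 1) 0.

Lemma be_cvg k : av_cvg (Coo_abs C) (fun N => be C N k) (beI k).
Proof.
rewrite /beI; case: k => [|k] /=.
  by apply: av_cvg_ext (av_cvg_cst _ _) => n; rewrite be_0.
have k0 : (0 < q ^ k.+1 - 1)%N by rewrite subn_gt0 -(exp1n k.+1) ltn_exp2r ?cardF_gt1.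
by apply: av_cvg_ext (av_cvgN (TN_cvg 0 k0)) => n; rewrite TN_0 // opprK.
Qed.

End Period.

(** Splitting off the constant coefficient instead of the leading one leaves multiples of 'X, as
    needed to compare lattices under multiplication by theta. *)
Lemma sumA_low N (V : nmodType) (f : {poly F} -> V) :
  sumA N.+1 f = \sum_(c : F) sumA N (fun b => f (c%:P + b * 'X)).
Proof.
elim: N f => [|N IH] f.
  rewrite sumAS; apply: eq_bigr => c _; rewrite !sumA0 expr0 mul0r add0r addr0.
  by rewrite -mul_polyC mulr1.
rewrite sumAS (eq_bigr _ (fun c _ => IH _)) exchange_big /=.
apply: eq_bigr => c _; rewrite sumAS; apply: eq_bigr => c' _.
apply: eq_sumA => b _; congr f.
by rewrite mulrDl -scalerAl -exprSr addrA.
Qed.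

Lemma TN_th k N w :
  TN k N.+1 (th * w) = th^-1 ^+ k * \sum_(c : F) TN k N (w + emb c%:P * th^-1).
Proof.
rewrite /TN sumA_low mulr_sumr; apply: eq_bigr => c _.
rewrite mulr_sumr; apply: eq_bigr => v _; rewrite -exprMn -invfM; congr (_^-1 ^+ k).
rewrite embD embM -/th; field; exact: th_neq0.
Qed.

(** The power sum of level N + 1 at 0 is computed twice: by [TN_0], and by [TN_th] as a sum over the
    points c th^-1, where [TN_be] applies for c != 0. *)
Lemma be_th n N : (0 < n)%N ->
  \sum_(i < n) be C N i * muN C N ^+ (q ^ i) =
  (th ^+ (q ^ n - 1) * be C N.+1 n - be C N n) * muN C N ^+ (q ^ n).
Proof.
move=> n0; have m0 := muN_neq0 C N.
have qn : (0 < q ^ n - 1)%N.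
  by rewrite subn_gt0 -{1}(exp1n n) ltn_exp2r ?cardF_gt1.
set X := \sum_(i < n) be C N i * (muN C N)^-1 ^+ (q ^ n - q ^ i).
have E : TN (q ^ n - 1) N.+1 0 = th^-1 ^+ (q ^ n - 1) * (- be C N n - X).
  rewrite -[X in TN _ _ X](mulr0 th) TN_th (bigD1 0) //= emb0 mul0r addr0 TN_0 //.
  congr (_ * (_ + _)); transitivity (\sum_(c : F | c != 0) X).
    apply: eq_bigr => c c0; rewrite add0r.
    have ce0 : emb c%:P != 0 by rewrite emb_eq0 polyC_eq0.
    rewrite TN_be //; last first.
      move=> b _; rewrite -[emb b]opprK -embN subr_eq0; apply/eqP => e.
      have /eqP := @thV_notin _ _ C (c^-1%:P * - b); apply.
      by rewrite embM -e mulrA -embM -polyCM mulVf // emb1 mul1r.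
    apply: eq_bigr => i _; congr (_ * _); rewrite eN_scale -/(muN C N) invfM exprMn.
    have qi : (q ^ i <= q ^ n)%N by rewrite leq_exp2l ?cardF_gt1 // ltnW.
    by rewrite [X in X * _]exprV_sub // exprVn !embC_expqX mulfV ?mul1r.
  have : \sum_(c : F) X = 0 by rewrite sumr_const -mulr_natr cardF_natr0 mulr0.
  by rewrite (bigD1 0) //= => /addr0_eq ->.
have XE : X = th ^+ (q ^ n - 1) * be C N.+1 n - be C N n.
  move: E; rewrite TN_0 // => /(congr1 (fun y => th ^+ (q ^ n - 1) * y)).
  rewrite exprVn mulVKf ?expf_neq0 ?th_neq0 // mulrN => e.
  by rewrite -[LHS](subKr (- be C N n)) -e opprK addrC.
rewrite -XE mulr_suml; apply: eq_bigr => i _.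
rewrite exprV_sub //; last by rewrite leq_exp2l ?cardF_gt1 // ltnW.
by rewrite -!mulrA -exprMn mulVf // expr1n mulr1.
Qed.

Lemma beI_th n : (0 < n)%N ->
  \sum_(i < n) beI i * mu ^+ (q ^ i) =
  (th ^+ (q ^ n - 1) - 1) * (beI n * mu ^+ (q ^ n)).
Proof.
move=> n0; have -> : (th ^+ (q ^ n - 1) - 1) * (beI n * mu ^+ (q ^ n)) =
  (th ^+ (q ^ n - 1) * beI n - beI n) * mu ^+ (q ^ n) by ring.
apply: av_cvg_unique (av_cvg_sum _ (fun i : 'I_n =>
  av_cvgM (be_cvg i) (av_cvgX (q ^ i) (eN_cvg th^-1)))) _.
apply: av_cvg_ext (av_cvgM (av_cvgD (av_cvgZ (th ^+ (q ^ n - 1))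
  (av_cvgS (be_cvg n))) (av_cvgN (be_cvg n))) (av_cvgX (q ^ n) (eN_cvg th^-1))) => N.
by rewrite -be_th.
Qed.

(** The recursion [beI_th] determines [beI] because mu and the th^(q^n - 1) - 1 do not vanish. The
    closed form, multiplied by mu^(q^m) to give [Z m], satisfies a two-term relation that makes its
    partial sums telescope; tpi enters it through (tpi mu)^(q - 1) = - th. *)
Lemma beIE (tpi : C) n : carlitz_period tpi ->
  beI n = (-1) ^+ n * tpi ^+ (q ^ n - 1) / emb (carlitz_L n).
Proof.
move=> /period_spec[t0 tE].
have mu0 := mu_neq0 C; have mu0' : mu ^+ q.-1 != 0 by rewrite expf_neq0.
pose Z m := (-1) ^+ m * tpi ^+ (q ^ m - 1) * mu ^+ (q ^ m) / emb (carlitz_L m).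
have L0 m : emb (carlitz_L m) != 0 by rewrite emb_eq0 carlitz_L_neq0.
have X0 m : th ^+ (q ^ m.+1) - th != 0.
  have := L0 m.+1; rewrite carlitz_LS embM embD embN embX.
  by rewrite mulf_eq0 negb_or => /andP[].
have thE m : th ^+ (q ^ m.+1) - th = th * (th ^+ (q ^ m.+1 - 1) - 1).
  by rewrite mulrBr mulr1 -exprS subn1 prednK ?cardFX_gt0.
have ZS m : Z m.+1 * (th ^+ (q ^ m.+1 - 1) - 1) = th ^+ (q ^ m - 1) * Z m.
  have E : (tpi * mu) ^+ (q ^ m.+1 - q ^ m) = - th ^+ (q ^ m).
    rewrite expnS -{2}[(q ^ m)%N]mul1n -mulnBl subn1 exprM exprMn tE divfK //.
    by rewrite exprNq.
  have qm : (q ^ m <= q ^ m.+1)%N by rewrite leq_exp2l ?cardF_gt1.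
  have E1 : tpi ^+ (q ^ m.+1 - 1) * mu ^+ (q ^ m.+1) =
      - th ^+ (q ^ m) * (tpi ^+ (q ^ m - 1) * mu ^+ (q ^ m)).
    rewrite -E exprMn mulrACA -!exprD subnK //.
    by rewrite addnBA ?cardFX_gt0 // subnK.
  rewrite /Z carlitz_LS embM embD embN embX -/th thE exprS mulN1r !mulNr.
  rewrite -[_ * _ * mu ^+ (q ^ m.+1)]mulrA E1.
  have -> : th ^+ (q ^ m) = th * th ^+ (q ^ m - 1).
    by rewrite -exprS subn1 prednK ?cardFX_gt0.
  have := X0 m; rewrite thE mulf_eq0 negb_or => /andP[_ h].
  by move: (th) (th_neq0 C) h => t t_neq0 h; field; rewrite L0 t_neq0 h.
have G m : \sum_(i < m) beI i * mu ^+ (q ^ i) = (th ^+ (q ^ m - 1) - 1) * Z m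
    /\ beI m * mu ^+ (q ^ m) = Z m.
  elim: m => [|m [IH1 IH2]].
    rewrite big_ord0 expn0 subnn expr0 subrr mul0r; split=> //.
    by rewrite /Z /beI /carlitz_L big_ord0 emb1 divr1 !expr0 !mul1r.
  have S1 : \sum_(i < m.+1) beI i * mu ^+ (q ^ i) = (th ^+ (q ^ m.+1 - 1) - 1) * Z m.+1.
    by rewrite big_ord_recr /= IH1 IH2 [RHS]mulrC ZS; ring.
  split=> //; have := beI_th (ltn0Sn m); rewrite S1 => /esym/mulfI; apply.
  by have := X0 m; rewrite thE mulf_eq0 negb_or => /andP[].
have [_] := G n; rewrite /Z => h.
apply: (mulIf (expf_neq0 (q ^ n) mu0)); rewrite h.
by rewrite [RHS]mulrAC.
Qed.

End CarlitzExponential.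

(** * The upper half plane and GL_2(A) *)

Section UpperHalfPlane.
Variables (R : realType) (F : finFieldType) (C : complex_infty R F).
Local Notation q := #|F|.
Local Notation "`| x |" := (Coo_abs C x) : ring_scope.
Local Notation emb := (@emb R F C).
Local Notation th := (th C).

Lemma emb_abs_ge1 a : a != 0 -> 1 <= `|emb a|.
Proof. by move=> a0; rewrite emb_abs // exprn_ege1 ?cardR_ge1. Qed.

Lemma size_emb_lt (a : {poly F}) n : `|emb a| < q%:R ^+ n -> (size a <= n)%N.
Proof.
have [->|a0] := eqVneq a 0; first by rewrite size_poly0.
rewrite emb_abs // ltr_eXn2l ?cardR_gt1 // /deg.
by rewrite -[size a in X in _ -> X]prednK // size_poly_gt0.
Qed.

(** Membership in the closure of K. It is equivalent to [Koo], but its stability under affine maps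
    over A and under inversion can be checked on fractions, without manipulating Laurent series. *)
Definition Kapprox (x : C) : Prop := forall e : R, 0 < e ->
  exists a, exists2 b, b != 0 & `|x - emb a / emb b| <= e.

Lemma thz_shift N n i : (i <= n)%N ->
  th ^ (N%:Z - i%:Z) = th ^+ (N + n - i) / th ^+ n.
Proof.
move=> ni; apply: (mulIf (expf_neq0 n (th_neq0 C))).
rewrite divfK ?expf_neq0 ?th_neq0 // !exprnP -expfzDr ?th_neq0 //.
by congr (_ ^ _); lia.
Qed.

Lemma Koo_approx (x : C) : Koo x -> Kapprox x.
Proof.
move=> [N [c /av_cvgP h]] e e0; have [n hn] := h e e0.
exists (\sum_(i < n) c i *: 'X^(N + n - i)), 'X^n; first by rewrite monic_neq0 ?monicXn.
rewrite absvalBC (_ : _ / _ = \sum_(i < n) emb (c i)%:P * th ^ (N%:Z - i%:Z)) ?hn //.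
rewrite emb_sum mulr_suml; apply: eq_bigr => i _.
by rewrite embZ !embX (thz_shift N (ltnW (ltn_ord i))) mulrA.
Qed.

Lemma integer_part x : Kapprox x -> exists a : {poly F}, `|x - emb a| < 1.
Proof.
move=> /(_ (1 / 2))[|a [b b0 hab]]; first by rewrite divr_gt0.
exists (a %/ b).
have -> : x - emb (a %/ b) = (x - emb a / emb b) + emb (a %% b) / emb b.
  rewrite {2}(divp_eq a b) embD embM; field; by rewrite emb_eq0.
apply: absvalD_lt; first by rewrite (le_lt_trans hab) // ltr_pdivrMr // mul1r ltr1n.
rewrite absvalM absvalV (emb_abs C b0) ltr_pdivrMr ?cardRX_gt0 // mul1r emb_abs_lt //.
by rewrite -ltnS /deg prednK ?size_poly_gt0 // ltn_modp.
Qed.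

Lemma Kapprox_lin x (a b : {poly F}) : Kapprox x -> Kapprox (emb a * x + emb b).
Proof.
move=> h e e0; have a0 : 0 < `|emb a| + 1 by rewrite ltr_wpDl ?absval_ge0.
have [s [t t0 hst]] := h _ (divr_gt0 e0 a0); exists (a * s + b * t), t => //.
have -> : emb a * x + emb b - emb (a * s + b * t) / emb t = emb a * (x - emb s / emb t).
  by rewrite embD !embM; field; rewrite emb_eq0.
rewrite absvalM -[leRHS](divfK (lt0r_neq0 a0)) mulrC.
by apply: ler_pM; rewrite ?absval_ge0 // lerDl.
Qed.

Lemma Kapprox_divth x n : Kapprox x -> Kapprox (x / th ^+ n).
Proof.
move=> h e e0; have [s [t t0 hst]] := h e e0.
exists s, (t * 'X^n); first by rewrite mulf_neq0 // monic_neq0 ?monicXn.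
have -> : x / th ^+ n - emb s / emb (t * 'X^n) = (x - emb s / emb t) / th ^+ n.
  by rewrite embM embX -/th invfM mulrBl mulrA.
rewrite absvalM absvalV absvalX th_abs; apply: le_trans hst.
by rewrite ler_piMr ?absval_ge0 // cardRXV_le1.
Qed.

(** The digits are read off integer parts: if [Q m] is the one of th^m x / th^(N + 1), then
    [Q m.+1 - 'X * Q m] has absolute value less than q and is a constant, the next digit. The choice
    of N makes [Q 0] vanish. *)
Lemma approx_Koo (x : C) : Kapprox x -> Koo x.
Proof.
move=> h; have [N hN] := cardRX_unbounded F `|x|.
pose y m := th ^+ m * (x / th ^+ N.+1).
have /choice[Q hQ] : forall m, exists a : {poly F}, `|y m - emb a| < 1.
  move=> m; apply: integer_part.
  have := Kapprox_lin ('X^m) 0 (Kapprox_divth N.+1 h).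
  by rewrite embX emb0 addr0.
have yS m : y m.+1 = th * y m by rewrite /y exprS -!mulrA.
have y0 : `|y 0| < 1.
  rewrite /y mul1r absvalM absvalV absvalX th_abs ltr_pdivrMr ?cardRX_gt0 // mul1r.
  by rewrite (lt_trans hN) // ltr_eXn2l ?cardR_gt1.
have Q0 : Q 0 = 0.
  apply/eqP; rewrite -size_poly_leq0 size_emb_lt // expr0.
  rewrite (_ : emb (Q 0) = y 0 - (y 0 - emb (Q 0))); last by ring.
  exact: absvalB_lt.
pose c m := (Q m.+1)`_0.
have QS m : Q m.+1 = 'X * Q m + (c m)%:P.
  have : (size (Q m.+1 - 'X * Q m)%R <= 1)%N.
    rewrite size_emb_lt // expr1 embD embN embM -/th.
    have -> : emb (Q m.+1) - th * emb (Q m) =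
        th * (y m - emb (Q m)) - (y m.+1 - emb (Q m.+1)) by rewrite yS; ring.
    apply: absvalB_lt; last by rewrite (lt_trans (hQ _)) // cardR_gt1.
    by rewrite absvalM th_abs gtr_pMr ?cardR_gt0.
  move=> /size1_polyC => e; have := congr1 (fun p : {poly F} => p + 'X * Q m) e.
  rewrite subrK addrC => ->; congr (_ + _%:P).
  by rewrite coefB coefXM eqxx subr0.
exists N, c; apply/av_cvgP => e e0.
have S n : \sum_(i < n) emb (c i)%:P * th ^ (N%:Z - i%:Z) =
    emb (Q n) * th ^ (N.+1%:Z - n%:Z).
  elim: n => [|n IH]; first by rewrite big_ord0 Q0 emb0 mul0r.
  rewrite big_ord_recr /= IH QS embD embM -/th.
  have -> : th ^ (N.+1%:Z - n%:Z) = th * th ^ (N.+1%:Z - n.+1%:Z).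
    by rewrite -{2}(expr1z th) -expfzDr ?th_neq0 //; congr (_ ^ _); lia.
  have -> : N%:Z - n%:Z = N.+1%:Z - n.+1%:Z by lia.
  by ring.
have [k hk] := @cardRXV_small R F e e0.
exists (k + N.+1)%N => n nk; rewrite S.
have -> : emb (Q n) * th ^ (N.+1%:Z - n%:Z) - x =
    - ((y n - emb (Q n)) / th ^+ (n - N.+1)).
  have Nn : (N.+1 <= n)%N by rewrite (leq_trans _ nk) // leq_addl.
  have -> : th ^ (N.+1%:Z - n%:Z) = (th ^+ (n - N.+1))^-1.
    by rewrite exprnN; congr (_ ^ _); lia.
  have nE : th ^+ n = th ^+ (n - N.+1) * th ^+ N.+1 by rewrite -exprD subnK.
  rewrite /y nE.
  have tn k' : th ^+ k' != 0 by rewrite expf_neq0 ?th_neq0.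
  move: (tn (n - N.+1)%N) (tn N.+1).
  by move: (th ^+ (n - N.+1)) (th ^+ N.+1) => s t s0 t0; field; rewrite s0 t0.
rewrite absvalN absvalM absvalV absvalX th_abs.
apply: (@le_trans _ _ (1 * q%:R ^- (n - N.+1))).
  by rewrite ler_wpM2r ?cardRXV_ge0 // ltW.
by rewrite mul1r; apply: le_trans hk; apply: cardRXV_le; lia.
Qed.

Lemma Koo_lin x (a b : {poly F}) : Koo x -> Koo (emb a * x + emb b).
Proof. by move=> /Koo_approx h; apply/approx_Koo/Kapprox_lin. Qed.

Lemma Koo_frac (a b : {poly F}) : Koo (emb a / emb b).
Proof.
apply: approx_Koo => e e0; have [->|b0] := eqVneq b 0; last first.
  by exists a, b => //; rewrite subrr absval0 ltW.
exists 0, 1; first exact: oner_neq0.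
by rewrite emb0 invr0 mulr0 mul0r subr0 absval0 ltW.
Qed.

Lemma Koo_emb a : Koo (emb a).
Proof. by have := Koo_frac a 1; rewrite emb1 divr1. Qed.

Lemma Koo_inv (x : C) : Koo x -> Koo x^-1.
Proof.
have [->|x0] := eqVneq x 0; first by rewrite invr0.
move=> /Koo_approx h; apply: approx_Koo => e e0.
have xp : 0 < `|x| by rewrite absval_gt0.
have m0 : 0 < Num.min (e * `|x| ^+ 2) (`|x| / 2).
  by rewrite lt_min mulr_gt0 ?exprn_gt0 //= divr_gt0.
have [s [t t0 hst]] := h _ m0; exists t, s.
  apply/eqP => s0; move: hst; rewrite s0 emb0 mul0r subr0 le_min => /andP[_].
  by rewrite leNgt ltr_pdivrMr // ltr_pMr // ltr1n.
set r := emb s / emb t in hst *.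
have rx : `|r| = `|x|.
  have -> : r = x + - (x - r) by ring.
  rewrite absvalD_isosceles // absvalN (le_lt_trans hst) // gt_min.
  by rewrite ltr_pdivrMr // ltr_pMr // ltr1n orbT.
have r0 : r != 0 by rewrite -(@absval_gt0 _ _ (Coo_abs C)) rx.
have -> : emb t / emb s = r^-1 by rewrite invf_div.
have -> : x^-1 - r^-1 = - ((x - r) / (x * r)) by field; rewrite x0 r0.
rewrite absvalN absvalM absvalV absvalM rx ler_pdivrMr ?mulr_gt0 // -expr2.
by apply: le_trans hst _; rewrite ge_min lexx.
Qed.

Lemma Omega_aff_cover (z : C) : Omega z -> exists m, @Omega_aff R F C m z.
Proof.
move=> Oz; have [e e0 he] : exists2 e : R, 0 < e & forall x, Koo x -> e <= `|z - x|.
  apply: contrapT => H; apply: Oz; apply: approx_Koo => e e0.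
  have [x Kx zx] : exists2 x, Koo x & `|z - x| <= e.
    apply: contrapT => H2; apply: H; exists e => // x Kx.
    by rewrite leNgt; apply/negP => lt; apply: H2; exists x => //; exact: ltW.
  have [a [b b0 hab]] := Koo_approx Kx e0; exists a, b => //.
  by rewrite -(subrK x z) -addrA absvalD_le.
have [m1 h1] := cardRX_unbounded F `|z|; have [m2 h2] := @cardRXV_small R F e e0.
exists (maxn m1 m2); split=> [|x Kx].
  by rewrite (le_trans (ltW h1)) // ler_weXn2l ?cardR_ge1 // leq_maxl.
apply: le_trans (he x Kx); apply: le_trans h2.
by apply: cardRXV_le; rewrite leq_maxr.
Qed.

Lemma Omega_aff_lower m (z : C) (a b : {poly F}) : Omega_aff m z -> a != 0 ->
  `|emb a| * q%:R ^- m <= `|emb a * z + emb b|.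
Proof.
move=> [_ h] a0; have := h _ (Koo_frac (- b) a).
have -> : emb a * z + emb b = emb a * (z - emb (- b) / emb a).
  by rewrite embN; field; rewrite emb_eq0.
by move=> le; rewrite absvalM ler_wpM2l ?absval_ge0.
Qed.

Lemma Omega_lin_neq0 (z : C) (a b : {poly F}) : Omega z -> (a != 0) || (b != 0) ->
  emb a * z + emb b != 0.
Proof.
move=> /Omega_aff_cover[m Om]; have [->|a0 _] := eqVneq a 0.
  by rewrite /= emb0 mul0r add0r emb_eq0.
rewrite -(@absval_gt0 _ _ (Coo_abs C)); apply: lt_le_trans (Omega_aff_lower b Om a0).
by rewrite mulr_gt0 ?absval_gt0 ?emb_eq0 ?invr_gt0 ?cardRX_gt0.
Qed.

Lemma Omega_pole_free (z : C) a N : Omega z -> a != 0 -> pole_free N (emb a * z).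
Proof. by move=> Oz a0 b _; rewrite Omega_lin_neq0 // a0. Qed.

Lemma Omega_neq0 (z : C) : Omega z -> z != 0.
Proof.
move=> Oz; have := @Omega_lin_neq0 z 1 0 Oz.
by rewrite emb1 emb0 mul1r addr0; apply; rewrite oner_neq0.
Qed.

Lemma Omega_inv (z : C) : Omega z -> Omega z^-1.
Proof. by move=> Oz /Koo_inv; rewrite invrK. Qed.

Lemma Omega_upper (z : C) (a d : F) (b : {poly F}) : a != 0 -> d != 0 ->
  Omega z -> Omega ((emb a%:P * z + emb b) / emb d%:P).
Proof.
move=> a0 d0 Oz /(Koo_lin (a^-1 * d)%:P (- (a^-1)%:P * b)) h; apply: Oz.
have aE : emb (a^-1)%:P = (emb a%:P)^-1.
  have ea0 : emb a%:P != 0 by rewrite emb_eq0 polyC_eq0.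
  by apply: (mulfI ea0); rewrite mulfV // -embM -polyCM mulfV // emb1.
move: h; rewrite polyCM !embM embN aE.
rewrite (_ : _ + _ = z) //; field.
by rewrite !emb_eq0 !polyC_eq0 a0 d0.
Qed.

End UpperHalfPlane.

(** * Generators of GL_2(A) and reduction of modularity to them *)

Section GL2Generators.
Variable F : fieldType.

Definition mx22 (a b c d : {poly F}) : 'M[{poly F}]_2 :=
  \matrix_(i, j) (if i == 0 then if j == 0 then a else b
                  else if j == 0 then c else d).

Lemma mx22E (g : 'M[{poly F}]_2) : g = mx22 (g 0 0) (g 0 1) (g 1 0) (g 1 1).
Proof.
apply/matrixP => i j; rewrite mxE.
have h (k : 'I_2) : k != 0 -> k = 1 by case: k => [[|[|?]]] //= ? _; apply: val_inj.
by case: (eqVneq i 0) => [->|/h ->]; case: (eqVneq j 0) => [->|/h ->].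
Qed.

Lemma mul_mx22 a b c d a' b' c' d' : mx22 a b c d *m mx22 a' b' c' d' =
  mx22 (a * a' + b * c') (a * b' + b * d') (c * a' + d * c') (c * b' + d * d').
Proof.
rewrite [LHS]mx22E; congr mx22;
  by rewrite mxE !big_ord_recl big_ord0 !mxE /= addr0.
Qed.

Lemma mulmx22E (g h : 'M[{poly F}]_2) i j :
  (g *m h) i j = g i 0 * h 0 j + g i 1 * h 1 j.
Proof.
rewrite mxE !big_ord_recl big_ord0 addr0; congr (_ + g _ _ * h _ _); exact: val_inj.
Qed.

Lemma det_mx22 (g : 'M[{poly F}]_2) : \det g = g 0 0 * g 1 1 - g 0 1 * g 1 0.
Proof.
rewrite (expand_det_row _ 0) !big_ord_recl big_ord0 addr0.
rewrite /cofactor !det_mx11 !mxE /= expr0 mul1r expr1 mulN1r mulrN.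
congr (g _ _ * g _ _ - g _ _ * g _ _); exact: val_inj.
Qed.

(* Euclid's algorithm on the first column. *)
Lemma GL2_generated (P : 'M[{poly F}]_2 -> Prop) :
  (forall g h, g \in unitmx -> h \in unitmx -> P g -> P h -> P (g *m h)) ->
  (forall g, g \in unitmx -> g 1 0 = 0 -> P g) ->
  P (mx22 0 1 1 0) -> forall g, g \in unitmx -> P g.
Proof.
move=> PM PU PS g; move: {2}(size _) (leqnn (size (g 1 0))) => n.
elim: n g => [|n IH] g gn ug.
  by apply: PU => //; apply/eqP; rewrite -size_poly_leq0.
have [c0|c0] := eqVneq (g 1 0) 0; first exact: PU.
pose s := mx22 0 1 1 0; pose t := mx22 1 (g 0 0 %/ g 1 0) 0 1.
pose r := g 0 0 %% g 1 0; pose g' := mx22 (g 1 0) (g 1 1) r (g 0 1 - g 0 0 %/ g 1 0 * g 1 1).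
have gE : g = t *m (s *m g').
  rewrite [LHS]mx22E !mul_mx22; congr mx22; try by ring.
  by rewrite [LHS](divp_eq _ (g 1 0)) -/r; ring.
have us : s \in unitmx by rewrite unitmxE det_mx22 !mxE /= mul0r mul1r sub0r unitrN unitr1.
have ut : t \in unitmx by rewrite unitmxE det_mx22 !mxE /= !mulr0 mul1r subr0 unitr1.
have ug' : g' \in unitmx.
  by move: ug; rewrite gE !unitmx_mul => /andP[_ /andP[]].
rewrite gE; apply: (PM) => //; first by rewrite unitmx_mul us.
  by apply: PU => //; rewrite mxE.
apply: PM => //; apply: IH => //; rewrite mxE /=.
by rewrite -ltnS (leq_trans _ gn) // ltn_modp.
Qed.

End GL2Generators.

Section Modularity.
Variables (R : realType) (F : finFieldType) (C : complex_infty R F).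
Local Notation q := #|F|.
Local Notation emb := (@emb R F C).

Definition jfac (g : 'M[{poly F}]_2) (z : C) : C := emb (g 1 0) * z + emb (g 1 1).

Definition mob (g : 'M[{poly F}]_2) (z : C) : C :=
  (emb (g 0 0) * z + emb (g 0 1)) / jfac g z.

Lemma det_unit_neq0 (g : 'M[{poly F}]_2) : g \in unitmx -> \det g != 0.
Proof.
rewrite unitmxE => /unitrP[x [_ e]]; apply/eqP => d0.
by move/eqP: e; rewrite d0 mul0r eq_sym oner_eq0.
Qed.

Lemma jfac_neq0 g z : g \in unitmx -> Omega z -> jfac g z != 0.
Proof.
move=> /det_unit_neq0 d0 Oz; apply: Omega_lin_neq0 => //.
rewrite -negb_and; apply: contra d0 => /andP[/eqP c0 /eqP e0].
by rewrite det_mx22 c0 e0 !mulr0 subrr.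
Qed.

Lemma jfacM g h z : h \in unitmx -> Omega z ->
  jfac (g *m h) z = jfac g (mob h z) * jfac h z.
Proof.
move=> uh Oz; have j0 := jfac_neq0 uh Oz.
rewrite {1}/jfac !mulmx22E !embD !embM.
rewrite [jfac g _]/jfac [RHS]mulrDl -[X in _ = X + _]mulrA [mob h z * _]divfK //.
by rewrite /jfac; ring.
Qed.

Lemma mobM g h z : g \in unitmx -> h \in unitmx -> Omega z -> Omega (mob h z) ->
  mob (g *m h) z = mob g (mob h z).
Proof.
move=> ug uh Oz Oh; have j0 := jfac_neq0 uh Oz.
have j1 := jfac_neq0 ug Oh.
rewrite {1}/mob jfacM // !mulmx22E !embD !embM.
rewrite [RHS]/mob.
have -> : emb (g 0 0) * mob h z + emb (g 0 1) =
    ((emb (g 0 0) * emb (h 0 0) + emb (g 0 1) * emb (h 1 0)) * z +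
     (emb (g 0 0) * emb (h 0 1) + emb (g 0 1) * emb (h 1 1))) / jfac h z.
  apply: (mulIf j0); rewrite divfK // mulrDl -[X in X + _]mulrA [mob h z * _]divfK //.
  by rewrite /jfac; ring.
by field; rewrite j0 j1.
Qed.

Lemma modular_transf_gen (k m : int) (f : C -> C) :
  (forall (a d : F) (b : {poly F}) z, a != 0 -> d != 0 -> Omega z ->
    f ((emb a%:P * z + emb b) / emb d%:P) =
      emb (a * d)%:P ^ (- m) * emb d%:P ^ k * f z) ->
  (forall z, Omega z -> f z^-1 = (- 1) ^ (- m) * z ^ k * f z) ->
  modular_transf k m f.
Proof.
move=> fU fS.
(* The cocycle relations require the image point to lie in [Omega], so this is proved together with
   the transformation law. *)
suff H g : g \in unitmx -> forall z, Omega z -> Omega (mob g z) /\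
    f (mob g z) = emb (\det g) ^ (- m) * jfac g z ^ k * f z.
  by move=> g ug z Oz; have [_] := H g ug z Oz.
move=> ug; apply: (@GL2_generated F (fun g => forall z, Omega z -> Omega (mob g z) /\
    f (mob g z) = emb (\det g) ^ (- m) * jfac g z ^ k * f z)) ug.
- move=> {}g h ug uh Hg Hh z Oz; have [Oh fh] := Hh z Oz.
  have [Og fg] := Hg _ Oh; rewrite mobM //; split=> //.
  rewrite fg fh det_mulmx embM jfacM //.
  by rewrite !exprzMl ?unitfE ?emb_eq0 ?det_unit_neq0 ?jfac_neq0 //; ring.
- move=> {}g ug c0 z Oz.
  have := ug; rewrite unitmxE det_mx22 c0 mulr0 subr0 unitrM !poly_unitE.
  move=> /andP[/andP[/eqP/eqP/size_poly1P[a a0 aE] _] /andP[/eqP/eqP/size_poly1P[d d0 dE] _]].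
  have jE : jfac g z = emb d%:P by rewrite /jfac c0 dE emb0 mul0r add0r.
  rewrite /mob jE aE dE -polyCM.
  by split; [exact: Omega_upper|exact: fU].
- move=> z Oz; have E : mob (mx22 0 1 1 0) z = z^-1.
    by rewrite /mob /jfac !mxE /= emb0 emb1 mul0r add0r mul1r addr0 mul1r.
  rewrite E; split; first exact: Omega_inv.
  rewrite fS // /jfac det_mx22 !mxE /= emb0 emb1 mul1r addr0 mul0r mul1r sub0r.
  by rewrite embN emb1.
Qed.

End Modularity.

(** * Series over the monic polynomials *)

Section RationalApproximation.
Variables (R : realType) (F : finFieldType) (C : complex_infty R F).
Local Notation "`| x |" := (Coo_abs C x) : ring_scope.

Definition regular_on (S : set C) (r : C -> C) : Prop :=
  exists P Q : {poly C}, forall z, S z -> Q.[z] != 0 /\ r z = P.[z] / Q.[z].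

Lemma regular_cst S c : regular_on S (fun=> c).
Proof.
by exists c%:P, 1 => z _; rewrite !hornerC divr1; split=> //; rewrite oner_neq0.
Qed.

Lemma regularD S r s : regular_on S r -> regular_on S s ->
  regular_on S (fun z => r z + s z).
Proof.
move=> [P [Q h]] [P' [Q' h']]; exists (P * Q' + P' * Q), (Q * Q') => z Sz.
have [q0 ->] := h z Sz; have [q0' ->] := h' z Sz.
rewrite hornerD !hornerM; split; first exact: mulf_neq0.
by field; rewrite q0 q0'.
Qed.

Lemma regularM S r s : regular_on S r -> regular_on S s ->
  regular_on S (fun z => r z * s z).
Proof.
move=> [P [Q h]] [P' [Q' h']]; exists (P * P'), (Q * Q') => z Sz.
have [q0 ->] := h z Sz; have [q0' ->] := h' z Sz.
rewrite !hornerM; split; first exact: mulf_neq0.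
by field; rewrite q0 q0'.
Qed.

Lemma regularX S r k : regular_on S r -> regular_on S (fun z => r z ^+ k).
Proof.
move=> rr; elim: k => [|k IH]; first exact: regular_cst.
have [P [Q h]] := regularM rr IH; exists P, Q => z Sz.
by rewrite exprS; exact: h.
Qed.

Lemma regular_sum S I (r : seq I) (f : I -> C -> C) :
  (forall i, regular_on S (f i)) -> regular_on S (fun z => \sum_(i <- r) f i z).
Proof.
move=> h; elim: r => [|i r IH].
  have [P [Q hh]] := regular_cst S 0; exists P, Q => z Sz.
  by rewrite big_nil; exact: hh.
have [P [Q hh]] := regularD (h i) IH; exists P, Q => z Sz.
by rewrite big_cons; exact: hh.
Qed.

Lemma regular_inv_linear S (a b : C) : (forall z, S z -> a * z + b != 0) ->
  regular_on S (fun z => (a * z + b)^-1).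
Proof.
move=> h; exists 1, (a *: 'X + b%:P) => z Sz.
rewrite hornerD hornerZ hornerX !hornerC div1r; split=> //.
exact: h.
Qed.

(** Boundedness is recorded together with approximation because uniform approximation of a product
    needs bounds on the factors. *)
Definition bounded_analytic (f : C -> C) : Prop := forall m : nat,
  (exists2 B : R, 0 < B & forall z, Omega_aff m z -> `|f z| <= B) /\
  (forall e : R, 0 < e -> exists2 r, regular_on (Omega_aff m) r &
     forall z, Omega_aff m z -> `|f z - r z| <= e).

Lemma bounded_analytic_rigid f : bounded_analytic f -> rigid_analytic f.
Proof.
move=> h m e e0; have [_ /(_ (e / 2))[|r [P [Q hr]] fr]] := h m.
  by rewrite divr_gt0.
exists P, Q => z Oz; have [Q0 rE] := hr z Oz; split=> //.
by rewrite -rE (le_lt_trans (fr z Oz)) // ltr_pdivrMr // ltr_pMr // ltr1n.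
Qed.

Lemma bounded_analytic_cst c : bounded_analytic (fun=> c).
Proof.
move=> m; split=> [|e e0].
  exists (`|c| + 1) => [|z _]; first by rewrite ltr_wpDl ?absval_ge0.
  by rewrite lerDl.
exists (fun=> c) => [|z _]; first exact: regular_cst.
by rewrite subrr absval0 ltW.
Qed.

Lemma bounded_analyticD f g : bounded_analytic f -> bounded_analytic g ->
  bounded_analytic (fun z => f z + g z).
Proof.
move=> hf hg m; have [[B B0 fB] fr] := hf m; have [[D D0 gD] gr] := hg m.
split=> [|e e0].
  exists (B + D) => [|z Oz]; first exact: addr_gt0.
  apply: absvalD_le; first by rewrite (le_trans (fB z Oz)) // lerDl ltW.
  by rewrite (le_trans (gD z Oz)) // lerDr ltW.
have [r rr fr'] := fr e e0; have [s ss gs'] := gr e e0.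
exists (fun z => r z + s z) => [|z Oz]; first exact: regularD.
by rewrite opprD addrACA absvalD_le ?fr' ?gs'.
Qed.

Lemma bounded_analyticM f g : bounded_analytic f -> bounded_analytic g ->
  bounded_analytic (fun z => f z * g z).
Proof.
move=> hf hg m; have [[B B0 fB] fr] := hf m; have [[D D0 gD] gr] := hg m.
split=> [|e e0].
  exists (B * D) => [|z Oz]; first exact: mulr_gt0.
  by rewrite absvalM; apply: ler_pM; rewrite ?absval_ge0 ?fB ?gD.
have D10 : 0 < D + 1 by rewrite ltr_wpDl // ltW.
have m0 : 0 < Num.min 1 (e / B) by rewrite lt_min ltr01 divr_gt0.
have [r rr fr'] := fr (e / (D + 1)) (divr_gt0 e0 D10).
have [s ss gs'] := gr _ m0.
exists (fun z => r z * s z) => [|z Oz]; first exact: regularM.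
have -> : f z * g z - r z * s z = (f z - r z) * s z + f z * (g z - s z) by ring.
have := gs' z Oz; rewrite le_min => /andP[s1 se].
have sD : `|s z| <= D + 1.
  have -> : s z = g z - (g z - s z) by ring.
  apply: absvalB_le; first by rewrite (le_trans (gD z Oz)) // lerDl.
  by rewrite (le_trans s1) // lerDr ltW.
apply: absvalD_le; rewrite absvalM.
  by rewrite -[leRHS](divfK (lt0r_neq0 D10)); apply: ler_pM; rewrite ?absval_ge0 ?fr'.
rewrite -[leRHS](divfK (lt0r_neq0 B0)) mulrC.
by apply: ler_pM; rewrite ?absval_ge0 ?fB.
Qed.

Lemma bounded_analyticX f k : bounded_analytic f ->
  bounded_analytic (fun z => f z ^+ k).
Proof.
move=> hf; elim: k => [|k IH]; first exact: bounded_analytic_cst.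
rewrite (_ : (fun z => f z ^+ k.+1) = (fun z => f z * f z ^+ k)).
  exact: bounded_analyticM.
by apply/funext => z; rewrite exprS.
Qed.

End RationalApproximation.

(** * Convergence and analyticity of series over monic polynomials *)

Section AExpansions.
Variables (R : realType) (F : finFieldType) (C : complex_infty R F).
Local Notation q := #|F|.
Local Notation "`| x |" := (Coo_abs C x) : ring_scope.
Local Notation emb := (@emb R F C).
Local Notation th := (th C).

Lemma TN_scale k N (c : F) w : c != 0 ->
  TN k N (emb c%:P * w) = emb c%:P ^- k * TN k N w.
Proof.
move=> c0; rewrite /TN -(sumA_scale N _ c0) /sumA mulr_sumr.
apply: eq_bigr => v _; rewrite embZ -mulrDr invfM exprMn.
by rewrite -[emb c%:P ^- k]exprVn.
Qed.

Lemma TI_scale k (c : F) w : (0 < k)%N -> c != 0 ->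
  TI k (emb c%:P * w) = emb c%:P ^- k * TI k w.
Proof.
move=> k0 c0; apply: av_cvg_unique (TN_cvg _ k0) _.
apply: av_cvg_ext (av_cvgZ (emb c%:P ^- k) (TN_cvg w k0)) => N.
by rewrite TN_scale.
Qed.

Lemma TI_shift k w (a : {poly F}) : (0 < k)%N -> TI k (w + emb a) = TI k w.
Proof.
move=> k0; apply: av_cvg_unique (TN_cvg _ k0) _.
apply: (av_cvg_eventually (N := size a)) (TN_cvg w k0) => N aN.
rewrite /TN -(sumA_shift (fun b => (w + emb b)^-1 ^+ k) aN).
apply: eq_sumA => b _.
by rewrite embD addrA addrAC.
Qed.

Lemma Omega_aff_sub m (z : C) : Omega_aff m z -> Omega z.
Proof.
move=> [_ h] Kz; have := h _ Kz.
by rewrite subrr absval0 leNgt invr_gt0 cardRX_gt0.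
Qed.

Lemma TN_abs_le k N m z (a : {poly F}) : Omega_aff m z -> a != 0 ->
  `|TN k N (emb a * z)| <= (q%:R ^+ m / `|emb a|) ^+ k.
Proof.
move=> Oz a0; have ap : 0 < `|emb a| by rewrite absval_gt0 emb_eq0.
have qm := cardRX_gt0 R F m.
apply: sumA_le => [|b _]; first by rewrite exprn_ge0 // divr_ge0 ?ltW.
have h := Omega_aff_lower b Oz a0.
have d0 : 0 < q%:R ^+ m / `|emb a| by rewrite divr_gt0.
have r0 : 0 < `|emb a * z + emb b| by apply: lt_le_trans h; rewrite mulr_gt0 ?invr_gt0.
rewrite absvalX absvalV; apply: lerXn2r; rewrite ?nnegrE ?invr_ge0 ?absval_ge0 ?(ltW d0) //.
by rewrite -[leRHS]invrK lef_pV2 ?posrE ?invr_gt0 // invf_div.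
Qed.

(* The series [\sum_(a monic) x(a) T_k(a z)] for a coefficient function [x]
   homogeneous of degree [k] under [F^*]. *)
Variables (x : {poly F} -> {poly F}) (k : nat).
Hypothesis k_gt0 : (0 < k)%N.
Hypothesis x_homog : forall (c : F) a, c != 0 ->
  emb (x (c *: a)) = emb c%:P ^+ k * emb (x a).
Hypothesis x_le : forall a, a != 0 -> `|emb (x a)| <= `|emb a|.
(** Uniformity in N is what permits a and b to be cut off at the same degree. The level N = 0 is
    excluded since there b = 0 only, and for x = id and k = 1 the term is the constant 1 / z. *)
Hypothesis x_decay : forall (m : nat) (e : R), 0 < e -> exists t : nat,
  forall N z (a : {poly F}), (0 < N)%N -> Omega_aff m z -> (t < size a)%N ->
  `|emb (x a) * TN k N (emb a * z)| <= e.

Definition Aexp (z : C) : C := av_lim (Coo_abs C)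
  (fun N => \sum_(j < N) monsum j (fun a => emb (x a) * TI k (emb a * z))).

Definition Abox (N : nat) (z : C) : C :=
  sumA N (fun a => emb (x a) * TN k N (emb a * z)).

Lemma x_decayI m (e : R) : 0 < e -> exists t : nat,
  forall z (a : {poly F}), Omega_aff m z -> (t < size a)%N ->
  `|emb (x a) * TI k (emb a * z)| <= e.
Proof.
move=> e0; have [t ht] := x_decay m e0; exists t => z a Oz ta.
apply: (av_cvg_le (N := 1) (av_cvgZ (emb (x a)) (TN_cvg (emb a * z) k_gt0))) => N N0.
exact: ht.
Qed.

Lemma Aexp_cvg z : Omega z -> av_cvg (Coo_abs C)
  (fun N => \sum_(j < N) monsum j (fun a => emb (x a) * TI k (emb a * z))) (Aexp z).
Proof.
move=> /Omega_aff_cover[m Oz].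
have [l hl] : exists l, av_cvg (Coo_abs C) (fun N => \sum_(j < N) monsum j
    (fun a => emb (x a) * TI k (emb a * z))) l.
  apply: (@av_cvg_series _ _ _ (@Coo_complete _ _ C)
    (fun j => monsum j (fun a => emb (x a) * TI k (emb a * z)))).
  apply/av_cvgP => e e0; have [t ht] := x_decayI m e0; exists t => j tj; rewrite subr0.
  by apply: monsum_le => [|a _ sa]; [exact: ltW|rewrite ht // sa ltnS].
by rewrite /Aexp (av_limE hl).
Qed.

(** For a of degree at least t both the complete and the truncated inner sums are small by decay.
    For the finitely many other a the two differ by at most q^-N, by [TN_TI], which requires q^N to
    exceed |a z| and hence N > t + m. *)
Lemma Aexp_approx m (e : R) : 0 < e -> exists N0, forall N z, (N0 <= N)%N ->
  Omega_aff m z ->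
  `|\sum_(j < N) monsum j (fun a => emb (x a) * TN k N (emb a * z)) - Aexp z| <= e.
Proof.
move=> e0; have [t1 ht1] := x_decay m e0; have [t2 ht2] := x_decayI m e0.
pose t := maxn t1 t2; have e0' : 0 < e / q%:R ^+ t by rewrite divr_gt0 // cardRX_gt0.
have [N1 hN1] := @cardRXV_small R F _ e0'.
exists (maxn t (maxn N1 (t + m).+1)) => N z.
rewrite geq_max => /andP[tN]; rewrite geq_max => /andP[N1N tmN] Oz.
have OOz := Omega_aff_sub Oz.
pose s M := \sum_(j < M) monsum j (fun a => emb (x a) * TI k (emb a * z)).
have sA : `|Aexp z - s N| <= e.
  apply: (@av_cvg_ball _ _ _ s _ _ _ N (Aexp_cvg OOz)) => M' NM'.
  apply: (@av_step_le _ _ _ s _ N) NM' => [|M NM]; first exact: ltW.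
  rewrite /s big_ord_recr /= [X in X - _]addrC addrK.
  apply: monsum_le => [|a _ sa]; first exact: ltW.
  by apply: ht2 => //; rewrite sa ltnS (leq_trans _ NM) // (leq_trans _ tN) // leq_maxr.
rewrite -(subrK (s N) (\sum_(j < N) _)) -addrA absvalD_le //; last first.
  by rewrite absvalBC.
rewrite /s -sumrB; apply: absval_sum_le => [|j _]; first exact: ltW.
rewrite /monsum -sumrB; apply: absval_sum_le => [|c _]; first exact: ltW.
set a := ('X^j + rVpoly c)%R.
have sa : size a = j.+1 by rewrite /a size_monic_shift ?size_poly.
have a0 : a != 0 by rewrite -size_poly_gt0 sa.
have [tj|jt] := leqP t j.
  have ta : (t < size a)%N by rewrite sa ltnS.
  apply: absvalB_le; last by apply: ht2 => //; rewrite (leq_ltn_trans _ ta) // leq_maxr.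
  by apply: ht1 => //; rewrite ?(leq_ltn_trans _ ta) ?leq_maxl // (leq_trans _ tmN).
have aa : `|emb a| <= q%:R ^+ t.
  by apply: emb_abs_le; rewrite sa ltnS ltnW.
rewrite -mulrBr absvalM; apply: (@le_trans _ _ (q%:R ^+ t * q%:R ^- N)).
  apply: ler_pM; rewrite ?absval_ge0 //; first exact: le_trans (x_le a0) aa.
  apply: TN_TI => //; rewrite absvalM; have [zm _] := Oz.
  apply: (@le_lt_trans _ _ (q%:R ^+ (t + m))).
    by rewrite exprD; apply: ler_pM; rewrite ?absval_ge0.
  by rewrite ltr_eXn2l ?cardR_gt1.
rewrite mulrC -ler_pdivlMr ?cardRX_gt0 //; apply: le_trans hN1.
exact: cardRXV_le.
Qed.

Lemma Aexp_bounded m z : Omega_aff m z -> `|Aexp z| <= q%:R ^+ (m * k).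
Proof.
move=> Oz; have OOz := Omega_aff_sub Oz.
have B0 : 0 <= q%:R ^+ (m * k) :> R by rewrite ltW // cardRX_gt0.
apply: (av_cvg_le (N := 0) (Aexp_cvg OOz)) => N _.
apply: absval_sum_le => // j _; apply: monsum_le => // a am _.
have a0 : a != 0 by rewrite monic_neq0.
apply: (av_cvg_le (N := 0) (av_cvgZ (emb (x a)) (TN_cvg (emb a * z) k_gt0))) => M _.
rewrite absvalM; apply: (@le_trans _ _ (`|emb a| * (q%:R ^+ m / `|emb a|) ^+ k)).
  by apply: ler_pM; rewrite ?absval_ge0 ?x_le // TN_abs_le.
rewrite expr_div_n -exprM mulrCA ler_piMr // ler_pdivrMr ?mul1r.
  by rewrite -{1}(expr1 `|emb a|) ler_weXn2l ?emb_abs_ge1.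
by rewrite exprn_gt0 ?absval_gt0 ?emb_eq0.
Qed.

Lemma Aexp_bounded_analytic : bounded_analytic Aexp.
Proof.
move=> m; split=> [|e e0].
  by exists (q%:R ^+ (m * k)) => [|z Oz]; [exact: cardRX_gt0|exact: Aexp_bounded].
have [N hN] := Aexp_approx m e0.
exists (fun z => \sum_(j < N) monsum j (fun a => emb (x a) * TN k N (emb a * z))).
  apply: regular_sum => j; apply: regular_sum => c; apply: regularM.
    exact: regular_cst.
  apply: regular_sum => b; apply: regularX; apply: regular_inv_linear => z Oz.
  set a := ('X^j + _)%R; have a0 : a != 0.
    by rewrite -size_poly_gt0 size_monic_shift ?size_poly.
  rewrite -(@absval_gt0 _ _ (Coo_abs C)); apply: lt_le_trans (Omega_aff_lower _ Oz a0).
  by rewrite mulr_gt0 ?invr_gt0 ?cardRX_gt0 // absval_gt0 emb_eq0.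
by move=> z Oz; rewrite absvalBC; exact: hN.
Qed.

Lemma Abox_cvg z : Omega z -> av_cvg (Coo_abs C) (Abox ^~ z)
  (emb (x 0) * TI k 0 - Aexp z).
Proof.
move=> /Omega_aff_cover[m Oz].
have E N : Abox N z = emb (x 0) * TN k N 0 -
    \sum_(j < N) monsum j (fun a => emb (x a) * TN k N (emb a * z)).
  rewrite /Abox sumA_monsum ?emb0 ?mul0r // => c a c0.
  rewrite x_homog // embZ -[_ * emb a * z]mulrA TN_scale // mulrACA.
  by rewrite mulfV ?mul1r // expf_neq0 // emb_eq0 polyC_eq0.
apply: av_cvg_ext (fun N => esym (E N)) _.
apply: (av_cvgD (av_cvgZ _ (TN_cvg 0 k_gt0))); apply: av_cvgN.
by apply/av_cvgP => e e0; have [N0 h] := Aexp_approx m e0; exists N0 => N NN; exact: h.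
Qed.

Lemma Aexp_upper (a d : F) (b : {poly F}) z : a != 0 -> d != 0 -> Omega z ->
  Aexp ((emb a%:P * z + emb b) / emb d%:P) = (emb d%:P / emb a%:P) ^+ k * Aexp z.
Proof.
move=> a0 d0 Oz; apply: av_cvg_unique (Aexp_cvg (@Omega_upper R F C z a d b a0 d0 Oz)) _.
apply: av_cvg_ext (av_cvgZ _ (Aexp_cvg Oz)) => N.
rewrite mulr_sumr; apply: eq_bigr => j _; rewrite /monsum mulr_sumr.
apply: eq_bigr => c _; set y := ('X^j + _)%R.
have ea0 : emb a%:P != 0 by rewrite emb_eq0 polyC_eq0.
have ed0 : emb d%:P != 0 by rewrite emb_eq0 polyC_eq0.
have dE : emb (d^-1)%:P = (emb d%:P)^-1.
  by apply: (mulfI ed0); rewrite mulfV // -embM -polyCM mulfV // emb1.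
have adE : emb (a / d)%:P = emb a%:P / emb d%:P by rewrite polyCM embM dE.
have -> : emb y * ((emb a%:P * z + emb b) / emb d%:P) =
    emb (a / d)%:P * (emb y * z) + emb (y * b * (d^-1)%:P).
  by rewrite adE !embM dE; ring.
rewrite TI_shift // TI_scale ?mulf_neq0 ?invr_eq0 // mulrCA; congr (_ * _).
by rewrite -exprVn adE invf_div.
Qed.

End AExpansions.

(** * Decay estimates, and box sums under inversion *)

Section QuasiModular.
Variables (R : realType) (F : finFieldType) (C : complex_infty R F).
Local Notation q := #|F|.
Local Notation "`| x |" := (Coo_abs C x) : ring_scope.
Local Notation emb := (@emb R F C).
Local Notation th := (th C).
Local Notation one := (fun=> 1 : {poly F}).

Lemma decay_of_bound (x : {poly F} -> {poly F}) (k : nat) :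
  (forall m N z (a : {poly F}), (0 < N)%N -> Omega_aff m z ->
     q%:R ^+ m < `|emb a| ->
     `|emb (x a) * TN k N (emb a * z)| <= q%:R ^+ (2 * m) / `|emb a|) ->
  forall (m : nat) (e : R), 0 < e -> exists t : nat,
  forall N z (a : {poly F}), (0 < N)%N -> Omega_aff m z -> (t < size a)%N ->
  `|emb (x a) * TN k N (emb a * z)| <= e.
Proof.
move=> h m e e0; have [N1 hN1] := @cardRXV_small R F e e0.
exists (2 * m + N1).+1 => N z a N0 Oz sa.
have a0 : a != 0 by rewrite -size_poly_gt0 (leq_ltn_trans _ sa).
have ta : ((2 * m + N1).+1 <= deg a)%N by rewrite /deg -ltnS prednK // size_poly_gt0.
apply: le_trans (h m N z a N0 Oz _) _.
  by rewrite emb_abs // ltr_eXn2l ?cardR_gt1 //; lia.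
rewrite emb_abs // ler_pdivrMr ?cardRX_gt0 //.
apply: (@le_trans _ _ (q%:R ^- N1 * q%:R ^+ (2 * m + N1))).
  by rewrite exprD mulrCA mulVf ?mulr1 // lt0r_neq0 // cardRX_gt0.
apply: ler_pM => //; rewrite ?cardRXV_ge0 ?ltW ?cardRX_gt0 //.
by rewrite ltr_eXn2l ?cardR_gt1 //; lia.
Qed.

(** The bound q^m / |a| on each 1 / (a z + b) is just cancelled by the factor a. Summing first over
    constant b replaces w by w - w^q, of size at least |w|^2 when |w| > 1; this gains one more
    factor q^m / |a|. *)
Lemma decay_id1 (m : nat) (e : R) : 0 < e -> exists t : nat,
  forall N z (a : {poly F}), (0 < N)%N -> Omega_aff m z -> (t < size a)%N ->
  `|emb a * TN 1 N (emb a * z)| <= e.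
Proof.
move: m e; apply: (@decay_of_bound id 1) => m [//|N] z a _ Oz am.
have a0 : a != 0.
  by apply: contraTneq am => ->; rewrite emb0 absval0 -leNgt ltW // cardRX_gt0.
have ap : 0 < `|emb a| by rewrite absval_gt0 emb_eq0.
have qm := cardRX_gt0 R F m.
rewrite TN1; last exact/Omega_pole_free/a0/(Omega_aff_sub Oz).
have [b _] := eN_lower 1 N (emb a * z); rewrite addn1; set w := emb a * z - emb b => hb.
have hw : `|emb a| / q%:R ^+ m <= `|w|.
  by rewrite /w -embN; exact: Omega_aff_lower.
have w1 : 1 < `|w|.
  by apply: lt_le_trans hw; rewrite ltr_pdivlMr // mul1r.
have E : `|eN 1 w| = `|w| ^+ q.
  rewrite eNS /lam /= expr0 /line expr1n divr1 addrC absvalD_isosceles absvalN absvalX //.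
  by rewrite -{1}(expr1 `|w|) ltr_eXn2l // cardF_gt1.
have h2 : (`|emb a| / q%:R ^+ m) ^+ 2 <= `|eN N.+1 (emb a * z)|.
  apply: le_trans hb; rewrite E; apply: (@le_trans _ _ (`|w| ^+ 2)).
    by rewrite lerXn2r ?nnegrE ?divr_ge0 ?absval_ge0 // ltW.
  by rewrite ler_weXn2l ?cardF_gt1 // ltW.
rewrite absvalM absvalV.
apply: (@le_trans _ _ (`|emb a| * ((`|emb a| / q%:R ^+ m) ^+ 2)^-1)).
  rewrite ler_wpM2l ?absval_ge0 // lef_pV2 ?posrE ?exprn_gt0 ?divr_gt0 //.
  by apply: lt_le_trans h2; rewrite exprn_gt0 ?divr_gt0.
rewrite le_eqVlt; apply/orP; left; apply/eqP.
rewrite mulnC exprM; move: (lt0r_neq0 qm) (lt0r_neq0 ap).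
by move: (q%:R ^+ m) (`|emb a|) => s t s0 t0; field; rewrite s0 t0.
Qed.

Lemma decay_id k (m : nat) (e : R) : (1 < k)%N -> 0 < e -> exists t : nat,
  forall N z (a : {poly F}), (0 < N)%N -> Omega_aff m z -> (t < size a)%N ->
  `|emb a * TN k N (emb a * z)| <= e.
Proof.
move=> k1; move: m e; apply: (@decay_of_bound id k) => m N z a _ Oz am.
have a0 : a != 0.
  by apply: contraTneq am => ->; rewrite emb0 absval0 -leNgt ltW // cardRX_gt0.
have ap : 0 < `|emb a| by rewrite absval_gt0 emb_eq0.
have qm := cardRX_gt0 R F m.
rewrite absvalM; apply: (@le_trans _ _ (`|emb a| * (q%:R ^+ m / `|emb a|) ^+ 2)).
  rewrite ler_wpM2l ?absval_ge0 //; apply: le_trans (TN_abs_le k N Oz a0) _.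
  by rewrite ler_wiXn2l ?divr_ge0 ?ltW // ltr_pdivrMr // mul1r.
rewrite le_eqVlt; apply/orP; left; apply/eqP.
rewrite mulnC exprM; move: (lt0r_neq0 ap).
by move: (q%:R ^+ m) (`|emb a|) => s t t0; field; rewrite t0.
Qed.

Lemma decay_one k (m : nat) (e : R) : (0 < k)%N -> 0 < e -> exists t : nat,
  forall N z (a : {poly F}), (0 < N)%N -> Omega_aff m z -> (t < size a)%N ->
  `|emb (one a) * TN k N (emb a * z)| <= e.
Proof.
move=> k1; move: m e; apply: (@decay_of_bound one k) => m N z a _ Oz am.
have a0 : a != 0.
  by apply: contraTneq am => ->; rewrite emb0 absval0 -leNgt ltW // cardRX_gt0.
have ap : 0 < `|emb a| by rewrite absval_gt0 emb_eq0.
have qm := cardRX_gt0 R F m.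
rewrite emb1 mul1r; apply: (@le_trans _ _ (q%:R ^+ m / `|emb a|)).
  apply: le_trans (TN_abs_le k N Oz a0) _.
  rewrite -[leRHS]expr1 ler_wiXn2l ?divr_ge0 ?ltW // ltr_pdivrMr // mul1r //.
rewrite ler_wpM2r ?invr_ge0 ?absval_ge0 // ler_weXn2l ?cardR_ge1 //; lia.
Qed.

Lemma emb_le_one a : a != 0 -> `|emb (one a)| <= `|emb a|.
Proof. by move=> a0; rewrite emb1 absval1 emb_abs_ge1. Qed.

Lemma embC_expq_predn (c : F) n : c != 0 -> emb c%:P ^+ (q ^ n - 1) = 1.
Proof.
move=> c0; have ec0 : emb c%:P != 0 by rewrite emb_eq0 polyC_eq0.
by apply: (mulfI ec0); rewrite -exprS subn1 prednK ?cardFX_gt0 // embC_expqX mulr1.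
Qed.

Lemma homog_id1 (c : F) a : c != 0 -> emb (c *: a) = emb c%:P ^+ 1 * emb a.
Proof. by move=> _; rewrite embZ expr1. Qed.

Lemma homog_idq n (c : F) a : c != 0 -> emb (c *: a) = emb c%:P ^+ (q ^ n) * emb a.
Proof. by move=> _; rewrite embZ embC_expqX. Qed.

Lemma homog_one n (c : F) (a : {poly F}) : c != 0 ->
  emb (one (c *: a)) = emb c%:P ^+ (q ^ n - 1) * emb (one a).
Proof. by move=> c0; rewrite embC_expq_predn // mul1r. Qed.

(** The box sum with the coefficient attached to b instead of a: the effect of z -> 1/z after
    renaming the indices, see [Abox_inv]. *)
Definition Adual (x : {poly F} -> {poly F}) k N (z : C) : C :=
  sumA N (fun a => sumA N (fun b => emb (x b) * (emb a * z + emb b)^-1 ^+ k)).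

Lemma Abox_inv (x : {poly F} -> {poly F}) k N (z : C) : z != 0 ->
  Abox x k N z^-1 = z ^+ k * Adual x k N z.
Proof.
move=> z0; rewrite /Adual /Abox /TN /sumA exchange_big /= mulr_sumr.
apply: eq_bigr => a _; rewrite !mulr_sumr; apply: eq_bigr => b _.
rewrite mulrCA; congr (_ * _); rewrite -exprMn; congr (_ ^+ k).
have -> : emb (rVpoly b) * z + emb (rVpoly a) =
    z * (emb (rVpoly a) * z^-1 + emb (rVpoly b)) by field.
by rewrite invfM mulVKf.
Qed.

Lemma Adual_one k N (z : C) : Adual one k N z = Abox one k N z.
Proof.
apply: eq_sumA => a _; rewrite /TN emb1 mul1r; apply: eq_sumA => b _.
by rewrite ?mul1r.
Qed.

(** Write b = (a z + b) - z a. For k > 1 the pair (0, 0) fits in, since with [0^-1 = 0] all its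
    terms vanish. *)
Lemma Adual_id k N (z : C) : (1 < k)%N ->
  Adual id k N z = Abox one (k - 1) N z - z * Abox id k N z.
Proof.
move=> k1; rewrite /Adual /Abox /sumA mulr_sumr -sumrB; apply: eq_bigr => a _.
rewrite /TN emb1 mul1r mulrA mulr_sumr -sumrB; apply: eq_bigr => b _.
set r := _ + emb (rVpoly b); have -> : emb (rVpoly b) = r - z * emb (rVpoly a).
  by rewrite /r; ring.
rewrite mulrBl; congr (_ - _).
case: k k1 => [|[|k]] // _; rewrite subn1 exprS mulrA.
have [->|r0] := eqVneq r 0; first by rewrite invr0 !mul0r expr0n.
by rewrite mulfV // mul1r.
Qed.

(** For k = 1 the decomposition b = (a z + b) - z a yields a term 1 for every pair except (0, 0).
    The sum of 1 over all b is q^N = 0 for N > 0, so only the correction -1 of the missing pair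
    remains. *)
Lemma Adual_id1 N (z : C) : (0 < N)%N -> Omega z ->
  Adual id 1 N z = -1 - z * Abox id 1 N z.
Proof.
move=> N0 Oz.
have E (a b : {poly F}) : emb b * (emb a * z + emb b)^-1 ^+ 1 =
    1 - (if a == 0 then if b == 0 then 1 else 0 else 0)
      - z * (emb a * (emb a * z + emb b)^-1 ^+ 1).
  have [/andP[/eqP -> /eqP ->]|ab] := boolP ((a == 0) && (b == 0)).
    by rewrite !eqxx emb0 !mul0r mulr0 subrr subr0.
  have -> : (if a == 0 then if b == 0 then 1 else 0 else 0 : C) = 0.
    by move: ab; case: eqP => //; case: eqP.
  have r0 : emb a * z + emb b != 0 by apply: Omega_lin_neq0; rewrite // -negb_and.
  by rewrite expr1; field.
rewrite /Adual (eq_sumA (g := fun a => 0 -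
    (if a == 0 then 1 else 0) - z * (emb a * TN 1 N (emb a * z)))) => [|a _].
  rewrite /sumA !sumrB big1 // sub0r -mulr_sumr; congr (- _ - _).
  rewrite (bigD1 0) //= linear0 eqxx big1 ?addr0 // => v v0.
  by rewrite -(linear0 (@rVpoly F N)) (inj_eq (can_inj (@rVpolyK _ _))) (negbTE v0).
rewrite (eq_sumA (fun b _ => E a b)) /sumA !sumrB -!mulr_sumr; congr (_ - _ - _).
  rewrite sumr_const card_mx mul1n -mulr_natr mul1r natrX cardF_natr0 expr0n.
  by rewrite gtn_eqF.
case: (a == 0); last by rewrite big1.
rewrite (bigD1 0) //= linear0 eqxx big1 ?addr0 // => v v0.
by rewrite -(linear0 (@rVpoly F N)) (inj_eq (can_inj (@rVpolyK _ _))) (negbTE v0).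
Qed.

End QuasiModular.

(** * The modular forms *)

Section EisensteinForms.
Variables (R : realType) (F : finFieldType) (C : complex_infty R F).
Local Notation q := #|F|.
Local Notation "`| x |" := (Coo_abs C x) : ring_scope.
Local Notation emb := (@emb R F C).
Local Notation th := (th C).
Local Notation one := (fun=> 1 : {poly F}).
Variable n : nat.
Hypothesis n_gt0 : (0 < n)%N.
Local Notation Q := (q ^ n)%N.

Lemma Q_gt1 : (1 < Q)%N.
Proof. by rewrite -(exp1n n) ltn_exp2r ?cardF_gt1. Qed.

Lemma Q1_gt0 : (0 < Q - 1)%N.
Proof. by rewrite subn_gt0 Q_gt1. Qed.

Definition formB : C -> C := Aexp id 1.
Definition formH : C -> C := Aexp id Q.
(* The Eisenstein series of weight [Q - 1]. *)
Definition formG (z : C) : C := TI (Q - 1) 0 - Aexp one (Q - 1) z.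
(** The box sums run over all a, not only monic ones, and q - 1 = -1; so they tend to [- formB],
    [formG] and [- formH], and this is the limit of their combination B G + H. *)
Definition formX (z : C) : C := - formB z * formG z - formH z.

Let id_le (a : {poly F}) (_ : a != 0) : `|emb a| <= `|emb a| := lexx _.
Let le_one := @emb_le_one R F C.
Let dec_one m e := @decay_one R F C (Q - 1) m e Q1_gt0.
Let dec_idq m e := @decay_id R F C Q m e Q_gt1.

Lemma boxB_cvg z : Omega z -> av_cvg (Coo_abs C) (Abox id 1 ^~ z) (- formB z).
Proof.
move=> Oz.
have := Abox_cvg (x := id) (ltn0Sn 0) (@homog_id1 _ _ C) id_le (@decay_id1 _ _ C) Oz.
by rewrite emb0 mul0r add0r.
Qed.

Lemma boxG_cvg z : Omega z ->
  av_cvg (Coo_abs C) (Abox one (Q - 1) ^~ z) (formG z).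
Proof.
move=> Oz.
have := Abox_cvg (x := one) Q1_gt0 (@homog_one _ _ C n) le_one dec_one Oz.
by rewrite emb1 mul1r.
Qed.

Lemma boxH_cvg z : Omega z -> av_cvg (Coo_abs C) (Abox id Q ^~ z) (- formH z).
Proof.
move=> Oz.
have := Abox_cvg (x := id) (ltnW Q_gt1) (@homog_idq _ _ C n) id_le dec_idq Oz.
by rewrite emb0 mul0r add0r.
Qed.

Lemma formG_inv z : Omega z -> formG z^-1 = z ^+ (Q - 1) * formG z.
Proof.
move=> Oz; apply: av_cvg_unique (boxG_cvg (Omega_inv Oz)) _.
apply: av_cvg_ext (av_cvgZ _ (boxG_cvg Oz)) => N.
by rewrite Abox_inv ?Omega_neq0 // Adual_one.
Qed.

(** If B, G, H are the three box sums at z, those at 1/z are z (-1 - z B), z^(Q - 1) G and z^Q (G -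
    z H). In B G + H the two terms z^Q G cancel, which leaves - z^(Q + 1) (B G + H). *)
Lemma formX_inv z : Omega z -> formX z^-1 = - z ^+ Q.+1 * formX z.
Proof.
move=> Oz; have z0 := Omega_neq0 Oz.
have boxX_cvg y : Omega y -> av_cvg (Coo_abs C)
    (fun N => Abox id 1 N y * Abox one (Q - 1) N y + Abox id Q N y) (formX y).
  by move=> Oy; apply: av_cvgD (av_cvgM (boxB_cvg Oy) (boxG_cvg Oy)) (boxH_cvg Oy).
apply: av_cvg_unique (boxX_cvg _ (Omega_inv Oz)) _.
apply: (av_cvg_eventually (N := 1)) (av_cvgZ _ (boxX_cvg _ Oz)) => N N0.
rewrite !Abox_inv // Adual_one Adual_id1 // Adual_id ?Q_gt1 // exprS.
have -> : z ^+ Q = z * z ^+ (Q - 1) by rewrite -exprS subn1 prednK // ltnW // Q_gt1.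
by rewrite expr1; ring.
Qed.

Section Upper.
Variables (a d : F) (b : {poly F}) (z : C).
Hypotheses (a0 : a != 0) (d0 : d != 0) (Oz : Omega z).
Let ad : C := emb d%:P / emb a%:P.
Let y : C := (emb a%:P * z + emb b) / emb d%:P.

Let adE : ad = emb (d / a)%:P.
Proof.
have ea0 : emb a%:P != 0 by rewrite emb_eq0 polyC_eq0.
rewrite polyCM embM; congr (_ * _); apply: (mulfI ea0).
by rewrite mulfV // -embM -polyCM mulfV // emb1.
Qed.

Let da0 : d / a != 0. Proof. by rewrite mulf_neq0 // invr_eq0. Qed.

Lemma formG_upper : formG y = formG z.
Proof.
rewrite /formG (Aexp_upper (x := one) Q1_gt0 dec_one) // -/ad adE.
by rewrite embC_expq_predn // mul1r.
Qed.

Lemma formB_upper : formB y = ad * formB z.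
Proof.
by rewrite /formB (Aexp_upper (x := id) (ltn0Sn 0) (@decay_id1 _ _ C)) // expr1.
Qed.

Lemma formH_upper : formH y = ad * formH z.
Proof.
rewrite /formH (Aexp_upper (x := id) (ltnW Q_gt1) dec_idq) // -/ad adE.
by rewrite embC_expqX.
Qed.

Lemma formX_upper : formX y = ad * formX z.
Proof. by rewrite /formX formG_upper formB_upper formH_upper; ring. Qed.

End Upper.

Definition formXG (c : C) (e : nat) (z : C) : C := c * (formX z * formG z ^+ e).

Lemma formXG_modular c e :
  modular_transf (Q.+1 + (Q - 1) * e)%N%:Z 1 (formXG c e).
Proof.
apply: modular_transf_gen => [a d b z a0 d0 Oz|z Oz]; rewrite /formXG.
  rewrite formG_upper // formX_upper // -exprnP exprN1 polyCM embM.
  have ea0 : emb a%:P != 0 by rewrite emb_eq0 polyC_eq0.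
  have ed0 : emb d%:P != 0 by rewrite emb_eq0 polyC_eq0.
  rewrite exprD exprS embC_expqX exprM embC_expq_predn // expr1n.
  by field; rewrite ea0 ed0.
rewrite formG_inv // formX_inv // -exprnP exprN1 invrN1.
by rewrite exprD exprM exprMn; ring.
Qed.

Lemma formXG_rigid c e : rigid_analytic (formXG c e).
Proof.
have hB : bounded_analytic formB.
  exact: (Aexp_bounded_analytic (x := id) (ltn0Sn 0) id_le (@decay_id1 _ _ C)).
have hH : bounded_analytic formH.
  exact: (Aexp_bounded_analytic (x := id) (ltnW Q_gt1) id_le dec_idq).
have hA : bounded_analytic (Aexp (C := C) one (Q - 1)).
  exact: (Aexp_bounded_analytic (x := one) Q1_gt0 le_one dec_one).
have hN f : bounded_analytic f -> bounded_analytic (fun z => -1 * f z).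
  exact/bounded_analyticM/bounded_analytic_cst.
have hG : bounded_analytic formG.
  rewrite (_ : formG = fun z => TI (Q - 1) 0 + -1 * Aexp (C := C) one (Q - 1) z).
    by apply: bounded_analyticD; [exact: bounded_analytic_cst|exact: hN].
  by apply/funext => z; rewrite mulN1r.
have hX : bounded_analytic formX.
  rewrite (_ : formX = fun z => -1 * (formB z * formG z) + -1 * formH z).
    by apply: bounded_analyticD; apply: hN => //; exact: bounded_analyticM.
  by apply/funext => z; rewrite /formX; ring.
apply: bounded_analytic_rigid; apply: bounded_analyticM.
  exact: bounded_analytic_cst.
by apply: bounded_analyticM => //; exact: bounded_analyticX.
Qed.

End EisensteinForms.

(** * Expansions in u *)

Section FormalSeries.
Variable B : comNzRingType.
Implicit Types (c d : nat -> B) (P : {poly B}).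

Definition pmul c d n : B := \sum_(i < n.+1) c i * d (n - i)%N.
Definition pone (n : nat) : B := (n == 0%N)%:R.
Fixpoint pexp c k : nat -> B := if k is j.+1 then pmul c (pexp c j) else pone.
Definition trunc N c : {poly B} := \poly_(i < N) c i.

Lemma eq_pmul c c' d d' n : (forall i, (i <= n)%N -> c i = c' i) ->
  (forall i, (i <= n)%N -> d i = d' i) -> pmul c d n = pmul c' d' n.
Proof.
move=> cE dE; apply: eq_bigr => i _.
by rewrite cE ?dE ?leq_subr // -ltnS.
Qed.

Lemma coef_pmul P P' n :
  pmul (fun i => P`_i) (fun i => P'`_i) n = (P * P')`_n.
Proof. by rewrite coefM. Qed.

Lemma coef_trunc N c n : (n < N)%N -> (trunc N c)`_n = c n.
Proof. by move=> nN; rewrite coef_poly nN. Qed.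

Lemma pmul_trunc N c d n : (n < N)%N ->
  pmul c d n = (trunc N c * trunc N d)`_n.
Proof.
move=> nN; rewrite -coef_pmul; apply: eq_pmul => i ni;
  by rewrite coef_trunc // (leq_ltn_trans ni).
Qed.

Lemma pexp_trunc N c k n : (n < N)%N -> pexp c k n = (trunc N c ^+ k)`_n.
Proof.
elim: k n => [|k IH] n nN; first by rewrite expr0 coef1.
rewrite exprS -coef_pmul; apply: eq_pmul => i ni.
  by rewrite coef_trunc // (leq_ltn_trans ni).
exact: IH (leq_ltn_trans ni nN).
Qed.

Lemma pmul_low c d s t n : (forall i, (i < s)%N -> c i = 0) ->
  (forall i, (i < t)%N -> d i = 0) -> (n < s + t)%N -> pmul c d n = 0.
Proof.
move=> c0 d0 nst; apply: big1 => i _; have [is_|si] := ltnP i s.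
  by rewrite c0 ?mul0r.
by rewrite d0 ?mulr0 // -(ltn_add2l s) (leq_ltn_trans _ nst) //; have := ltn_ord i; lia.
Qed.

Lemma pexp_low c s k n : (forall i, (i < s)%N -> c i = 0) ->
  (n < k * s)%N -> pexp c k n = 0.
Proof.
move=> c0; elim: k n => [//|k IH] n nk.
by apply: (pmul_low c0 IH); rewrite mulSn in nk.
Qed.

Lemma coef_expX_low P k n : P`_0 = 0 -> (n < k)%N -> (P ^+ k)`_n = 0.
Proof.
move=> P0 nk; have /factor_theorem[P' ->] : root P 0.
  by rewrite /root horner_coef0 P0.
by rewrite subr0 exprMn_comm ?coefMXn ?nk //; exact: commr_polyX.
Qed.

(** The range of summation in [ps_inv] depends on the coefficient. As (1 - P)^k has no term below
    degree k, it may be enlarged, and a single polynomial then gives all coefficients up to n. *)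
Lemma ps_inv_wide P m n : P`_0 = 1 -> (m <= n)%N ->
  ps_inv P m = (\sum_(k < n.+1) (1 - P) ^+ k)`_m.
Proof.
move=> P0 mn; rewrite /ps_inv !coef_sum -!(big_mkord xpredT (fun k => ((1 - P) ^+ k)`_m)).
rewrite [RHS](big_cat_nat (n := m.+1)) //= [X in _ = _ + X]big_nat_cond.
rewrite [X in _ = _ + X]big1 ?addr0 // => k /andP[/andP[mk _] _].
by apply: coef_expX_low => //; rewrite coefB coef1 P0 subrr.
Qed.

Lemma ps_invP P n : P`_0 = 1 -> pmul (fun i => P`_i) (ps_inv P) n = pone n.
Proof.
move=> P0; pose S := \sum_(k < n.+1) (1 - P) ^+ k.
rewrite (@eq_pmul _ (fun i => P`_i) _ (fun i => S`_i)) => [| //|i ni]; last first.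
  exact: ps_inv_wide.
rewrite coef_pmul; have -> : P * S = 1 - (1 - P) ^+ n.+1.
  rewrite -[1 - _ ^+ _]opprB subrX1 -mulNr; congr (_ * _); ring.
by rewrite coefB coef1 coef_expX_low ?subr0 // coefB coef1 P0 subrr.
Qed.

End FormalSeries.

(** * Degrees in theta of the coefficients of u_a *)

Section Degrees.
Variable F : finFieldType.
Local Notation q := #|F|.

(** Under this growth condition the series converges for |u| < 1 / q, at a rate that does not depend
    on a when c is the expansion of u_a. *)
Definition deg_le (c : nat -> {poly F}) : Prop := forall n, (size (c n) <= n.+1)%N.

Lemma deg_le_pmul c d : deg_le c -> deg_le d -> deg_le (pmul c d).
Proof.
move=> hc hd n; rewrite (leq_trans (size_sum _ _ _)) //.
apply/bigmax_leqP => i _; rewrite (leq_trans (size_polyMleq _ _)) //.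
by have := hc i; have := hd (n - i)%N; have := ltn_ord i; lia.
Qed.

Lemma deg_le_pone : deg_le (@pone {poly F}).
Proof. by case=> [|n]; rewrite /pone ?size_poly1 ?size_poly0. Qed.

Lemma deg_le_pexp c k : deg_le c -> deg_le (pexp c k).
Proof.
by move=> hc; elim: k => [|k IH]; [exact: deg_le_pone|exact: deg_le_pmul].
Qed.

Lemma deg_le_ps_inv (P : {poly {poly F}}) :
  deg_le (fun j => P`_j) -> deg_le (ps_inv P).
Proof.
move=> hP n; rewrite /ps_inv coef_sum (leq_trans (size_sum _ _ _)) //.
apply/bigmax_leqP => -[k kn] _ /=; elim: k n {kn} => [|k IH] n.
  by rewrite expr0 coef1; exact: deg_le_pone.
have hW : deg_le (fun j => (1 - P)`_j).
  move=> j; rewrite coefB coef1 (leq_trans (size_polyD _ _)) // geq_max size_polyN hP.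
  by rewrite andbT; case: eqP => // _; rewrite ?size_poly0 ?size_poly1.
by rewrite exprS -coef_pmul; exact: deg_le_pmul.
Qed.

(* The total degree of [P] in [theta] and [x] is at most [M]. *)
Definition tdeg_le (M : nat) (P : {poly {poly F}}) : Prop :=
  forall j : nat, (size (P`_j)%R <= M.+1 - j)%N.

Lemma tdeg_leW M M' P : (M <= M')%N -> tdeg_le M P -> tdeg_le M' P.
Proof. by move=> MM h j; apply: leq_trans (h j) _; lia. Qed.

Lemma tdeg_leD M P P' : tdeg_le M P -> tdeg_le M P' -> tdeg_le M (P + P').
Proof.
by move=> h h' j; rewrite coefD (leq_trans (size_polyD _ _)) // geq_max h h'.
Qed.

Lemma tdeg_leM M M' P P' : tdeg_le M P -> tdeg_le M' P' -> tdeg_le (M + M') (P * P').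
Proof.
move=> h h' j; rewrite coefM (leq_trans (size_sum _ _ _)) //.
apply/bigmax_leqP => i _; have := h i; have := h' (j - i)%N; have := ltn_ord i.
have [->|p0] := eqVneq P`_i 0; first by rewrite mul0r size_poly0.
have [->|p0'] := eqVneq P'`_(j - i) 0; first by rewrite mulr0 size_poly0.
rewrite size_mul //; move: p0 p0'; rewrite -!size_poly_gt0.
move: (nat_of_ord i) (size _) (size _) => i' s s'; lia.
Qed.

Lemma tdeg_le_const (c : F) : tdeg_le 0 c%:P%:P.
Proof.
move=> j; rewrite coefC; case: eqP => [->|_]; last by rewrite size_poly0.
by rewrite size_polyC; case: eqP.
Qed.

Lemma tdeg_leX M P k : tdeg_le M P -> tdeg_le (k * M) (P ^+ k).
Proof.
move=> h; elim: k => [|k IH]; last by rewrite exprS mulSn; exact: tdeg_leM.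
by rewrite expr0; have := tdeg_le_const 1.
Qed.

Lemma tdeg_carlitz_theta M P : (0 < M)%N -> tdeg_le M P ->
  tdeg_le (q * M) (carlitz_theta P).
Proof.
move=> M0 h; apply: tdeg_leD; last exact: tdeg_leX.
have hX : tdeg_le 1 ('X : {poly F})%:P.
  by move=> j; rewrite coefC; case: eqP => [->|_]; rewrite ?size_poly0 ?size_polyX.
apply: tdeg_leW (tdeg_leM hX h).
by have := cardF_gt1 F; move: (q) => x x1; nia.
Qed.

Lemma tdeg_iter i : tdeg_le (q ^ i) (iter i (@carlitz_theta F) 'X).
Proof.
elim: i => [|i IH].
  by move=> j /=; rewrite coefX; case: eqP => [->|_]; rewrite ?size_poly0 ?size_poly1.
by rewrite expnS; apply: tdeg_carlitz_theta => //; exact: cardFX_gt0.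
Qed.

Lemma carlitz_iter_lead i : (iter i (@carlitz_theta F) 'X)`_(q ^ i) = 1.
Proof.
suff [] : size (iter i (@carlitz_theta F) 'X) = (q ^ i).+1 /\
    lead_coef (iter i (@carlitz_theta F) 'X) = 1.
  by rewrite lead_coefE => ->.
elim: i => [|i [IHs IHl]]; first by rewrite /= size_polyX lead_coefX.
rewrite iterS /carlitz_theta; set P := iter i _ _ in IHs IHl *.
have P0 : P != 0 by rewrite -size_poly_gt0 IHs.
have sq : size (P ^+ q) = (q ^ i.+1).+1.
  have := size_exp P q; rewrite IHs /= expnSr => <-.
  by rewrite prednK // size_poly_gt0 expf_neq0.
have lt : (size (('X : {poly F})%:P * P)%R < size (P ^+ q))%N.
  rewrite size_Cmul ?polyX_eq0 // IHs sq ltnS ltn_exp2l ?cardF_gt1 //.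
by rewrite addrC size_polyDl // lead_coefDl // sq lead_coef_exp IHl expr1n.
Qed.

Lemma tdeg_carlitz a : tdeg_le (q ^ deg a) (carlitz a).
Proof.
rewrite /carlitz; elim/big_rec: _ => [|i P _ hP].
  by move=> j; rewrite coef0 size_poly0.
apply: tdeg_leD => //.
apply: tdeg_leW (tdeg_leM (tdeg_le_const _) (tdeg_iter i)).
rewrite add0n leq_exp2l ?cardF_gt1 // /deg.
by rewrite -ltnS (leq_trans (ltn_ord i)) ?leqSpred.
Qed.

Lemma carlitz_lead (a : {poly F}) : a \is monic -> (carlitz a)`_(q ^ deg a) = 1.
Proof.
move=> am; have sa : size a = (deg a).+1.
  by rewrite /deg prednK // size_poly_gt0 monic_neq0.
rewrite /carlitz sa big_ord_recr /= coefD coef_sum big1 => [|i _].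
  by rewrite add0r coefCM carlitz_iter_lead mulr1 -lead_coefE (monicP am).
apply/eqP; rewrite -size_poly_leq0.
apply: leq_trans (tdeg_leM (tdeg_le_const _) (tdeg_iter i) _) _.
rewrite add0n leqn0 subn_eq0 ltn_exp2l ?cardF_gt1 //.
Qed.

(** C_a has total degree at most q^deg a in theta and x; reversing it in x turns the codegree of a
    coefficient into its index. *)
Lemma deg_le_carlitz_rev (a : {poly F}) : deg_le (fun j => (carlitz_rev a)`_j).
Proof.
move=> j; rewrite coef_poly; case: ltnP => jq; last by rewrite size_poly0.
by apply: leq_trans (tdeg_carlitz a _) _; lia.
Qed.

Lemma carlitz_rev0 (a : {poly F}) : a \is monic -> (carlitz_rev a)`_0 = 1.
Proof. by move=> am; rewrite coef_poly /= subn0 carlitz_lead. Qed.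

Lemma u_series_low (a : {poly F}) n : (n < q ^ deg a)%N -> u_series a n = 0.
Proof. by rewrite /u_series => ->. Qed.

Lemma deg_le_u_series (a : {poly F}) : deg_le (u_series a).
Proof.
move=> n; rewrite /u_series; case: ltnP => h; first by rewrite size_poly0.
by apply: leq_trans (deg_le_ps_inv (deg_le_carlitz_rev a) _) _; lia.
Qed.

Lemma pexp_u_series_low (a : {poly F}) k n : (0 < k)%N ->
  (n < q ^ deg a)%N -> pexp (u_series a) k n = 0.
Proof.
move=> k0 h; apply: (pexp_low (s := q ^ deg a)) => [i|]; first exact: u_series_low.
by rewrite (leq_trans h) // leq_pmull.
Qed.

End Degrees.

(** * Evaluation of formal series in u *)

Section ConvergentSeries.
Variables (R : realType) (F : finFieldType) (C : complex_infty R F).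
Local Notation q := #|F|.
Local Notation "`| x |" := (Coo_abs C x) : ring_scope.
Local Notation emb := (@emb R F C).

Definition psum (c : nat -> C) (x s : C) : Prop :=
  av_cvg (Coo_abs C) (fun n => \sum_(i < n) c i * x ^+ i) s.

Lemma eq_psum c c' x s : (forall i, c i = c' i) -> psum c x s -> psum c' x s.
Proof.
move=> e; apply: av_cvg_ext => n; apply: eq_bigr => i _; by rewrite e.
Qed.

Lemma psum_ex c x : (forall e : R, 0 < e -> exists N : nat, forall n, (N <= n)%N ->
  `|c n * x ^+ n| <= e) -> exists s, psum c x s.
Proof.
move=> h; apply: (@av_cvg_series _ _ _ (@Coo_complete _ _ C) (fun n => c n * x ^+ n)).
apply/av_cvgP => e /h[N hN]; exists N => n Nn.
by rewrite subr0; exact: hN.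
Qed.

Lemma psumD c c' x s s' : psum c x s -> psum c' x s' ->
  psum (fun n => c n + c' n) x (s + s').
Proof.
move=> h h'; apply: av_cvg_ext (av_cvgD h h') => n.
by rewrite -big_split; apply: eq_bigr => i _; rewrite mulrDl.
Qed.

Lemma psumZ (k : C) c x s : psum c x s -> psum (fun n => k * c n) x (k * s).
Proof.
move=> h; apply: av_cvg_ext (av_cvgZ k h) => n.
by rewrite mulr_sumr; apply: eq_bigr => i _; rewrite mulrA.
Qed.

Lemma psum_poly (P : {poly C}) x : psum (fun i => P`_i) x P.[x].
Proof.
apply: (av_cvg_eventually (N := size P)) (av_cvg_cst _ _) => n Pn.
by rewrite (horner_coef_wide _ Pn).
Qed.

Lemma psum_tail c x s n (e : R) : psum c x s -> 0 <= e ->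
  (forall m, (n <= m)%N -> `|c m * x ^+ m| <= e) ->
  `|s - \sum_(i < n) c i * x ^+ i| <= e.
Proof.
move=> h e0 ce; apply: (@av_cvg_ball _ _ _ _ _ _ _ n h) => m nm.
apply: (@av_step_le _ _ _ (fun n => \sum_(i < n) c i * x ^+ i) e n) => // k nk.
by rewrite big_ord_recr /= [X in X - _]addrC addrK; exact: ce.
Qed.

Lemma psumM c d x s t : psum c x s -> psum d x t -> psum (pmul c d) x (s * t).
Proof.
move=> hc hd; pose a i := c i * x ^+ i; pose b i := d i * x ^+ i.
have [A A0 hA] := av_cvg_bounded hc; have [B B0 hB] := av_cvg_bounded hd.
have aE i : a i = \sum_(j < i.+1) a j - \sum_(j < i) a j.
  by rewrite big_ord_recr /= [X in X - _]addrC addrK.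
have aA i : `|a i| <= A by rewrite aE absvalB_le ?hA.
suff : av_cvg (Coo_abs C) (fun n => (\sum_(i < n) a i) * (\sum_(i < n) b i) -
    \sum_(i < n) pmul c d i * x ^+ i) 0.
  move=> /(av_cvgN)/(av_cvgD (av_cvgM hc hd)); rewrite oppr0 addr0.
  by apply: av_cvg_ext => n; rewrite opprB addrC subrK.
have DE n : \sum_(i < n) pmul c d i * x ^+ i = \sum_(i < n) \sum_(j < n - i) a i * b j.
  transitivity (\sum_(k < n) \sum_(i < k.+1) a i * b (k - i)%N).
    apply: eq_bigr => k _; rewrite mulr_suml; apply: eq_bigr => i _.
    have ik : (i <= k)%N by rewrite -ltnS.
    have -> : x ^+ k = x ^+ i * x ^+ (k - i) by rewrite -exprD subnKC.
    by rewrite /a /b; ring.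
  rewrite -(triangle_sum n (fun i k => a i * b (k - i)%N)).
  by apply: eq_bigr => i _; apply: eq_bigr => j _; rewrite addKn.
move/av_cvgP: (hc) => hc'; move/av_cvgP: (hd) => hd'; apply/av_cvgP => e e0.
have [N1 hN1] := hc' _ (divr_gt0 e0 B0); have [N2 hN2] := hd' _ (divr_gt0 e0 A0).
exists (N1 + N2)%N => n Nn; rewrite subr0 DE mulr_suml -sumrB.
apply: absval_sum_le => [|i _]; first exact: ltW.
(* For i < N1 the block of b from n - i to n lies beyond N2 and has a small sum; for the other i the
   term [a i] itself is small. *)
rewrite -mulr_sumr -mulrBr absvalM; have [iN|Ni] := ltnP i N1.
  rewrite -[leRHS](divfK (lt0r_neq0 A0)) mulrC.
  apply: ler_pM; rewrite ?absval_ge0 //.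
  rewrite (_ : _ - _ = (\sum_(j < n) b j - t) - (\sum_(j < n - i) b j - t)); last by ring.
  by apply: absvalB_le; apply: hN2; have := ltn_ord i; lia.
rewrite -[leRHS](divfK (lt0r_neq0 B0)).
apply: ler_pM; rewrite ?absval_ge0 //; last by apply: absvalB_le; exact: hB.
rewrite aE (_ : _ - _ = (\sum_(j < i.+1) a j - s) - (\sum_(j < i) a j - s)); last by ring.
by apply: absvalB_le; apply: hN1 => //; rewrite ltnW.
Qed.

Lemma psum_one x : psum (@pone C) x 1.
Proof.
have := psum_poly 1 x; rewrite hornerC; apply: eq_psum => i.
by rewrite coef1.
Qed.

Lemma psumX c x s k : psum c x s -> psum (pexp c k) x (s ^+ k).
Proof.
move=> h; elim: k => [|k IH]; first exact: psum_one.
by rewrite exprS; exact: psumM.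
Qed.

Lemma emb_pmul c d n :
  emb (pmul c d n) = pmul (fun i => emb (c i)) (fun i => emb (d i)) n.
Proof. by rewrite emb_sum; apply: eq_bigr => i _; rewrite embM. Qed.

Lemma emb_pone n : emb (pone _ n) = pone _ n.
Proof. by rewrite /pone; case: eqP => _; rewrite ?emb1 ?emb0. Qed.

Lemma emb_pexp c k n : emb (pexp c k n) = pexp (fun i => emb (c i)) k n.
Proof.
elim: k n => [|k IH] n; first exact: emb_pone.
by rewrite [LHS]emb_pmul; apply: eq_pmul => i _ //; exact: IH.
Qed.

Lemma deg_le_term c (x : C) n : deg_le c -> `|emb (c n) * x ^+ n| <= (q%:R * `|x|) ^+ n.
Proof.
move=> hc; rewrite absvalM absvalX exprMn ler_wpM2r ?exprn_ge0 ?absval_ge0 //.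
exact: emb_abs_le.
Qed.

Definition ev (P : {poly {poly F}}) (y : C) : C := (map_poly emb P).[y].

Lemma evD P P' y : ev (P + P') y = ev P y + ev P' y.
Proof. by rewrite /ev rmorphD hornerD. Qed.

Lemma evM P P' y : ev (P * P') y = ev P y * ev P' y.
Proof. by rewrite /ev rmorphM hornerM. Qed.

Lemma evC a y : ev a%:P y = emb a.
Proof. by rewrite /ev map_polyC hornerC. Qed.

Lemma evX P n y : ev (P ^+ n) y = ev P y ^+ n.
Proof. by rewrite /ev rmorphXn horner_exp. Qed.

Lemma ev_sum I (r : seq I) (f : I -> {poly {poly F}}) y :
  ev (\sum_(i <- r) f i) y = \sum_(i <- r) ev (f i) y.
Proof. by rewrite /ev rmorph_sum horner_sum. Qed.

Lemma ev_iter i w :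
  ev (iter i (@carlitz_theta F) 'X) (carlitz_exp w) = carlitz_exp (th C ^+ i * w).
Proof.
elim: i => [|i IH]; first by rewrite /ev map_polyX hornerX mul1r.
by rewrite iterS /carlitz_theta evD evM evC evX IH exprS -mulrA ec_th.
Qed.

Lemma ev_carlitz a w : ev (carlitz a) (carlitz_exp w) = carlitz_exp (emb a * w).
Proof.
have ec_sum (r : seq nat) (f : nat -> C) : carlitz_exp (\sum_(i <- r) f i) =
    \sum_(i <- r) carlitz_exp (f i).
  by apply: (big_morph (@carlitz_exp R F C)); [exact: ec_add|exact: ec0].
have aE : emb a = \sum_(0 <= i < size a) emb (a`_i)%:P * th C ^+ i.
  rewrite big_mkord -{1}(coefK a) poly_def emb_sum.
  by apply: eq_bigr => i _; rewrite embZ embX.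
rewrite aE mulr_suml ec_sum big_mkord /carlitz ev_sum; apply: eq_bigr => i _.
by rewrite evM evC ev_iter -mulrA ec_scale.
Qed.

Lemma ev_carlitz_rev (a : {poly F}) x : x != 0 ->
  ev (carlitz_rev a) x = x ^+ (q ^ deg a) * ev (carlitz a) x^-1.
Proof.
move=> x0; set M := (q ^ deg a)%N.
have evw (P : {poly {poly F}}) : (size P <= M.+1)%N -> forall y : C,
    ev P y = \sum_(j < M.+1) emb P`_j * y ^+ j.
  move=> sP y; rewrite /ev (@horner_coef_wide _ M.+1); last first.
    by rewrite (leq_trans (size_poly _ _)).
  by apply: eq_bigr => i _; rewrite coef_map.
have sC : (size (carlitz a) <= M.+1)%N.
  apply/leq_sizeP => j Mj; apply/eqP; rewrite -size_poly_leq0.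
  by apply: leq_trans (tdeg_carlitz a j) _; rewrite leqn0 subn_eq0.
rewrite !evw ?size_poly // mulr_sumr (reindex_inj rev_ord_inj) /=.
apply: eq_bigr => j _; have jM : (j <= M)%N by rewrite -ltnS.
rewrite subSS coef_poly ltnS leq_subr subKn // mulrCA; congr (_ * _).
have -> : x ^+ M = x ^+ (M - j) * x ^+ j by rewrite -exprD subnK.
by rewrite exprVn mulfK ?expf_neq0.
Qed.

(** The radius gives q |x| <= 1 / q, so by [deg_le] the formal inverse of R_a converges at x. Its
    value is the inverse of R_a(x) because the Cauchy product of the two series is 1. *)
Lemma psum_u_series (a : {poly F}) x : a \is monic -> x != 0 -> `|x| <= q%:R ^- 2 ->
  psum (fun n => emb (u_series a n)) x (ev (carlitz a) x^-1)^-1.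
Proof.
move=> am x0 hx; set M := (q ^ deg a)%N.
have qx : q%:R * `|x| <= q%:R^-1.
  rewrite mulrC -ler_pdivlMr ?cardR_gt0 // (le_trans hx) //.
  by rewrite exprS expr1 invfM.
have [s hs] : exists s, psum (fun n => emb (ps_inv (carlitz_rev a) n)) x s.
  apply: psum_ex => e e0; have [N hN] := @cardRXV_small R F e e0; exists N => n Nn.
  apply: le_trans (deg_le_term _ _ (deg_le_ps_inv (deg_le_carlitz_rev a))) _.
  apply: le_trans hN; apply: (@le_trans _ _ (q%:R^-1 ^+ n)).
    by apply: lerXn2r => //; rewrite nnegrE ?mulr_ge0 ?absval_ge0 ?invr_ge0 ?ler0n.
  by rewrite exprVn cardRXV_le.
have := psumM (psum_poly (map_poly emb (carlitz_rev a)) x) hs.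
have pE n : pmul (fun i => (map_poly emb (carlitz_rev a))`_i)
    (fun n => emb (ps_inv (carlitz_rev a) n)) n = pone _ n.
  rewrite -emb_pone -(ps_invP _ (carlitz_rev0 am)) emb_pmul.
  by apply: eq_pmul => i _ //; rewrite coef_map.
move=> /(eq_psum pE)/av_cvg_unique/(_ (psum_one x)); rewrite -/(ev _ x).
rewrite ev_carlitz_rev // -/M => E.
have := psumM (psum_poly 'X^M x) hs; rewrite hornerXn.
have -> : x ^+ M * s = (ev (carlitz a) x^-1)^-1.
  have y0 : ev (carlitz a) x^-1 != 0.
    by apply/eqP => y0; move/eqP: E; rewrite y0 mulr0 mul0r eq_sym oner_eq0.
  by apply: (mulfI y0); rewrite mulfV // mulrA [_ * x ^+ M]mulrC.
apply: eq_psum => n; rewrite /u_series -/M; case: ltnP => nM.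
  rewrite emb0; apply: big1 => i _; rewrite coefXn ltn_eqF ?mul0r //.
  by rewrite (leq_trans _ nM) // ltn_ord.
have Mn : (M < n.+1)%N by [].
rewrite /pmul (bigD1 (Ordinal Mn)) //= coefXn eqxx mul1r big1 ?addr0 // => i iM.
rewrite coefXn (_ : (i == M :> nat) = false) ?mul0r //.
by apply: contraNF iM => /eqP e; apply/eqP/val_inj.
Qed.

(** An exchange of summations: the vanishing of low coefficients leaves finitely many a for each
    power of x, and the bound K q^-n controls the tails uniformly in a. *)
Lemma psum_monic (c : {poly F} -> nat -> {poly F}) (s : {poly F} -> C) x S (K : R) :
  0 <= K ->
  (forall a, a \is monic -> psum (fun n => emb (c a n)) x (s a)) ->
  (forall a n, a \is monic -> (n < q ^ deg a)%N -> c a n = 0) ->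
  (forall a n, a \is monic -> `|emb (c a n) * x ^+ n| <= K * q%:R ^- n) ->
  av_cvg (Coo_abs C) (fun N => \sum_(j < N) monsum j s) S ->
  psum (fun n => emb (\sum_(j < n.+1) monsum j (c ^~ n))) x S.
Proof.
move=> K0 hs low bd hS; apply/av_cvgP => e e0.
have K1 : 0 < K + 1 by rewrite ltr_wpDl.
have [M hM] := @cardRXV_small R F _ (divr_gt0 e0 K1).
have small a n : (M <= n)%N -> a \is monic -> `|emb (c a n) * x ^+ n| <= e.
  move=> Mn am; apply: le_trans (bd a n am) _.
  rewrite -[leRHS](divfK (lt0r_neq0 K1)) mulrC; apply: ler_pM; rewrite ?cardRXV_ge0 ?lerDl //.
  by apply: le_trans hM; exact: cardRXV_le.
exists M => n Mn; rewrite absvalBC.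
apply: (@av_cvg_ball _ _ _ _ _ _ _ n hS) => N nN.
have -> : \sum_(i < n) emb (\sum_(j < i.+1) monsum j (c ^~ i)) * x ^+ i =
    \sum_(j < N) monsum j (fun a => \sum_(i < n) emb (c a i) * x ^+ i).
  transitivity (\sum_(i < n) \sum_(j < N) monsum j (fun a => emb (c a i) * x ^+ i)).
    apply: eq_bigr => i _; have iN : (i.+1 <= N)%N by rewrite (leq_trans _ nN).
    rewrite (big_ord_widen N (fun j => monsum j (c ^~ i)) iN) big_mkcond emb_sum mulr_suml.
    apply: eq_bigr => j _; case: ifP => ji; rewrite /monsum.
      by rewrite emb_sum mulr_suml.
    rewrite emb0 mul0r big1 // => v _; rewrite low ?emb0 ?mul0r //.
      by rewrite monic_shift ?size_poly.
    rewrite /deg size_monic_shift ?size_poly //=.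
    apply: leq_ltn_trans (ltn_expl j (cardF_gt1 F)).
    by move/negbT: ji; rewrite -leqNgt => /ltnW.
  rewrite exchange_big; apply: eq_bigr => j _; rewrite /monsum exchange_big.
  by [].
rewrite -sumrB; apply: absval_sum_le => [|j _]; first exact: ltW.
rewrite /monsum -sumrB; apply: absval_sum_le => [|v _]; first exact: ltW.
have am : 'X^j + rVpoly v \is monic by rewrite monic_shift ?size_poly.
apply: (psum_tail (hs _ am)) => [|m nm]; first exact: ltW.
by apply: small => //; rewrite (leq_trans Mn).
Qed.

End ConvergentSeries.

(** * The u-expansions of the forms, with coefficients in A *)

Section FormCoefficients.
Variable F : finFieldType.
Local Notation q := #|F|.

(* [gam n i = (-1)^(n - i) L_n / L_i] *)
Definition gam (n i : nat) : {poly F} := \prod_(i <= j < n) ('X - 'X ^+ (q ^ j.+1)).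

Lemma gamM n i : (i <= n)%N -> gam n i * gam i 0 = gam n 0.
Proof. by move=> i_n; rewrite mulrC -big_cat_nat. Qed.

Lemma gam_carlitz_L n : gam n 0 = (-1) ^+ n * carlitz_L F n.
Proof.
rewrite /gam big_mkord /carlitz_L -[X in _ ^+ X]card_ord -prodr_const -big_split.
by apply: eq_bigr => i _ /=; rewrite mulN1r opprB.
Qed.

Lemma gam_neq0 n : gam n 0 != 0.
Proof. by rewrite gam_carlitz_L mulf_neq0 ?signr_eq0 ?carlitz_L_neq0. Qed.

Definition ser_h (n m : nat) : {poly F} :=
  \sum_(j < m.+1) monsum j (fun a => a * pexp (u_series a) (q ^ n) m).

(** The expansion of [TI (q ^ n - 1)] at a z divided by [beI C n]: by [TI_beI] that sum is a
    polynomial in u_a, and [beI_ratio] computes the normalized coefficients. *)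
Definition ser_ga (n : nat) (a : {poly F}) (m : nat) : {poly F} :=
  \sum_(i < n) gam n i * pexp (u_series a) (q ^ n - q ^ i) m.

Definition ser_g (n m : nat) : {poly F} :=
  pone _ m + \sum_(j < m.+1) monsum j (fun a => ser_ga n a m).

Definition ser_X (n m : nat) : {poly F} :=
  pmul (@false_eisenstein F) (ser_g n) m - gam n 0 * ser_h n m.

Definition ser_form (n e : nat) : nat -> {poly F} := pmul (ser_X n) (pexp (ser_g n) e).

End FormCoefficients.

Section UExpansion.
Variables (R : realType) (F : finFieldType) (C : complex_infty R F).
Local Notation q := #|F|.
Local Notation "`| x |" := (Coo_abs C x) : ring_scope.
Local Notation emb := (@emb R F C).
Variables (tpi : C) (n : nat).
Hypothesis htpi : carlitz_period tpi.
Hypothesis n_gt0 : (0 < n)%N.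
Local Notation Q := (q ^ n)%N.
Local Notation u a z := (u_param tpi (emb a * z)).

Lemma TI_beI w : (forall N, pole_free N w) ->
  TI (Q - 1) w = \sum_(i < n) beI C i * TI 1 w ^+ (Q - q ^ i).
Proof.
move=> h; apply: av_cvg_unique (TN_cvg w (Q1_gt0 F n_gt0)) _.
apply: av_cvg_ext (av_cvg_sum (index_enum 'I_n) (fun i : 'I_n =>
  av_cvgM (be_cvg C i) (av_cvgX (Q - q ^ i) (TN_cvg w (ltn0Sn 0))))) => N.
by rewrite TN_be //; apply: eq_bigr => i _; rewrite TN1.
Qed.

Lemma beI_gam k : beI C k = tpi ^+ (q ^ k - 1) / emb (gam F k 0).
Proof.
rewrite (beIE k htpi) gam_carlitz_L embM embX embN emb1 invfM -exprVn invrN1.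
by rewrite -mulrA mulrCA.
Qed.

Lemma beI_neq0 k : beI C k != 0.
Proof.
by rewrite beI_gam mulf_neq0 ?invr_eq0 ?emb_eq0 ?gam_neq0 ?expf_neq0 ?(tpi_neq0 htpi).
Qed.

(** The powers of tpi from u = TI 1 / tpi cancel those in the logarithm coefficients; this is why
    the normalized Eisenstein series has coefficients in A. *)
Lemma beI_ratio i : (i <= n)%N ->
  beI C i / beI C n * tpi ^+ (Q - q ^ i) = emb (gam F n i).
Proof.
move=> i_n; have t0 := tpi_neq0 htpi.
have g0 k : emb (gam F k 0) != 0 by rewrite emb_eq0 gam_neq0.
have -> : emb (gam F n i) = emb (gam F n 0) / emb (gam F i 0).
  by rewrite -(gamM F i_n) embM mulfK.
have E : tpi ^+ (Q - 1) = tpi ^+ (Q - q ^ i) * tpi ^+ (q ^ i - 1).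
  rewrite -exprD; congr (_ ^+ _).
  have h1 : (q ^ i <= Q)%N by rewrite leq_exp2l ?cardF_gt1.
  by have := cardFX_gt0 F i; lia.
rewrite !beI_gam E invfM invrK; field.
by rewrite !g0 !expf_neq0.
Qed.

Variable z : C.
(** The constant ensures |u| <= q^-3, hence terms of size at most q^(-2m) in degree m. One factor
    q^-m absorbs the coefficient a, since u_a starts at u^(q^deg a) and deg a <= m wherever it
    contributes; the other one gives convergence. *)
Hypothesis far : forall x, Koo x -> q%:R ^+ 3 / `|tpi| <= `|z - x|.

Let tpi_gt0 : 0 < `|tpi|. Proof. by rewrite absval_gt0 (tpi_neq0 htpi). Qed.
Let r_gt0 : 0 < q%:R ^+ 3 / `|tpi|. Proof. by rewrite divr_gt0 ?cardRX_gt0. Qed.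

Lemma far_Omega : Omega z.
Proof. by move=> Kz; have := far Kz; rewrite subrr absval0 leNgt r_gt0. Qed.

Lemma uE (a : {poly F}) : a != 0 -> u a z = TI 1 (emb a * z) / tpi.
Proof.
by move=> a0; rewrite (u_paramE htpi) // => N; exact: Omega_pole_free far_Omega a0.
Qed.

Local Notation x := (u_param tpi z).

Lemma x_small : `|x| <= q%:R ^- 3.
Proof.
have -> : x = TI 1 z / tpi.
  by have := uE (oner_neq0 _); rewrite emb1 mul1r.
rewrite absvalM absvalV ler_pdivrMr //; apply: (av_cvg_le (N := 0) (TN_cvg z (ltn0Sn 0))).
move=> N _; apply: sumA_le => [|b _]; first by rewrite mulr_ge0 ?cardRXV_ge0 // ltW.
have h : q%:R ^+ 3 / `|tpi| <= `|z + emb b|.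
  by rewrite -[emb b]opprK -embN; apply: far; exact: Koo_emb.
rewrite expr1 absvalV -[leRHS]invrK.
rewrite lef_pV2 ?posrE ?invr_gt0 ?mulr_gt0 ?invr_gt0 ?cardRX_gt0 //.
  by rewrite invfM invrK.
exact: lt_le_trans h.
Qed.

Lemma x_neq0 : x != 0.
Proof.
rewrite /u_param (carlitz_exp_tpi htpi) invr_eq0 mulf_neq0 ?(tpi_neq0 htpi) //.
apply/eqP => /eI_eq0[a za]; apply: far_Omega; rewrite za.
exact: Koo_emb.
Qed.

Lemma psum_u a : a \is monic -> psum (fun m => emb (u_series a m)) x (u a z).
Proof.
move=> am; have hx : `|x| <= q%:R ^- 2 by rewrite (le_trans x_small) ?cardRXV_le.
have := psum_u_series am x_neq0 hx.
by rewrite /u_param invrK ev_carlitz mulrCA.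
Qed.

Lemma psum_uX a k : a \is monic ->
  psum (fun m => emb (pexp (u_series a) k m)) x (u a z ^+ k).
Proof.
move=> am; apply: eq_psum (psumX k (psum_u am)) => m.
by rewrite emb_pexp.
Qed.

Lemma term_le c m : deg_le c -> `|emb (c m) * x ^+ m| <= q%:R ^- m * q%:R ^- m.
Proof.
move=> hc; apply: le_trans (deg_le_term _ _ hc) _.
have -> : q%:R ^- m * q%:R ^- m = (q%:R ^- 2) ^+ m :> R.
  by rewrite -invfM -exprD exprVn -exprM mul2n addnn.
apply: lerXn2r; rewrite ?nnegrE ?mulr_ge0 ?ler0n ?absval_ge0 ?cardRXV_ge0 //.
apply: (@le_trans _ _ (q%:R * q%:R ^- 3)); first by rewrite ler_wpM2l ?ler0n ?x_small.
by rewrite exprS invfM mulVKf // lt0r_neq0 // cardR_gt0.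
Qed.

Lemma term_le1 c m : deg_le c -> `|emb (c m) * x ^+ m| <= q%:R ^- m.
Proof.
by move=> hc; apply: le_trans (term_le m hc) _; rewrite ler_piMr ?cardRXV_ge0 ?cardRXV_le1.
Qed.

Lemma term_le_id (a : {poly F}) c m : deg_le c ->
  (forall k, (k < q ^ deg a)%N -> c k = 0) ->
  `|emb (a * c m) * x ^+ m| <= 1 * q%:R ^- m.
Proof.
move=> hc low; rewrite mul1r; have [ma|am] := ltnP m (q ^ deg a).
  by rewrite low // mulr0 emb0 mul0r absval0 cardRXV_ge0.
rewrite embM -mulrA absvalM; apply: (@le_trans _ _ (q%:R ^+ m * (q%:R ^- m * q%:R ^- m))).
  apply: ler_pM; rewrite ?absval_ge0 ?term_le //; apply: emb_abs_le.
  rewrite (leq_trans (leqSpred _)) // ltnS -/(deg a).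
  by rewrite (leq_trans _ am) // ltnW // ltn_expl // cardF_gt1.
by rewrite mulVKf // lt0r_neq0 // cardRX_gt0.
Qed.

Lemma psum_E : psum (fun m => emb (false_eisenstein F m)) x (formB z / tpi).
Proof.
pose c (a : {poly F}) m := a * u_series a m.
apply: (@psum_monic _ _ C c (fun a => emb a * u a z) x _ 1) => //.
- by move=> a am; apply: eq_psum (psumZ (emb a) (psum_u am)) => m; rewrite embM.
- by move=> a m _ h; rewrite /c u_series_low ?mulr0.
- by move=> a m _; apply: term_le_id (@deg_le_u_series F a) (@u_series_low F a).
have := av_cvgZ tpi^-1 (Aexp_cvg (x := id) (ltn0Sn 0) (@decay_id1 _ _ C) far_Omega).
rewrite mulrC; apply: av_cvg_ext => N; rewrite mulr_sumr; apply: eq_bigr => j _.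
rewrite /monsum mulr_sumr; apply: eq_bigr => v _.
rewrite uE ?monic_neq0 ?monic_shift ?size_poly //=.
by rewrite mulrCA [tpi^-1 * _]mulrC.
Qed.

Lemma psum_h : psum (fun m => emb (ser_h F n m)) x (formH n z / tpi ^+ Q).
Proof.
pose c (a : {poly F}) m := a * pexp (u_series a) Q m.
have Q0 := ltnW (Q_gt1 F n_gt0).
apply: (@psum_monic _ _ C c (fun a => emb a * u a z ^+ Q) x _ 1) => //.
- by move=> a am; apply: eq_psum (psumZ (emb a) (psum_uX Q am)) => m; rewrite embM.
- by move=> a m _ h; rewrite /c pexp_u_series_low ?mulr0.
- move=> a m _; apply: term_le_id => [|k kq]; first exact/deg_le_pexp/deg_le_u_series.
  exact: pexp_u_series_low.
have dec m e := @decay_id R F C Q m e (Q_gt1 F n_gt0).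
have := av_cvgZ (tpi ^- Q) (Aexp_cvg (x := id) Q0 dec far_Omega).
rewrite mulrC; apply: av_cvg_ext => N; rewrite mulr_sumr; apply: eq_bigr => j _.
rewrite /monsum mulr_sumr; apply: eq_bigr => v _.
rewrite uE ?monic_neq0 ?monic_shift ?size_poly //=.
by rewrite expr_div_n -TI_expq // mul1n mulrCA [_ / tpi ^+ Q]mulrC.
Qed.

Lemma psum_sum (r : seq nat) (c : nat -> nat -> C) (s : nat -> C) y :
  (forall i, psum (c i) y (s i)) ->
  psum (fun m => \sum_(i <- r) c i m) y (\sum_(i <- r) s i).
Proof.
move=> h; elim: r => [|i r IH].
  rewrite big_nil; apply: av_cvg_ext (av_cvg_cst _ 0) => N.
  by rewrite big1 // => j _; rewrite big_nil mul0r.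
rewrite big_cons; apply: eq_psum (psumD (h i) IH) => m.
by rewrite big_cons.
Qed.

Lemma psum_g : psum (fun m => emb (ser_g F n m)) x (- formG n z / beI C n).
Proof.
have b0 := beI_neq0 n; have Q1 := Q1_gt0 F n_gt0.
have qi (i : nat) : (i < n)%N -> (0 < Q - q ^ i)%N.
  by move=> i_n; rewrite subn_gt0 ltn_exp2l ?cardF_gt1.
have dec m e := @decay_one R F C (Q - 1) m e Q1.
have -> : - formG n z / beI C n = 1 + Aexp (C := C) (fun=> 1) (Q - 1) z / beI C n.
  rewrite /formG; have -> : TI (Q - 1) 0 = - beI C n.
    by rewrite /beI; case: (n) n_gt0 => // k _; rewrite opprK.
  by field.
apply: (@eq_psum _ _ _ (fun m => emb (pone _ m) +
    emb (\sum_(j < m.+1) monsum j ((ser_ga n) ^~ m)))) => [m|]; first by rewrite -embD.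
apply: psumD; first by apply: eq_psum (psum_one _) => m; rewrite emb_pone.
pose K : R := \sum_(i < n) `|emb (gam F n i)|.
have K0 : 0 <= K by apply: sumr_ge0 => i _; exact: absval_ge0.
pose s (a : {poly F}) := \sum_(0 <= i < n) emb (gam F n i) * u a z ^+ (Q - q ^ i).
apply: (@psum_monic _ _ C (ser_ga n) s x _ K) => //.
- move=> a am; apply: eq_psum (psum_sum (index_iota 0 n)
    (fun i => psumZ (emb (gam F n i)) (psum_uX (Q - q ^ i) am))) => m.
  by rewrite big_mkord emb_sum; apply: eq_bigr => i _; rewrite embM.
- move=> a m _ h; apply: big1 => i _; rewrite pexp_u_series_low ?mulr0 //.
  exact: qi.
- move=> a m _; rewrite emb_sum mulr_suml; apply: absval_sum_le => [|i _].
    by rewrite mulr_ge0 ?cardRXV_ge0.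
  rewrite embM -mulrA absvalM; apply: ler_pM; rewrite ?absval_ge0 //.
    by rewrite /K (bigD1 i) //= lerDl sumr_ge0 // => k _; exact: absval_ge0.
  by apply: term_le1; exact/deg_le_pexp/deg_le_u_series.
have := av_cvgZ (beI C n)^-1 (Aexp_cvg (x := fun=> 1) Q1 dec far_Omega).
rewrite mulrC; apply: av_cvg_ext => N; rewrite mulr_sumr; apply: eq_bigr => j _.
rewrite /monsum mulr_sumr; apply: eq_bigr => v _.
set a := ('X^j + _)%R; have a0 : a != 0.
  by rewrite monic_neq0 ?monic_shift ?size_poly.
rewrite emb1 mul1r TI_beI => [|M]; last exact: Omega_pole_free far_Omega a0.
rewrite /s big_mkord mulr_sumr; apply: eq_bigr => i _.
have t0 := tpi_neq0 htpi.
rewrite uE // -(beI_ratio (ltnW (ltn_ord i))) expr_div_n.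
by field; rewrite b0 expf_neq0.
Qed.

(** The constant collects the normalizations making the expansions integral: [formX] is divided by
    tpi [beI C n], and each factor [formG] by [- beI C n], its value at u = 0. *)
Lemma psum_form e : psum (fun m => emb (ser_form F n e m)) x
  (formXG n (tpi * beI C n * (- beI C n) ^+ e)^-1 e z).
Proof.
have b0 := beI_neq0 n; have t0 := tpi_neq0 htpi.
have hX : psum (fun m => emb (ser_X F n m)) x (formX n z / (tpi * beI C n)).
  have := psumD (psumM psum_E psum_g) (psumZ (- emb (gam F n 0)) psum_h).
  have -> : formB z / tpi * (- formG n z / beI C n) +
      - emb (gam F n 0) * (formH n z / tpi ^+ Q) = formX n z / (tpi * beI C n).
    have tQ : tpi ^+ Q = tpi * tpi ^+ (Q - 1).
      by rewrite -exprS subn1 prednK // cardFX_gt0.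
    have gE : emb (gam F n 0) = tpi ^+ (Q - 1) / beI C n.
      rewrite beI_gam invfM invrK mulrA mulfV ?mul1r //.
      by rewrite expf_neq0.
    rewrite gE tQ /formX; field.
    by rewrite b0 t0 expf_neq0.
  apply: eq_psum => m; rewrite /ser_X embD embN embM emb_pmul mulNr.
  by [].
rewrite /formXG; have -> : (tpi * beI C n * (- beI C n) ^+ e)^-1 *
    (formX n z * formG n z ^+ e) =
    formX n z / (tpi * beI C n) * (- formG n z / beI C n) ^+ e.
  have -> : - formG n z / beI C n = formG n z / - beI C n.
    by rewrite invrN mulrN mulNr.
  have nb0 : (- beI C n) ^+ e != 0 by rewrite expf_neq0 // oppr_eq0.
  rewrite expr_div_n; move: ((- beI C n) ^+ e) nb0 => b1 b1_neq0.
  by field; rewrite b0 t0 b1_neq0.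
apply: eq_psum (psumM hX (psumX e psum_g)) => m.
by rewrite emb_pmul; apply: eq_pmul => i _ //; rewrite emb_pexp.
Qed.

End UExpansion.

(** * The v-adic limit *)

Section Congruences.
Variables (F : finFieldType) (wp : {poly F}).
Hypotheses (wp_monic : wp \is monic) (wp_irr : irreducible_poly wp).
Local Notation q := #|F|.

(** In the residue field A / wp, with q^deg wp elements, raising to the power q^deg wp is the
    identity. The computation takes place in that quotient and is then read on remainders modulo
    wp. *)
Lemma dvdp_XqX k : wp %| 'X ^+ (q ^ (deg wp * k)) - 'X.
Proof.
have hI : monic_irreducible_poly wp by [].
pose y : {poly %/ wp with hI} := in_qpoly wp 'X.
have yq : y ^+ (q ^ (deg wp * k)) = y.
  have yd : y ^+ (q ^ deg wp) = y by have := expf_card y; rewrite card_qfpoly.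
  elim: k => [|k IH]; first by rewrite muln0 expn0 expr1.
  by rewrite mulnS expnD exprM yd IH.
have dvd_modp (a : {poly F}) : wp %| a - a %% wp.
  by rewrite {1}(divp_eq a wp) addrK dvdp_mull.
have yE : (y : {poly F}) = 'X %% wp.
  by rewrite /y /= (mk_monicE hI) Pdiv.IdomainMonic.modpE.
set N := (q ^ _)%N in yq *.
set Y := 'X %% wp in yE.
have YN : Y ^+ N %% wp = Y.
  have := poly_of_qpolyX (y : {poly %/ wp}) N.
  rewrite (yq : (y : {poly %/ wp}) ^+ N = y) yE (mk_monicE hI).
  by rewrite -Pdiv.IdomainMonic.modpE.
have -> : 'X ^+ N - 'X = ('X ^+ N - Y ^+ N) + (Y ^+ N - Y ^+ N %% wp) - ('X - Y).
  by rewrite YN; ring.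
apply: dvdp_sub; last exact: dvd_modp.
apply: dvdp_add; last exact: dvd_modp.
by rewrite subrXX dvdp_mulr // dvd_modp.
Qed.

(** The factor of index n - 1, present for every i < n, is theta - theta^(q^n), and [dvdp_XqX]
    applies to it. *)
Lemma dvdp_gam n i : (0 < n)%N -> (i < n)%N -> (deg wp %| n)%N -> wp %| gam F n i.
Proof.
case: n => // n _ i_n /dvdnP[k nk]; rewrite /gam big_nat_recr //= dvdp_mull //.
by rewrite nk mulnC -dvdpNr opprB dvdp_XqX.
Qed.

Lemma deg_wp_gt0 : (0 < deg wp)%N.
Proof. by have [s1 _] := wp_irr; rewrite /deg; case: (size wp) s1 => [|[|]]. Qed.

(** Each block of [deg wp] consecutive factors contributes one divisor wp, through its last
    factor. *)
Lemma dvdp_gam_pow i : wp ^+ i %| gam F (deg wp * i) 0.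
Proof.
have d0 := deg_wp_gt0.
elim: i => [|i IH]; first by rewrite expr0 dvd1p.
have ii : (deg wp * i <= deg wp * i.+1)%N by rewrite leq_mul2l leqnSn orbT.
rewrite /gam (big_cat_nat (n := deg wp * i)) //= exprSr dvdp_mul //.
apply: dvdp_gam; rewrite ?muln_gt0 ?d0 ?dvdn_mulr //.
by rewrite ltn_mul2l d0 /=.
Qed.

Lemma dvdp_coef (P : {poly {poly F}}) (a : {poly F}) m : a %| (a%:P * P)`_m.
Proof. by rewrite coefCM dvdp_mulr. Qed.

(* Since [g = 1 mod wp], one has [g^(p^i) = 1 mod wp^(p^i)]. *)
Lemma dvdp_ser_form (p i n : nat) m : p \in [pchar F] -> (0 < n)%N ->
  (deg wp %| n)%N -> wp ^+ i %| gam F n 0 ->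
  wp ^+ i %| ser_form F n (p ^ i - 1) m - false_eisenstein F m.
Proof.
move=> pF n0 dn dL; have pp : prime p := pcharf_prime pF.
have pX : p \in [pchar {poly {poly F}}].
  by rewrite inE pp /= -(rmorph_nat polyC) -(rmorph_nat polyC) (pcharf0 pF) !rmorph0.
(* The coefficient of u^m only depends on the truncations at m + 1; with them the computation
   becomes one in a polynomial ring of characteristic p, where Frobenius is additive. *)
pose N := m.+1; set Eis := trunc N (@false_eisenstein F).
set g := trunc N (ser_g F n); set h := trunc N (ser_h F n).
have gE : exists y, g = 1 + wp%:P * y.
  exists (trunc N (fun k => (ser_g F n k - pone _ k) %/ wp)); apply/polyP => k.
  rewrite coefD coef1 coefCM !coef_poly; case: ltnP => kN; last first.
    by rewrite mulr0 addr0; move: kN; case: k.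
  rewrite mulrC divpK; first by rewrite addrC subrK.
  rewrite /ser_g [X in X - _]addrC addrK.
  apply: (big_ind (fun a => wp %| a)) => [||j _]; [exact: dvdp0|exact: dvdp_add|].
  apply: (big_ind (fun a => wp %| a)) => [||v _]; [exact: dvdp0|exact: dvdp_add|].
  apply: (big_ind (fun a => wp %| a)) => [||l _]; [exact: dvdp0|exact: dvdp_add|].
  by rewrite dvdp_mulr // dvdp_gam.
have [y gy] := gE; set c := gam F n 0 in dL *.
have -> : ser_form F n (p ^ i - 1) m =
    ((Eis * g - c%:P * h) * g ^+ (p ^ i - 1))`_m.
  rewrite -coef_pmul; apply: eq_pmul => k km; last first.
    by rewrite (@pexp_trunc _ N) // (leq_ltn_trans km).
  by rewrite /ser_X coefB coefCM (@pmul_trunc _ N) ?coef_trunc // (leq_ltn_trans km).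
have pi0 : (0 < p ^ i)%N by rewrite expn_gt0 prime_gt0.
have -> : (Eis * g - c%:P * h) * g ^+ (p ^ i - 1) =
    Eis + (wp ^+ (p ^ i))%:P * (Eis * y ^+ (p ^ i)) - c%:P * (h * g ^+ (p ^ i - 1)).
  have E : g * g ^+ (p ^ i - 1) = 1 + (wp ^+ (p ^ i))%:P * y ^+ (p ^ i).
    rewrite -exprS subn1 prednK // {1}gy exprDn_pchar.
      by rewrite expr1n exprMn polyC_exp.
    by rewrite (eq_pnat _ (pcharf_eq pX)) pnatX pnat_id.
  by rewrite mulrBl -mulrA E; ring.
have cancel_ends (r s t : {poly F}) : r + s - t - r = s - t by ring.
rewrite coefB coefD coef_trunc // cancel_ends.
apply: dvdp_sub; last by apply: dvdp_trans dL _; exact: dvdp_coef.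
apply: dvdp_trans (dvdp_coef _ _ _); apply: dvdp_exp2l.
by rewrite ltnW // ltn_expl // prime_gt1.
Qed.

End Congruences.

Section VadicLimit.
Variables (R : realType) (F : finFieldType) (wp : {poly F}).
Hypotheses (wp_monic : wp \is monic) (wp_irr : irreducible_poly wp).
Variable Kv : completion_at R wp.
Local Notation q := #|F|.

(** The normalization [Kv_absE] concerns wp^n b with b prime to wp, so the exact power of wp is
    first extracted from the cofactor, by induction on its size. *)
Lemma Kv_abs_le i (a : {poly F}) : wp ^+ i %| a ->
  Kv_abs Kv (Kv_inj Kv (injA a)) <= q%:R ^- i.
Proof.
have [->|a0] := eqVneq a 0.
  by rewrite /injA tofrac0 rmorph0 absval0 cardRXV_ge0.
move=> /dvdpP[b ab].
have b0 : b != 0 by apply: contra_neq a0 => b0; rewrite ab b0 mul0r.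
have [k [c cwp bE]] : exists k, exists2 c, ~~ (wp %| c) & b = wp ^+ k * c.
  have s1 : (1 < size wp)%N by have [] := wp_irr.
  move: {2}(size b) (leqnn (size b)) b0 => s {ab}; elim: s b => [|s IH] b bs b0.
    by move: b0; rewrite -size_poly_eq0 -leqn0 bs.
  have [/dvdpP[b' bb']|ndvd] := boolP (wp %| b); last first.
    by exists 0%N, b; rewrite // mul1r.
  have b'0 : b' != 0 by apply: contra_neq b0 => e; rewrite bb' e mul0r.
  have sb' : (size b' <= s)%N.
    move: bs; rewrite bb' size_mul ?(monic_neq0 wp_monic) //.
    by move: (size b') (size wp) s1 => x y; lia.
  have [k [c cwp b'E]] := IH b' sb' b'0.
  by exists k.+1; exists c => //; rewrite bb' b'E exprS mulrC mulrA.
rewrite ab bE mulrAC -exprD mulrC mulrC Kv_absE //.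
by apply: cardRXV_le; rewrite leq_addl.
Qed.

Lemma vnorm_le (f : nat -> Kv) (B : R) : (forall n, Kv_abs Kv (f n) <= B) ->
  (vnorm f <= B%:E)%E.
Proof. by move=> h; apply: ub_ereal_sup => _ [n _ <-]; rewrite lee_fin. Qed.

Lemma vnorm_ge0 (f : nat -> Kv) : (0 <= vnorm f)%E.
Proof.
apply: (@le_trans _ _ (Kv_abs Kv (f 0%N))%:E); first by rewrite lee_fin absval_ge0.
by apply: ereal_sup_ubound; exists 0%N.
Qed.

Lemma vnorm_cvg0 (f : nat -> nat -> Kv) :
  (forall i n, Kv_abs Kv (f i n) <= q%:R ^- i) ->
  (fun i => vnorm (f i)) @ \oo --> (0 : \bar R).
Proof.
move=> h; apply: (@squeeze_cvge _ _ _ _ (fun=> 0%E) _ (fun i => (q%:R ^- i)%:E)).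
- by apply: nearW => i; rewrite vnorm_ge0 vnorm_le.
- exact: cvg_cst.
apply: cvg_EFin; first exact: nearW.
apply/cvgrPdist_le => e e0; have [N hN] := @cardRXV_small R F e e0.
exists N => // n /= Nn; rewrite sub0r normrN ger0_norm ?cardRXV_ge0 //.
by apply: le_trans hN; exact: cardRXV_le.
Qed.

End VadicLimit.

Lemma res_of_int_eq (N : nat) (a b c : int) : a = b + c * N%:Z ->
  res_of_int N a = res_of_int N b.
Proof. by move=> ->; rewrite /res_of_int addrC modzMDl. Qed.

Unset Implicit Arguments.

Theorem theorem6p4 (R : realType) (F : finFieldType)
  (p : nat) (hp : prime p) (hF : p \in [pchar F])
  (wp : {poly F}) (hmonic : wp \is monic) (hirr : irreducible_poly wp)
  (Kv : completion_at R wp) (C : complex_infty R F)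
  (tpi : C) (htpi : carlitz_period tpi) :
  vadic_modular_int tpi hp (weight_of_int #|F| (deg wp) hp 2) 1
    (fun n : nat => Kv_inj Kv (injA (false_eisenstein F n))).
Proof.
have integral m : Kv_abs Kv (Kv_inj Kv (injA (false_eisenstein F m))) <= 1.
  have := Kv_abs_le (i := 0) (a := false_eisenstein F m) hmonic hirr Kv.
  by rewrite !expr0 invr1; apply; exact: dvd1p.
split; last exact: integral.
split; first by apply: le_lt_trans (vnorm_le integral) _; exact: ltry.
(* The successor keeps n positive, as weight q^n - 1 requires; wp^(i + 1), hence wp^i, still divides
   [gam F (n i) 0]. *)
pose n i := (deg wp * i.+1)%N; have n0 i : (0 < n i)%N.
  by rewrite muln_gt0 (deg_wp_gt0 hirr).
pose e i := (p ^ i - 1)%N.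
pose k i := ((#|F| ^ n i).+1 + (#|F| ^ n i - 1) * e i)%N.
have kE i : k i = (2 + p ^ i * (#|F| ^ n i - 1))%N.
  have := cardFX_gt0 F (n i); have : (0 < p ^ i)%N by rewrite expn_gt0 prime_gt0.
  by rewrite /k /e; move: (p ^ i)%N (#|F| ^ n i)%N => x y; nia.
exists (fun i => (k i)%:Z), (fun i m => injA (ser_form F (n i) (e i) m)); split.
- move=> i; exists (formXG (n i) (tpi * beI C (n i) * (- beI C (n i)) ^+ e i)^-1 (e i)).
  split; [exact: formXG_rigid|exact: formXG_modular|].
  exists (#|F|%:R ^+ 3 / Coo_abs C tpi) => [|z far].
    by rewrite divr_gt0 ?cardRX_gt0 // absval_gt0 (tpi_neq0 htpi).
  exact: psum_form.
- apply: vnorm_cvg0 => i m; rewrite -rmorphB -tofracB.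
  apply: Kv_abs_le => //; apply: dvdp_ser_form => //; first exact: dvdn_mulr.
  apply: dvdp_trans (dvdp_gam_pow hmonic hirr i.+1).
  by rewrite dvdp_exp2l.
split=> [|N].
  (* As deg wp divides n, q^(deg wp) - 1 divides q^n - 1, so this component of the weight equals
     that of 2 for every i; p-adically, p^i makes it agree with 2 modulo p^N as soon as i >= N. *)
  apply: nearW => i; apply: (@res_of_int_eq _ _ _
    (p ^ i * ((#|F| ^ n i - 1) %/ (#|F| ^ deg wp - 1)))%N%:Z).
  have dv : (#|F| ^ deg wp - 1 %| #|F| ^ n i - 1)%N.
    by rewrite /n expnM !subn1 [X in (_ %| X)%N]predn_exp dvdn_mulr.
  by rewrite kE -PoszM -mulnA divnK.
exists N => // i /= Ni; apply: (@res_of_int_eq _ _ _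
    (p ^ (i - N) * (#|F| ^ n i - 1))%N%:Z).
by rewrite kE -PoszM mulnAC -expnD subnK.
Qed.
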